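(* Let $X$ be a locally compact Hausdorff space, let $H$ be a complex Hilbert space, and let $\pi\colon C_0(X;\mathbb C)\to B(H)$ be a $^*$-homomorphism. Set $A=\overline{\pi(C_0(X;\mathbb C))}^{\,\mathrm{SOT}}$, and let $\mu$ be the regular Borel measure on $X$ with values in the extended positive cone of $A_{\mathrm{sa}}$ that represents $\pi$. Suppose that $A_{\mathrm{sa}}=\overline{\pi(C_0(X))}^{\,\mathrm{SOT}}$ has the countable sup property or, equivalently, that $A$ is $\sigma$-finite; this is certainly the case when $H_{\mathrm{nd}}$ is separable. Then: $$A=I_\mu(\mathrm B(X,\mathscr B,\mu;\mathbb C));$$ $$A_{\mathrm{sa}}=I_\mu(\mathrm B(X,\mathscr B,\mu;\mathbb R))=[\pi(C_c(X))]^{\uparrow\downarrow}=[\pi(C_c(X))]^{\downarrow\uparrow};$$ $$A_{\mathrm{sa}}^+=I_\mu(\mathrm B(X,\mathscr B,\mu;\mathbb R^+))=I_\mu\big([\![C_c(X)^+]\!]^{\downarrow\uparrow}\big)=[\pi(C_c(X)^+)]^{\downarrow\uparrow}=I_\mu\big([\![C_c(X)^+]\!]^{\uparrow\downarrow}\big)=[\pi(C_c(X)^+)]^{\uparrow\downarrow}.$$ Consequently, $I_\mu\colon\mathrm B(X,\mathscr B,\mu;\mathbb C)\to A$ is an isomorphism.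
   Context: $C_c(X)$ and $C_0(X)$ are the real-valued continuous functions on $X$ with compact support, resp. vanishing at infinity; $C_0(X;\mathbb C)$ is the complex-valued version of the latter. $B(H)$ is the algebra of bounded operators on $H$; SOT is the strong operator topology. $\pi$ need not be non-degenerate. $A$ is a commutative SOT-closed $C^*$-subalgebra of $B(H)$ (not necessarily containing the identity operator), and $A_{\mathrm{sa}}$, the real algebra of its self-adjoint elements with the ordering inherited from $B(H)_{\mathrm{sa}}$, is a monotone complete vector lattice algebra, with positive cone $A_{\mathrm{sa}}^+$. $H_{\mathrm{nd}}=\overline{\mathrm{Span}\{\pi(f)x:f\in C_0(X;\mathbb C),x\in H\}}$. $A$ is $\sigma$-finite if every subset of $A$ consisting of non-zero mutually orthogonal self-adjoint projections is countable. A partially ordered vector space $F$ has the countable sup property if, for every net $(x_\lambda)\subseteq F^+$ and $x\in F^+$ with $x_\lambda\uparrow x$ (increasing with supremum $x$), there is a countable set of indices $\{\lambda_n\}$ with $x=\sup_nx_{\lambda_n}$. Measures and order integral (with $F=A_{\mathrm{sa}}$, $\mathbb R^+=[0,\infty)$): $\overline F=F\cup\{\infty\}$ with $\infty$ as largest element, $\overline{F^+}=F^+\cup\{\infty\}$. With $\mathscr B$ the Borel $\sigma$-algebra of $X$ (generated by the open sets), a measure $\mu\colon\mathscr B\to\overline{F^+}$ is a map with $\mu(\emptyset)=0$ and $\mu(\bigcup_n\Delta_n)=\bigvee_{N}\sum_{n=1}^N\mu(\Delta_n)$ in $\overline F$ for pairwise disjoint sequences in $\mathscr B$. It is a regular Borel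 measure if $\mu(K)\in F$ for all compact $K$, $\mu(V)=\bigvee\{\mu(K):K\subseteq V\text{ compact}\}$ in $\overline F$ for all open $V$, and $\mu(\Delta)=\bigwedge\{\mu(V):V\supseteq\Delta\text{ open}\}$ in $\overline F$ for all Borel $\Delta$. For $\varphi=\sum_{i=1}^n r_i\chi_{\Delta_i}$ with $r_i\in\mathbb R^+$ and disjoint Borel $\Delta_i$, $\int_X^{o}\varphi\,d\mu=\sum r_i\mu(\Delta_i)$; for Borel $f\colon X\to[0,\infty]$, $\int_X^{o}f\,d\mu=\bigvee_n\int_X^{o}\varphi_n\,d\mu$ for any sequence of such $\varphi_n\uparrow f$ pointwise; for real-valued $f$ with $\int_X^{o}|f|\,d\mu\in F$, one sets $\int_X^{o}f\,d\mu=\int_X^{o}f^+d\mu-\int_X^{o}f^-d\mu$; this is extended complex linearly to complex-valued functions. The measure $\mu$ representing $\pi$ is the unique regular Borel measure $\mu\colon\mathscr B\to\overline{A_{\mathrm{sa}}^+}$ such that $\pi(f)=\int_X^{o}f\,d\mu$ for all $f\in C_c(X)$; it exists, and it is finite ($\mu(X)\in A_{\mathrm{sa}}$) and spectral ($\mu(\Delta_1\cap\Delta_2)=\mu(\Delta_1)\mu(\Delta_2)$). $\mathrm B(X,\mathscr B,\mu;\mathbb C)$ is the space of bounded complex-valued Borel functions modulo those vanishing $\mu$-a.e.; $\mathrm B(X,\mathscr B,\mu;\mathbb R)$ is its real-valued version, with positive cone $\mathrm B(X,\mathscr B,\mu;\mathbb R^+)$; in this context it coincides with the space $L^1(X,\mathscr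 B,\mu;\mathbb R)$ of $\mu$-integrable functions modulo almost everywhere equality. $I_\mu(f)=\int_X^{o}f\,d\mu$. $[\![S]\!]$ denotes the set of equivalence classes of the elements of $S$. For a non-empty subset $S$ of a partially ordered vector space $F$, $S^{\uparrow}$ is the set of all $x\in F$ for which there is an increasing sequence in $S$ with supremum $x$ in $F$, and $S^{\downarrow}$ is defined similarly with decreasing sequences and infima; $S^{\uparrow\downarrow}=(S^\uparrow)^\downarrow$, $S^{\downarrow\uparrow}=(S^\downarrow)^\uparrow$. For subsets of $A_{\mathrm{sa}}$ these are taken in $A_{\mathrm{sa}}$; for $[\![C_c(X)^+]\!]$ they are taken in $\mathrm B(X,\mathscr B,\mu;\mathbb R)$. *)

(* Defs.v *)
From HB Require Import structures.
From mathcomp Require Import all_boot all_order all_algebra.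
From mathcomp Require Import all_classical all_reals all_analysis.
From mathcomp Require Import sesquilinear complex.

Set Implicit Arguments.
Unset Strict Implicit.
Unset Printing Implicit Defensive.

Import Order.TTheory GRing.Theory Num.Theory.
Import numFieldNormedType.Exports.

Local Open Scope classical_set_scope.
Local Open Scope ring_scope.

Section order_notions.
Context {T : Type} (le : T -> T -> Prop).
Implicit Types (F S : set T) (x : T).

(* [F] is the ordered set in which suprema and infima are taken, with the
   restriction of [le] as its order. *)
Definition is_sup F S x :=
  [/\ F x, (forall y, S y -> le y x)
    & forall z, F z -> (forall y, S y -> le y z) -> le x z].

Definition is_inf F S x :=
  [/\ F x, (forall y, S y -> le x y)
    & forall z, F z -> (forall y, S y -> le z y) -> le z x].

Definition seq_up F S : set T := [set x | exists s : nat -> T,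
  [/\ (forall n, S (s n)), (forall n, le (s n) (s n.+1))
    & is_sup F (range s) x]].

Definition seq_down F S : set T := [set x | exists s : nat -> T,
  [/\ (forall n, S (s n)), (forall n, le (s n.+1) (s n))
    & is_inf F (range s) x]].

Definition countable_sup_property F (Fpos : set T) :=
  forall (I : Type) (leI : I -> I -> Prop) (u : I -> T) (x : T),
    inhabited I ->
    (forall i, leI i i) ->
    (forall i j k, leI i j -> leI j k -> leI i k) ->
    (forall i j, exists k, leI i k /\ leI j k) ->
    (forall i, Fpos (u i)) -> Fpos x ->
    (forall i j, leI i j -> le (u i) (u j)) ->
    is_sup F (range u) x ->
  exists l : nat -> I, is_sup F (range (u \o l)) x.

End order_notions.

Section function_spaces.
Context (X : topologicalType) (K : numFieldType).

Definition C0 : set (X -> K) := [set f | continuous f /\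
  forall e : K, 0 < e ->
    exists2 D : set X, compact D & forall x, ~ D x -> `|f x| < e].

Definition Cc : set (X -> K) :=
  [set f | continuous f /\ compact (closure [set x | f x != 0])].

Definition borel : set (set X) := <<s [set U : set X | open U] >>.

Definition bounded_borel : set (X -> K) :=
  [set f | (forall U : set K, open U -> borel (f @^-1` U)) /\
           exists M : K, forall x, `|f x| <= M].

End function_spaces.

Arguments C0 : clear implicits.
Arguments Cc : clear implicits.
Arguments borel : clear implicits.
Arguments bounded_borel : clear implicits.

Definition Cc_pos (X : topologicalType) (R : realType) : set (X -> R) :=
  [set f | Cc X R f /\ forall x, 0 <= f x].

Arguments Cc_pos : clear implicits.

Definition toC (R : realType) (X : Type) (f : X -> R) : X -> R[i] :=
  fun x => (f x)%:C%C.

(* Operators are functions [H -> H], with their pointwise linear structure and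
   composition as product; [bounded_op] singles out B(H). *)
Section operators.
Context {R : realType} {H : completeNormedModType R[i]}.
Context (dot : {dot H for Num.conj}).
Implicit Types (S T : H -> H) (A : set (H -> H)).

Definition bounded_op : set (H -> H) :=
  [set T | linear T /\ exists M : R[i], forall x, `|T x| <= M * `|x|].

Definition is_adjoint T S := forall x y, dot (T x) y = dot x (S y).

Definition selfadjoint T := is_adjoint T T.

Definition op_le S T := forall x, 0 <= dot (T x - S x) x.

(* The strong operator topology is the topology of pointwise convergence. *)
Definition sot_closure A : set (H -> H) :=
  bounded_op `&` closure (A : set {ptws H -> H}).

Definition sa_part A : set (H -> H) := [set T | A T /\ selfadjoint T].

Definition sa_pos A : set (H -> H) := [set T | sa_part A T /\ op_le 0 T].

Definition is_projection T := selfadjoint T /\ T \o T = T.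

Definition algebra_sigma_finite A := forall P : set (H -> H), P `<=` A ->
  (forall p, P p -> is_projection p /\ p <> 0) ->
  (forall p q, P p -> P q -> p <> q -> p \o q = 0) ->
  countable P.

(* Only the values of [pi] on C_0(X; C) matter. *)
Definition star_homomorphism (X : topologicalType)
    (pi : (X -> R[i]) -> H -> H) :=
  [/\ (forall f, C0 X R[i] f -> bounded_op (pi f)),
      (forall (a : R[i]) f g, C0 X R[i] f -> C0 X R[i] g ->
         pi (a *: f + g) = a *: pi f + pi g),
      (forall f g, C0 X R[i] f -> C0 X R[i] g ->
         pi (f \* g) = pi f \o pi g)
    & (forall f, C0 X R[i] f ->
         is_adjoint (pi f) (pi (fun x => Num.conj (f x))))].

Definition linear_span (S : set H) : set H := [set y |
  exists n (a : 'I_n -> R[i]) (v : 'I_n -> H),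
    (forall i, S (v i)) /\ y = \sum_(i < n) a i *: v i].

Definition nondegenerate_part (X : topologicalType)
    (pi : (X -> R[i]) -> H -> H) : set H :=
  closure (linear_span
    [set y | exists2 f, C0 X R[i] f & exists x, y = pi f x]).

Definition separable_set (S : set H) :=
  exists D : set H, [/\ countable D, D `<=` S & S `<=` closure D].

End operators.

(* [option V] is V with a largest element [None] = infinity added. *)
Section extended.
Context {R : realType} {V : lmodType R[i]} (le : V -> V -> Prop) (F : set V).

Definition ext_le (a b : option V) : Prop :=
  match a, b with
  | _, None => True
  | None, Some _ => False
  | Some v, Some w => le v w
  end.

Definition ext_space : set (option V) :=
  [set a | if a is Some v then F v else True].

Definition ext_pos : set (option V) :=
  [set a | if a is Some v then F v /\ le 0 v else True].

Definition ext_add (a b : option V) : option V :=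
  if (a, b) is (Some v, Some w) then Some (v + w) else None.

(* For r >= 0, with the convention 0 * infinity = 0. *)
Definition ext_scale (r : R) (a : option V) : option V :=
  if a is Some v then Some (r%:C%C *: v) else if r == 0 then Some 0 else None.

End extended.

Section measure_and_order_integral.
Context {R : realType} {X : topologicalType} {V : lmodType R[i]}.
Context (le : V -> V -> Prop) (F : set V) (mu : set X -> option V).

Local Notation ext_sup := (is_sup (ext_le le) (ext_space F)).
Local Notation ext_inf := (is_inf (ext_le le) (ext_space F)).

Definition is_vmeasure :=
  [/\ (forall D, borel X D -> ext_pos le F (mu D)),
      mu set0 = Some 0
    & forall D : nat -> set X, (forall n, borel X (D n)) -> trivIset setT D ->
      ext_sup (range (fun N => \big[@ext_add R V/Some 0]_(n < N.+1) mu (D n)))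
              (mu (\bigcup_n D n))].

Definition regular_borel_measure :=
  [/\ is_vmeasure,
      (forall K, compact K -> exists2 v, F v & mu K = Some v),
      (forall U, open U ->
         ext_sup [set mu K | K in [set K | compact K /\ K `<=` U]] (mu U))
    & (forall D, borel X D ->
         ext_inf [set mu U | U in [set U | open U /\ D `<=` U]] (mu D))].

Record simple_fun := SimpleFun {
  sf_size : nat;
  sf_coef : 'I_sf_size -> R;
  sf_set : 'I_sf_size -> set X;
  sf_coef_ge0 : forall i, 0 <= sf_coef i;
  sf_set_borel : forall i, borel X (sf_set i);
  sf_set_disjoint : trivIset setT sf_set }.

Definition sf_val (phi : simple_fun) (x : X) : R :=
  \sum_(i < sf_size phi) sf_coef i * \1_(sf_set i) x.

Definition sf_oint (phi : simple_fun) : option V :=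
  \big[@ext_add R V/Some 0]_(i < sf_size phi) ext_scale (sf_coef i) (mu (sf_set i)).

Definition is_oint_pos (f : X -> \bar R) (a : option V) :=
  exists phi : nat -> simple_fun,
    [/\ (forall n x, sf_val (phi n) x <= sf_val (phi n.+1) x),
        (forall x, (sf_val (phi n) x)%:E @[n --> \oo] --> f x)
      & ext_sup (range (fun n => sf_oint (phi n))) a].

Definition oint_pos (f : X -> \bar R) : option V :=
  xget None (is_oint_pos f).

Definition ointegrable (f : X -> R) :=
  exists2 v, F v & oint_pos (fun x => `|f x|%:E) = Some v.

(* Meaningful for integrable [f]; an infinite part is replaced by 0. *)
Definition oint (f : X -> R) : V :=
  odflt 0 (oint_pos (EFin \o f^\+)) - odflt 0 (oint_pos (EFin \o f^\-)).

Definition ointegrableC (f : X -> R[i]) :=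
  ointegrable (fun x => complex.Re (f x)) /\
  ointegrable (fun x => complex.Im (f x)).

Definition ointC (f : X -> R[i]) : V :=
  oint (fun x => complex.Re (f x)) +
  (0 +i* 1)%C *: oint (fun x => complex.Im (f x)).

Definition mu_ae (P : X -> Prop) :=
  exists N, [/\ borel X N, mu N = Some 0 & forall x, ~ N x -> P x].

Definition ae_class (K : numFieldType) (f : X -> K) : set (X -> K) :=
  [set g | bounded_borel X K g /\ mu_ae (fun x => f x = g x)].

(* The elements of B(X, mu; K) are classes of functions, as sets. *)
Definition bspace (K : numFieldType) : set (set (X -> K)) :=
  [set ae_class f | f in bounded_borel X K].

Arguments bspace : clear implicits.

Definition class_le (c d : set (X -> R)) :=
  exists f g, [/\ c f, d g & mu_ae (fun x => f x <= g x)].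

Definition bspace_pos : set (set (X -> R)) :=
  [set c | bspace R c /\ class_le (ae_class (cst 0)) c].

(* Integrals of classes, computed on a chosen representative. *)
Definition Imu (c : set (X -> R)) : V := oint (xget (cst 0) c).

Definition ImuC (c : set (X -> R[i])) : V := ointC (xget (cst 0) c).

End measure_and_order_integral.

Arguments ae_class {R X V} mu {K} f.
Arguments bspace {R X V} mu K.

Definition represents {R : realType} {H : completeNormedModType R[i]}
    (dot : {dot H for Num.conj}) (F : set (H -> H)) (X : topologicalType)
    (mu : set X -> option (H -> H)) (pi : (X -> R[i]) -> H -> H) :=
  regular_borel_measure (op_le dot) F mu /\
  forall f : X -> R, Cc X R f ->
    ointegrable (op_le dot) F mu f /\
    pi (toC f) = oint (op_le dot) F mu f.

(* [J] is a *-isomorphism of B(X, mu; C) onto [A]; the algebra operations on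
   classes are those of representatives. *)
Definition star_isomorphism {R : realType} {H : completeNormedModType R[i]}
    (dot : {dot H for Num.conj}) (X : topologicalType)
    (mu : set X -> option (H -> H)) (A : set (H -> H))
    (J : set (X -> R[i]) -> H -> H) :=
  let B := bounded_borel X R[i] in
  let cl := ae_class mu (K := R[i]) in
  [/\ set_bij (bspace mu R[i]) A J,
      (forall (a : R[i]) f g, B f -> B g ->
         J (cl (a *: f + g)) = a *: J (cl f) + J (cl g)),
      (forall f g, B f -> B g -> J (cl (f \* g)) = J (cl f) \o J (cl g))
    & (forall f, B f ->
         is_adjoint dot (J (cl f)) (J (cl (fun x => Num.conj (f x)))))].

(* Main.v *)
(* Everything is expressed by the quadratic forms [qf T x = Re <T x, x>], which
   determine a self-adjoint [T] and its order.  For each [x], [qf (mu D) x] is a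
   finite scalar measure, and the order integral [oint f] is the operator whose
   form at [x] is the Lebesgue integral of [f]; [mu] is finite by comparison with
   [pi f <= 1] on compact sets, and spectral by approximation on open sets and a
   Dynkin argument, whence [|oint f x|^2] is the integral of [f^2].
   The countable sup property yields sigma-finiteness, and sigma-finiteness a
   sequence [xi] separating [A].  For [T] self-adjoint in [A], approximate [T] at
   [xi 0, ..., xi n] within [2^-n] by [pi (f n)] with [f n] in Cc; truncating [f n]
   to the spectral bounds [a <= T <= b] does not spoil the approximation.  The
   partial maxima of [f n, f n+1, ...] increase to [G n], and [G n] decreases to
   some [F] with [oint F = T] at every [xi j], because [f] converges summably fast
   for the measures at [xi j].  Hence [T] is a decreasing limit of increasing
   limits, and [oint] is onto. *)

From HB Require Import structures.
Require Import Defs.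
From mathcomp Require Import all_boot all_order all_algebra.
From mathcomp Require Import all_classical all_reals all_analysis.
From mathcomp Require Import sesquilinear complex.
From mathcomp Require Import ring lra measurable_realfun.

Set Implicit Arguments.
Unset Strict Implicit.
Unset Printing Implicit Defensive.

Import Order.TTheory GRing.Theory Num.Theory.
Import numFieldNormedType.Exports.

Local Open Scope classical_set_scope.
Local Open Scope ring_scope.

(** * Quadratic forms of symmetric operators *)

(** Two obstacles shape the proof. The order integral is defined by suprema in an extended space and
    a choice among admissible values, so it resists direct computation; its quadratic form does not.
    And [A] need not contain the identity, so constructions in [A] (range projections, supports,
    complements) avoid it, and [mu setT] is not taken to be the identity.

    The spectral theorem is in effect what is proved, so substitutes are needed. Commutativity makes
    the members of [A] normal, which gives adjoints and self-adjoint approximants. Suprema of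
    bounded directed families are strong limits, which gives projections. The truncation argument
    stands in for Kaplansky's density theorem: dominated convergence needs uniform bounds. Bounds of
    the form [0 <= T <= b] yield nonnegative functions, so one construction serves [A_sa] and its
    positive cone; applied to [- T] it yields the opposite order of limits. A separating sequence is
    needed because a sequence of functions can only be controlled at countably many vectors. *)

Section hilbert.
Context {R : realType} {H : completeNormedModType R[i]}.
Context (dot : {dot H for Num.conj}).
Implicit Types (x y z : H) (r s : R) (S T : H -> H).

(** A real inner product on [H]. It suffices for symmetric operators, and [dotE] recovers the
    imaginary part of [dot] from it. *)
Definition rdot x y : R := complex.Re (dot x y).
(** Norms over [R[i]] are complex numbers with zero imaginary part; [nrm] moves them to [R], whose
    order is total. *)
Definition nrm x : R := complex.Re `|x|.

Lemma normE x : `|x| = ((nrm x)%:C)%C.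
Proof.
have := normr_ge0 x; rewrite /nrm; case: (`|x|) => a b; rewrite lecE /=.
by case/andP => /eqP->.
Qed.

Lemma nrm_ge0 x : 0 <= nrm x.
Proof. by have := normr_ge0 x; rewrite normE lecR. Qed.

Lemma nrmD x y : nrm (x + y) <= nrm x + nrm y.
Proof. by have := ler_normD x y; rewrite !normE -rmorphD lecR. Qed.

Lemma nrmN x : nrm (- x) = nrm x.
Proof. by rewrite /nrm normrN. Qed.

Lemma nrmBC x y : nrm (x - y) = nrm (y - x).
Proof. by rewrite -nrmN opprB. Qed.

Lemma nrm_eq0 x : nrm x = 0 -> x = 0.
Proof. by move=> x0; apply/normr0_eq0; rewrite normE x0. Qed.

Lemma nrm0 : nrm 0 = 0.
Proof. by rewrite /nrm normr0. Qed.

Lemma nrm_tri x y z : nrm (x - z) <= nrm (x - y) + nrm (y - z).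
Proof. by apply: le_trans (nrmD _ _); rewrite addrA subrK. Qed.

Lemma nrmZ r x : nrm ((r%:C)%C *: x) = `|r| * nrm x.
Proof.
rewrite /nrm normrZ normE /= expr0n /= addr0 sqrtr_sqr.
by rewrite mul0r subr0.
Qed.

Lemma nrmZC (a : R[i]) x : nrm (a *: x) = complex.Re `|a| * nrm x.
Proof. by rewrite /nrm normrZ normE; case: a => a b; rewrite /= mulr0 subr0. Qed.

Lemma cabs_ge0 (a : R[i]) : 0 <= complex.Re `|a|.
Proof. by case: a => a b /=; exact: sqrtr_ge0. Qed.

Lemma natSinv_small (e : R) : 0 < e ->
  exists N, forall n, (N <= n)%N -> n.+1%:R^-1 < e.
Proof. by move=> e0; have [N _ hN] := near_infty_natSinv_lt (PosNum e0); exists N. Qed.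

Lemma small_eq0 (a c : R) : (forall e, 0 < e -> `|a| <= e * c) -> a = 0.
Proof.
move=> h; apply/eqP; rewrite -normr_le0; apply/ler_addgt0Pl => e e0.
rewrite addr0; have c0 : 0 < `|c| + 1 by rewrite ltr_wpDl.
apply: le_trans (h (e / (`|c| + 1)) (divr_gt0 e0 c0)) _.
rewrite mulrAC ler_pdivrMr// ler_pM2l//.
by apply: le_trans (ler_norm _) _; rewrite lerDl.
Qed.

Lemma small_nrm_eq0 x (c : R) : (forall e, 0 < e -> nrm x <= e * c) -> x = 0.
Proof.
move=> h; apply: nrm_eq0; apply: (@small_eq0 _ c) => e e0.
by rewrite ger0_norm ?nrm_ge0 ?h.
Qed.

Lemma nrm_lt_eq0 x : (forall e, 0 < e -> nrm x < e) -> x = 0.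
Proof.
move=> h; apply: nrm_eq0; apply/eqP; rewrite eq_le nrm_ge0 andbT.
by apply/ler_addgt0Pl => e e0; rewrite addr0 ltW// h.
Qed.

Lemma nrm_cauchy (u : nat -> H) :
  (forall e : R, 0 < e -> exists N, forall n m, (N <= n)%N -> (N <= m)%N ->
    nrm (u n - u m) < e) ->
  exists l, forall e : R, 0 < e -> exists N, forall n, (N <= n)%N ->
    nrm (u n - l) < e.
Proof.
move=> cu.
have : cvg (u @ \oo).
  apply: cauchy_cvg; apply: cauchy_exP => e e0.
  have [er eE] : exists er : R, e = (er%:C)%C.
    by exists (complex.Re e); case: e e0 => a b; rewrite ltcE /= => /andP[/eqP->].
  have er0 : 0 < er by move: e0; rewrite eE ltcR.
  have [N hN] := cu _ er0.
  exists (u N); exists N => //= n Nn.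
  by rewrite -ball_normE /= normE eE ltcR hN.
move=> /cvg_ex[l ul]; exists l => e e0.
have ec0 : 0 < (e%:C)%C by rewrite ltcR.
move/cvgrPdist_lt : ul => /(_ _ ec0) [N _ hN]; exists N => n Nn.
by have := hN n Nn; rewrite /= normE ltcR nrmBC.
Qed.

Lemma rdotDl x y z : rdot (x + y) z = rdot x z + rdot y z.
Proof. by rewrite /rdot linearDl /=; case: (dot x z); case: (dot y z). Qed.

Lemma rdotDr x y z : rdot x (y + z) = rdot x y + rdot x z.
Proof. by rewrite /rdot linearDr /=; case: (dot x y); case: (dot x z). Qed.

Lemma rdotC x y : rdot x y = rdot y x.
Proof. by rewrite /rdot hermC expr0 mul1r /Num.conj /=; case: (dot y x). Qed.

Lemma rdotZl r x y : rdot ((r%:C)%C *: x) y = r * rdot x y.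
Proof.
rewrite /rdot linearZl_LR /=; case: (dot x y) => a b /=.
by rewrite mul0r subr0.
Qed.

Lemma rdotZr r x y : rdot x ((r%:C)%C *: y) = r * rdot x y.
Proof. by rewrite rdotC rdotZl rdotC. Qed.

Lemma rdotNl x y : rdot (- x) y = - rdot x y.
Proof. by rewrite -scaleN1r -(rmorphN1 (real_complex R)) rdotZl mulN1r. Qed.

Lemma rdotNr x y : rdot x (- y) = - rdot x y.
Proof. by rewrite rdotC rdotNl rdotC. Qed.

Lemma rdotBl x y z : rdot (x - y) z = rdot x z - rdot y z.
Proof. by rewrite rdotDl rdotNl. Qed.

Lemma rdotBr x y z : rdot x (y - z) = rdot x y - rdot x z.
Proof. by rewrite rdotDr rdotNr. Qed.

Lemma rdot0l x : rdot 0 x = 0.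
Proof. by rewrite -(subrr 0) rdotBl subrr. Qed.

Lemma rdot0r x : rdot x 0 = 0.
Proof. by rewrite rdotC rdot0l. Qed.

(** [dot] is conjugate-linear in its second argument, so the real part of [<x, iy>] is the imaginary
    part of [<x, y>]. Identities for [rdot] thus lift to [dot]. *)
Lemma dotE x y : dot x y = (rdot x y +i* rdot x ((0 +i* 1)%C *: y))%C.
Proof.
rewrite /rdot (linearZr_LR dot) /= /Num.conj /=; case: (dot x y) => a b /=.
by rewrite mul0r sub0r mulN1r opprK.
Qed.

Context (dot_norm : forall x : H, dot x x = `|x| ^+ 2).

Lemma rdotxx x : rdot x x = nrm x ^+ 2.
Proof. by rewrite /rdot dot_norm normE -rmorphXn. Qed.

(** For [c > 0] the polynomial is evaluated at its minimum [t = - b / c]. For [c = 0] a nonzero [b]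
    is excluded by [t = - (a + 1) / (2 b)], where the value is [-1]. *)
Lemma discriminant_le (a b c : R) : 0 <= c ->
  (forall t, 0 <= a + 2 * t * b + t ^+ 2 * c) -> b ^+ 2 <= a * c.
Proof.
rewrite le_eqVlt => /orP[/eqP <-|c0] h; last first.
  have := h (- b / c).
  rewrite -(pmulr_lge0 _ c0) => h1.
  have : (a + 2 * (- b / c) * b + (- b / c) ^+ 2 * c) * c = a * c - b ^+ 2.
    by field; rewrite gt_eqF.
  by move=> e; rewrite e in h1; lra.
rewrite mulr0; have [->|b0] := eqVneq b 0; first by rewrite expr0n.
have := h (- (a + 1) / (2 * b)).
have -> : a + 2 * (- (a + 1) / (2 * b)) * b + (- (a + 1) / (2 * b)) ^+ 2 * 0
   = - 1 by field.
by rewrite lerNr oppr0 ler10.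
Qed.

Lemma linD T x y : linear T -> T (x + y) = T x + T y.
Proof. by move=> lT; have := lT 1 x y; rewrite !scale1r. Qed.

Lemma lin0 T : linear T -> T 0 = 0.
Proof.
by move=> lT; have := lT (-1) 0 0; rewrite !scaleN1r oppr0 addr0 addNr.
Qed.

Lemma linZ T (a : R[i]) x : linear T -> T (a *: x) = a *: T x.
Proof. by move=> lT; rewrite -[a *: x]addr0 lT lin0// addr0. Qed.

Lemma linN T x : linear T -> T (- x) = - T x.
Proof. by move=> lT; rewrite -scaleN1r linZ// scaleN1r. Qed.

Lemma linB T x y : linear T -> T (x - y) = T x - T y.
Proof. by move=> lT; rewrite linD// linN. Qed.

Lemma addopE S T x : (S + T) x = S x + T x.
Proof. by []. Qed.

Lemma oppopE S x : (- S) x = - S x.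
Proof. by []. Qed.

Lemma scaleopE (a : R[i]) S x : (a *: S) x = a *: S x.
Proof. by []. Qed.

Definition opE := (addopE, oppopE, scaleopE).

Definition symmetric_op T := forall x y, rdot (T x) y = rdot x (T y).

Lemma form_cauchy_schwarz T x y : linear T -> symmetric_op T ->
  (forall x, 0 <= rdot (T x) x) ->
  rdot (T x) y ^+ 2 <= rdot (T x) x * rdot (T y) y.
Proof.
move=> lT sT pT; apply: discriminant_le => // t.
have := pT (x + (t%:C)%C *: y).
rewrite linD// linZ// !rdotDl !rdotDr !rdotZl !rdotZr.
rewrite (sT y x) (rdotC y (T x)) => h.
by apply: le_trans h _; rewrite le_eqVlt; apply/orP; left; apply/eqP; ring.
Qed.

Lemma cauchy_schwarz x y : `|rdot x y| <= nrm x * nrm y.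
Proof.
have := @form_cauchy_schwarz id x y (fun _ _ _ => erefl) (fun _ _ => erefl).
rewrite !rdotxx => /(_ _)/wrap[|].
  by move=> z; rewrite rdotxx sqr_ge0.
rewrite -exprMn -(ger0_norm (mulr_ge0 (nrm_ge0 x) (nrm_ge0 y))) => h.
by rewrite -(@ler_pXn2r _ 2) ?nnegrE ?normr_ge0// real_normK ?num_real.
Qed.

(** Cauchy-Schwarz for the form of [T] at [x] and [T x] reads [|Tx|^4 <= <Tx, x> <TTx, Tx>], and the
    last factor is at most [c |Tx|^2]. This is the device that turns convergence of forms into
    strong convergence. *)
Lemma positive_op_norm T c x : 0 <= c -> linear T -> symmetric_op T ->
  (forall x, 0 <= rdot (T x) x <= c * nrm x ^+ 2) ->
  nrm (T x) ^+ 2 <= c * rdot (T x) x.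
Proof.
move=> c0 lT sT pT.
have h := @form_cauchy_schwarz T x (T x) lT sT (fun x => proj1 (andP (pT x))).
have /andP[p1 _] := pT x; have /andP[_ p2] := pT (T x).
rewrite rdotxx in h.
have [n0|n0] := eqVneq (nrm (T x)) 0; first by rewrite n0 expr0n mulr_ge0.
have n2 : 0 < nrm (T x) ^+ 2 by rewrite exprn_gt0 // lt_neqAle eq_sym n0 nrm_ge0.
rewrite -(ler_pM2r n2) -expr2; apply: le_trans h _.
by rewrite [c * _]mulrC -mulrA ler_wpM2l.
Qed.

(** Expanding the form at [x + T x] leaves [2 |Tx|^2 = 0]. *)
Lemma symmetric_op_eq0 T x : linear T -> symmetric_op T ->
  (forall x, rdot (T x) x = 0) -> T x = 0.
Proof.
move=> lT sT T0; apply: nrm_eq0; apply/eqP.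
rewrite -sqrf_eq0; rewrite -rdotxx.
have := T0 (x + T x).
rewrite linD// !rdotDl !rdotDr !T0 (sT (T x) x) => h.
by apply/eqP; lra.
Qed.

Lemma is_adjointP T S : linear S ->
  is_adjoint dot T S <-> forall x y, rdot (T x) y = rdot x (S y).
Proof.
move=> lS; split=> h x y; first by rewrite /rdot h.
by rewrite !dotE h h linZ.
Qed.

Lemma selfadjointP T : linear T -> selfadjoint dot T <-> symmetric_op T.
Proof. exact: is_adjointP. Qed.

(** In the order of [R[i]], [0 <= z] includes that [z] is real. For symmetric operators the values
    [<Ty, y>] are real anyway, so only the comparison of real forms remains. *)
Lemma op_leP S T : linear S -> linear T -> symmetric_op S -> symmetric_op T ->
  op_le dot S T <-> forall x, rdot (S x) x <= rdot (T x) x.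
Proof.
move=> lS lT sS sT.
have re U y : linear U -> symmetric_op U -> dot (U y) y = ((rdot (U y) y)%:C)%C.
  move=> lU /(selfadjointP lU) sU; have : dot (U y) y = Num.conj (dot (U y) y).
    by rewrite [LHS]sU hermC expr0 mul1r.
  rewrite /rdot; case: (dot _ _) => a b /= [] /eqP.
  by rewrite -subr_eq0 opprK -mulr2n mulrn_eq0 /= => /eqP->.
have E x : dot (T x - S x) x = ((rdot (T x) x - rdot (S x) x)%:C)%C.
  by rewrite linearBl /= !re// -rmorphB.
split=> h x.
  by have := h x; rewrite E lecR subr_ge0.
by rewrite E lecR subr_ge0.
Qed.

End hilbert.

(** * Strong closure of a star-algebra *)

Section operators.
Context {R : realType} {H : completeNormedModType R[i]}.
Context (dot : {dot H for Num.conj}).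
Context (dot_norm : forall x : H, dot x x = `|x| ^+ 2).
Implicit Types (x y z : H) (r s : R) (S T : H -> H).

Lemma bounded_opP T : bounded_op T <->
  linear T /\ exists2 c : R, 0 < c & forall x, nrm (T x) <= c * nrm x.
Proof.
split=> -[lT]; last first.
  move=> [c c0 cT]; split=> //; exists (c%:C)%C => x.
  by rewrite !normE -rmorphM lecR.
move=> [[M M'] MT]; split=> //; exists (`|M| + 1).
  by rewrite ltr_wpDl.
move=> x; have := MT x; rewrite !normE lecE /= => /andP[_].
rewrite mulr0 subr0 => h; apply: le_trans h _; apply: ler_wpM2r.
  exact: nrm_ge0.
by rewrite (le_trans (ler_norm _))// lerDl.
Qed.

Lemma bounded_op_linear T : bounded_op T -> linear T.
Proof. by case. Qed.

Lemma bounded_opD (a : R[i]) S T : bounded_op S -> bounded_op T ->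
  bounded_op (a *: S + T).
Proof.
move=> [lS [M MS]] [lT [N NT]]; split.
  move=> b x y; rewrite !opE /= lS lT.
  by rewrite !scalerDr !scalerA (mulrC a) addrACA.
exists (`|a| * M + N) => x; rewrite mulrDl.
apply: le_trans (ler_normD _ _) _; apply: lerD => //.
by rewrite normrZ -mulrA ler_wpM2l.
Qed.

Lemma bounded_op_comp S T : bounded_op S -> bounded_op T -> bounded_op (S \o T).
Proof.
move=> /bounded_opP[lS [c c0 cS]] /bounded_opP[lT [d d0 dT]].
apply/bounded_opP; split; first by move=> a x y; rewrite /= lT lS.
exists (c * d); first exact: mulr_gt0.
move=> x; apply: le_trans (cS _) _; rewrite -mulrA ler_pM2l//.
Qed.

(** Basic strong neighbourhoods: finitely many vectors and one tolerance. Boundedness of [T] is left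
    out, so that this applies to limits not yet known to be bounded. *)
Definition sot_approx (A : set (H -> H)) T := forall (s : seq H) (e : R), 0 < e ->
  exists2 S, A S & forall x, x \in s -> nrm (S x - T x) < e.

Lemma ptws_nbhs_ball T y (e : R) : 0 < e ->
  nbhs (T : {ptws H -> H}) [set S | nrm (S y - T y) < e].
Proof.
move=> e0; have ec : 0 < (e%:C)%C by rewrite ltcR.
suff c2 : nbhs (T y) [set z : H | nrm (z - T y) < e].
  exact: (@proj_continuous H (fun=> H) y T _ c2).
have := @nbhsx_ballx _ H (T y) _ ec.
by apply: filterS => z; rewrite -ball_normE /= normE ltcR nrmBC.
Qed.

(** The topology of [{ptws H -> H}] is the supremum of those induced by the evaluations, so
    convergence is tested one vector at a time. *)
Lemma ptws_cvg_ball (F : set_system {ptws H -> H}) T : Filter F ->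
  (forall y (e : R), 0 < e -> F [set S | nrm (S y - T y) < e]) ->
  F --> (T : {ptws H -> H}).
Proof.
move=> FF h; apply/cvg_sup => y; apply/cvg_image.
  by rewrite eqEsubset; split=> v // _; exists (cst v).
move=> B /nbhs_ballP[d d0 dB]; exists (@^~ y @^-1` B).
  have [er eE] : exists er : R, d = (er%:C)%C.
    by exists (complex.Re d); case: d d0 {dB} => a b /=; rewrite ltcE /= => /andP[/eqP->].
  move: d0 dB; rewrite eE /= ltcR => er0 dB.
  apply: filterS (h y _ er0) => S /= Sy; apply: dB.
  by rewrite -ball_normE /= normE ltcR nrmBC.
by rewrite eqEsubset; split => [j [? + <-//]|j Wj]; exists (fun _ => j).
Qed.

Lemma filter_all_seq (Y : Type) (I : eqType) (F : set_system Y) (FF : Filter F)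
    (P : I -> set Y) (s : seq I) : (forall i, F (P i)) ->
  F [set S | forall i, i \in s -> P i S].
Proof.
move=> h; elim: s => [|i s IHs]; first by apply: filterS filterT => S _ x.
apply: filterS (filterI (h i) IHs) => S [/= Sy Ss] x.
by rewrite inE => /orP[/eqP->//|/Ss].
Qed.

Lemma sot_closureP (A : set (H -> H)) T :
  sot_closure A T <-> bounded_op T /\ sot_approx A T.
Proof.
rewrite /sot_closure /setI /=; split=> -[bT clT]; split=> //.
  move=> s e e0; pose B := [set S : {ptws H -> H} |
    forall x, x \in s -> nrm (S x - T x) < e].
  suff [S [AS BS]] : A `&` B !=set0 by exists S.
  apply: clT; apply: (@filter_all_seq _ _ _ (nbhs_filter (T : {ptws H -> H}))
    (fun x => [set S | nrm (S x - T x) < e])).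
  by move=> x; exact: ptws_nbhs_ball.
(* Members of [A] close to [T] at finitely many vectors generate a proper filter. It converges
   pointwise to [T], so every neighbourhood of [T] meets [A]. *)
pose F := filter_from [set p : seq H * R | 0 < p.2]
  (fun p => [set S : {ptws H -> H} | A S /\
    forall x, x \in p.1 -> nrm (S x - T x) < p.2]).
have FF : ProperFilter F.
  apply: filter_from_proper; last first.
    by move=> [s e] /= /(clT s)[S AS hS]; exists S.
  apply: filter_from_filter; first by exists ([::], 1) => /=.
  move=> [s e] [s' e'] /= e0 e'0; exists (s ++ s', Num.min e e').
    by rewrite /= lt_min e0.
  move=> S [/= AS hS]; split; split=> // x xs.
    have := hS x; rewrite mem_cat xs => /(_ isT).
    by rewrite lt_min => /andP[].
  have := hS x; rewrite mem_cat xs orbT => /(_ isT).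
  by rewrite lt_min => /andP[].
have FT : {ptws, F --> T}.
  apply: ptws_cvg_ball => x e e0; exists ([:: x], e) => //= S [_ hS].
  by apply: hS; rewrite inE.
move=> B /FT[[s e] /= e0 hB]; have [S AS hS] := clT s e e0.
by exists S; split=> //; apply: hB.
Qed.

Lemma sot_approx_linear (D : set (H -> H)) T :
  (forall S, D S -> linear S) -> sot_approx D T -> linear T.
Proof.
move=> linD aT a x y; apply/eqP; rewrite -subr_eq0; apply/eqP.
apply: (@small_nrm_eq0 _ _ _ (1 + (complex.Re `|a| + 1))) => e e0.
have [U DU hU] := aT [:: x; y; a *: x + y] e e0.
apply: le_trans (nrm_tri _ (U (a *: x + y)) _) _.
have h1 := hU (a *: x + y); have h2 := hU x; have h3 := hU y.
rewrite !inE !eqxx ?orbT in h1 h2 h3.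
rewrite mulrDr mulr1; apply: lerD; first by rewrite nrmBC ltW// h1.
rewrite (linD _ DU) opprD addrACA -scalerBr; apply: le_trans (nrmD _ _) _.
rewrite mulrDr mulr1; apply: lerD; last by rewrite ltW// h3.
by rewrite nrmZC mulrC ler_wpM2r ?cabs_ge0// ltW// h2.
Qed.

Lemma sot_approx_symmetric (D : set (H -> H)) T :
  (forall S, D S -> symmetric_op dot S) -> sot_approx D T -> symmetric_op dot T.
Proof.
move=> symD aT x y; apply/eqP; rewrite -subr_eq0; apply/eqP.
apply: (@small_eq0 _ _ (nrm y + nrm x)) => e e0.
have [U DU hU] := aT [:: x; y] e e0.
have -> : rdot dot (T x) y - rdot dot x (T y) =
   rdot dot x (U y - T y) - rdot dot (U x - T x) y.
  by rewrite rdotBr rdotBl (symD _ DU); ring.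
apply: le_trans (ler_normB _ _) _; rewrite addrC mulrDr; apply: lerD.
  apply: le_trans (cauchy_schwarz dot_norm _ _) _; apply: ler_wpM2r; first exact: nrm_ge0.
  by rewrite ltW// hU// inE eqxx.
apply: le_trans (cauchy_schwarz dot_norm _ _) _; rewrite mulrC.
by apply: ler_wpM2r; [exact: nrm_ge0|rewrite ltW// hU// !inE eqxx orbT].
Qed.

(** No unit is demanded, as [pi] may be degenerate. In the field names [sa_] abbreviates star
    algebra; in [sa_part], [sa_add], [sa_mul] and the like it stands for self-adjoint. *)
Record star_alg (A : set (H -> H)) : Prop := StarAlg {
  sa_bounded : A `<=` bounded_op;
  sa_0 : A 0;
  sa_lin : forall (a : R[i]) S T, A S -> A T -> A (a *: S + T);
  sa_comp : forall S T, A S -> A T -> A (S \o T);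
  sa_comm : forall S T x, A S -> A T -> S (T x) = T (S x);
  sa_adj : forall S, A S -> exists2 S', A S' & is_adjoint dot S S' }.

(** Commutativity makes [W] normal: [<W'x, W'x> = <W W'x, x> = <W'W x, x> = <Wx, Wx>]. *)
Lemma star_alg_normal (A : set (H -> H)) W W' x : star_alg A -> A W -> A W' ->
  is_adjoint dot W W' -> nrm (W' x) = nrm (W x).
Proof.
move=> As AW AW' hW.
have h u v : rdot dot (W u) v = rdot dot u (W' v) by rewrite /rdot hW.
apply/eqP; rewrite -(@eqrXn2 _ 2) ?nrm_ge0// -!(rdotxx dot_norm).
by rewrite -h (sa_comm As x AW AW') rdotC -h.
Qed.

Section closure_of_star_alg.
Context (A0 : set (H -> H)) (A0s : star_alg A0).
Let A := sot_closure A0.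

Lemma sub_sot_closure : A0 `<=` A.
Proof.
move=> T A0T; apply/sot_closureP; split; first exact: (sa_bounded A0s).
by move=> s e e0; exists T => // x _; rewrite subrr nrm0.
Qed.

Lemma sot_closure_idem T : bounded_op T -> sot_approx A T -> A T.
Proof.
move=> bT aT; apply/sot_closureP; split=> // s e e0.
have e20 : 0 < e / 2 by rewrite divr_gt0.
have [S /sot_closureP[_ aS] hS] := aT s _ e20.
have [U A0U hU] := aS s _ e20; exists U => // x xs.
rewrite (splitr e); apply: le_lt_trans (nrm_tri _ (S x) _) _.
by rewrite ltrD ?hU ?hS.
Qed.

Lemma sot_closure_lin (a : R[i]) S T : A S -> A T -> A (a *: S + T).
Proof.
move=> /sot_closureP[bS aS] /sot_closureP[bT aT].
apply/sot_closureP; split; first exact: bounded_opD.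
move=> s e e0; pose c := complex.Re `|a| + 1.
have c0 : 0 < c by rewrite ltr_wpDl ?cabs_ge0.
have d0 : 0 < e / 2 / c by rewrite !divr_gt0.
have [S' AS hS] := aS s _ d0; have e20 : 0 < e / 2 by rewrite divr_gt0.
have [T' AT hT] := aT s _ e20.
exists (a *: S' + T'); first exact: (sa_lin A0s).
move=> x xs; rewrite !opE opprD addrACA -scalerBr (splitr e).
apply: le_lt_trans (nrmD _ _) _; apply: ltrD; last exact: hT.
rewrite nrmZC; have := hS x xs; rewrite ltr_pdivlMr// => h.
apply: le_lt_trans h; rewrite mulrC; apply: ler_wpM2l; first exact: nrm_ge0.
by rewrite lerDl.
Qed.

(** Composition is not jointly continuous for the strong topology. The outer factor is approximated
    first, at the vectors [T x]; the tolerance for the inner one is then scaled by the bound of the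
    approximant already chosen. *)
Lemma sot_closure_comp S T : A S -> A T -> A (S \o T).
Proof.
move=> /sot_closureP[bS aS] /sot_closureP[bT aT].
apply/sot_closureP; split; first exact: bounded_op_comp.
move=> s e e0; have e20 : 0 < e / 2 by rewrite divr_gt0.
have [S' AS hS] := aS (map T s) _ e20.
have [lS [c c0 cS]] := (bounded_opP S').1 (sa_bounded A0s AS).
have d0 : 0 < e / 2 / c by rewrite divr_gt0.
have [T' AT hT] := aT s _ d0.
exists (S' \o T'); first exact: (sa_comp A0s).
move=> x xs /=; rewrite (splitr e); apply: le_lt_trans (nrm_tri _ (S' (T x)) _) _.
apply: ltrD; last by rewrite hS// map_f.
rewrite -linB//; apply: le_lt_trans (cS _) _.
by rewrite mulrC -ltr_pdivlMr// hT.
Qed.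

(** Commuting with a fixed bounded [T] is a strongly closed condition. [sot_closure_comm] uses this
    twice, to pass from [A0] to its closure in one factor and then in the other. *)
Lemma sot_closure_comm0 S T x : bounded_op T ->
  (forall U z, A0 U -> U (T z) = T (U z)) ->
  A S -> S (T x) = T (S x).
Proof.
move=> /bounded_opP[lT [c c0 cT]] TA0 /sot_closureP[bS aS].
apply/eqP; rewrite -subr_eq0; apply/eqP/nrm_lt_eq0 => e e0.
pose d := Num.min (e / 2) (e / 2 / c).
have d0 : 0 < d by rewrite lt_min !divr_gt0.
have [U A0U hU] := aS [:: x; T x] _ d0.
rewrite (splitr e); apply: le_lt_trans (nrm_tri _ (U (T x)) _) _; apply: ltrD.
  by rewrite nrmBC; have := hU (T x); rewrite !inE eqxx orbT => /(_ isT); rewrite lt_min => /andP[].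
rewrite TA0// -linB//; apply: le_lt_trans (cT _) _.
have := hU x; rewrite !inE eqxx => /(_ isT); rewrite lt_min => /andP[_].
by rewrite ltr_pdivlMr// mulrC.
Qed.

Lemma sot_closure_comm S T x : A S -> A T -> S (T x) = T (S x).
Proof.
move=> AS AT; have bT : bounded_op T by case/sot_closureP: AT.
have UT U z : A0 U -> U (T z) = T (U z).
  move=> A0U; apply/esym; apply: (sot_closure_comm0 z (sa_bounded A0s A0U) _ AT).
  by move=> V w A0V; exact: (sa_comm A0s w A0V A0U).
exact: (sot_closure_comm0 x bT UT AS).
Qed.

(* Members of a commutative star-algebra are normal, so strong convergence
   passes to adjoints; this produces adjoints in the closure without the Riesz
   representation theorem. *)
Lemma sot_closure_adj T : A T -> exists2 T', A T' & is_adjoint dot T T'.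
Proof.
move=> /sot_closureP[bT aT].
have adjE U V : is_adjoint dot U V -> forall x y, rdot dot (U x) y = rdot dot x (V y).
  by move=> h x y; rewrite /rdot h.
have normal W W' x : A0 W -> A0 W' -> is_adjoint dot W W' -> nrm (W' x) = nrm (W x).
  exact: star_alg_normal.
have /choice[adj hadj] : forall S, exists S', A0 S -> A0 S' /\ is_adjoint dot S S'.
  move=> S; have [A0S|] := pselect (A0 S); last by exists S.
  by have [S' ? ?] := sa_adj A0s A0S; exists S'.
(* By normality of [U - V], the adjoints converge wherever the operators do, and at the same
   speed. *)
have adjB U V x : A0 U -> A0 V -> nrm (adj U x - adj V x) = nrm (U x - V x).
  move=> A0U A0V; have [aU hU] := hadj U A0U; have [aV hV] := hadj V A0V.
  have E (P Q : H -> H) : (-1 *: Q + P) x = P x - Q x.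
    by rewrite !opE scaleN1r addrC.
  rewrite -!E; apply: normal; [exact: (sa_lin A0s)|exact: (sa_lin A0s)|].
  move=> y z; rewrite !opE !scaleN1r linearDl linearDr linearNl linearNr /=.
  by rewrite hU hV.
(* [T' x] is the limit of [adj (S n) x] for members [S n] converging to [T] at [x]. The inequality
   against every [U] frees [y] from that sequence, so that one [U] serves finitely many vectors at
   once. *)
have /choice[T' hT'] : forall x, exists y, forall U, A0 U ->
    nrm (adj U x - y) <= nrm (U x - T x).
  move=> x; have /choice[S hS] : forall n : nat, exists S, A0 S /\ nrm (S x - T x) < n.+1%:R^-1.
    move=> n; have n0 : 0 < n.+1%:R^-1 :> R by rewrite invr_gt0.
    have [S A0S hS] := aT [:: x] _ n0.
    by exists S; split=> //; apply: hS; rewrite inE.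
  have small e : 0 < e -> exists N, forall n, (N <= n)%N -> nrm (S n x - T x) < e.
    move=> /natSinv_small[N hN]; exists N => n Nn.
    by case: (hS n) => _ h; apply: lt_trans h (hN n Nn).
  have [y hy] : exists y, forall e : R, 0 < e -> exists N, forall n, (N <= n)%N ->
      nrm (adj (S n) x - y) < e.
    apply: nrm_cauchy => e e0; have e20 : 0 < e / 2 by rewrite divr_gt0.
    have [N hN] := small _ e20; exists N => n m Nn Nm.
    have [An _] := hS n; have [Am _] := hS m.
    rewrite adjB// (splitr e); apply: le_lt_trans (nrm_tri _ (T x) _) _.
    by apply: ltrD; [exact: hN|rewrite nrmBC; exact: hN].
  exists y => U A0U; apply/ler_addgt0Pl => e e0.
  have e20 : 0 < e / 2 by rewrite divr_gt0.
  have [N hN] := small _ e20; have [M hM] := hy _ e20.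
  pose n := maxn N M; have [An _] := hS n.
  apply: le_trans (nrm_tri _ (adj (S n) x) _) _; rewrite adjB//.
  have h1 := hN n (leq_maxl _ _); have h2 := hM n (leq_maxr _ _).
  have := nrm_tri (U x) (T x) (S n x); rewrite (nrmBC (T x)).
  lra.
have approx2 (s : seq H) (e : R) : 0 < e -> exists U, [/\ A0 U, A0 (adj U),
   forall x, x \in s -> nrm (U x - T x) < e & forall x, x \in s -> nrm (adj U x - T' x) < e].
  move=> e0; have [U A0U hU] := aT s e e0; exists U; split=> //; first by case: (hadj U A0U).
  by move=> x xs; apply: le_lt_trans (hT' x U A0U) _; exact: hU.
have lT' : linear T'.
  apply: (@sot_approx_linear A0); first by move=> S /(sa_bounded A0s)[].
  by move=> s e e0; have [U [? ? ? ?]] := approx2 s e e0; exists (adj U).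
have T'T x : nrm (T' x) <= nrm (T x).
  have [A00 h0] := hadj 0 (sa_0 A0s).
  have := hT' x 0 (sa_0 A0s).
  have -> : adj 0 x = 0 by apply: nrm_eq0; rewrite (normal 0)// ?nrm0//; exact: (sa_0 A0s).
  by rewrite -[X in nrm (X - T x)]/(0 : H) !sub0r !nrmN.
exists T'.
  apply/sot_closureP; split.
    apply/bounded_opP; split=> //; have [_ [c c0 cT]] := (bounded_opP T).1 bT.
    by exists c => // x; apply: le_trans (T'T x) (cT x).
  move=> s e e0; have [U [A0U A0U' _ hU]] := approx2 s e e0.
  by exists (adj U).
apply/(is_adjointP _ _ lT') => x y; apply/eqP; rewrite -subr_eq0; apply/eqP.
apply: (@small_eq0 _ _ (nrm y + nrm x)) => e e0.
have [U [A0U A0U' h1 h2]] := approx2 [:: x; y] e e0.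
have [_ /adjE hU] := hadj U A0U.
have -> : rdot dot (T x) y - rdot dot x (T' y) =
   rdot dot x (adj U y - T' y) - rdot dot (U x - T x) y.
  by rewrite rdotBr rdotBl -hU; ring.
apply: le_trans (ler_normB _ _) _; rewrite addrC mulrDr; apply: lerD.
  apply: le_trans (cauchy_schwarz dot_norm _ _) _; apply: ler_wpM2r; first exact: nrm_ge0.
  by rewrite ltW// h1// inE eqxx.
apply: le_trans (cauchy_schwarz dot_norm _ _) _; rewrite mulrC.
by apply: ler_wpM2r; [exact: nrm_ge0|rewrite ltW// h2// !inE eqxx orbT].
Qed.

Lemma star_alg_sot_closure : star_alg A.
Proof.
split.
- by move=> T /sot_closureP[].
- exact/sub_sot_closure/(sa_0 A0s).
- exact: sot_closure_lin.
- exact: sot_closure_comp.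
- exact: sot_closure_comm.
- exact: sot_closure_adj.
Qed.

End closure_of_star_alg.
End operators.

(** * The self-adjoint part and its monotone completeness *)

Section closed_star_alg.
Context {R : realType} {H : completeNormedModType R[i]}.
Context (dot : {dot H for Num.conj}).
Context (dot_norm : forall x : H, dot x x = `|x| ^+ 2).
Context (A : set (H -> H)) (As : star_alg dot A).
Context (Acl : forall T, bounded_op T -> sot_approx A T -> A T).
Implicit Types (x y z : H) (r s : R) (S T : H -> H).

Local Notation sa := (sa_part dot A).
Definition qf T x : R := rdot dot (T x) x.
Definition qle S T := forall x, qf S x <= qf T x.

Lemma sa_linear T : sa T -> linear T.
Proof. by move=> [/(sa_bounded As)[]]. Qed.

Lemma sa_symmetric T : sa T -> symmetric_op dot T.
Proof. by move=> sT; have [_ /selfadjointP] := sT; apply; exact: sa_linear. Qed.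

Lemma sa_sym T x y : sa T -> rdot dot (T x) y = rdot dot x (T y).
Proof. by move=> /sa_symmetric. Qed.

Lemma qle_trans S T U : qle S T -> qle T U -> qle S U.
Proof. by move=> h1 h2 x; apply: le_trans (h1 x) (h2 x). Qed.

Lemma sa_intro T : A T -> symmetric_op dot T -> sa T.
Proof. by move=> AT sT; split=> //; apply/selfadjointP => //; case: (sa_bounded As AT). Qed.

Lemma sa_leP S T : sa S -> sa T -> op_le dot S T <-> qle S T.
Proof.
by move=> sS sT; apply: op_leP; try exact: sa_linear; exact: sa_symmetric.
Qed.

Lemma sa_eq S T : sa S -> sa T -> (forall x, qf S x = qf T x) -> S = T.
Proof.
move=> sS sT h; apply/funext => x; apply/eqP; rewrite -subr_eq0; apply/eqP.
have lS := sa_linear sS; have lT := sa_linear sT.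
apply: (@symmetric_op_eq0 _ _ _ dot_norm (S - T)).
- by move=> a u v; rewrite !opE lS lT scalerBr opprD addrACA.
- by move=> u v; rewrite !opE rdotBl rdotBr (sa_sym _ _ sS) (sa_sym _ _ sT).
- by move=> u; rewrite !opE rdotBl -/(qf S u) h subrr.
Qed.

Lemma sa_le_anti S T : sa S -> sa T -> qle S T -> qle T S -> S = T.
Proof. by move=> sS sT h1 h2; apply: sa_eq => // x; apply/le_anti; rewrite h1 h2. Qed.

Lemma alg_add S T : A S -> A T -> A (S + T).
Proof. by move=> AS AT; rewrite -[S]scale1r; exact: (sa_lin As). Qed.

Lemma alg_scale (a : R[i]) S : A S -> A (a *: S).
Proof. by move=> AS; rewrite -[a *: S]addr0; apply: (sa_lin As) => //; exact: sa_0 As. Qed.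

Lemma sa_add S T : sa S -> sa T -> sa (S + T).
Proof.
move=> sS sT; apply: sa_intro; first by apply: alg_add; [case: sS|case: sT].
by move=> x y; rewrite !opE rdotDl rdotDr (sa_sym _ _ sS) (sa_sym _ _ sT).
Qed.

Lemma sa_scale r S : sa S -> sa ((r%:C)%C *: S).
Proof.
move=> sS; apply: sa_intro; first by apply: alg_scale; case: sS.
by move=> x y; rewrite !opE rdotZl rdotZr (sa_sym _ _ sS).
Qed.

Lemma sa_zero : sa 0.
Proof.
apply: sa_intro; first exact: sa_0 As.
by move=> x y; rewrite rdot0l rdot0r.
Qed.

Lemma sa_opp S : sa S -> sa (- S).
Proof.
by move=> /(sa_scale (-1)); rewrite rmorphN1 scaleN1r.
Qed.

Lemma sa_sub S T : sa S -> sa T -> sa (S - T).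
Proof. by move=> sS sT; apply: sa_add => //; exact: sa_opp. Qed.

Lemma sa_mul S T : sa S -> sa T -> sa (S \o T).
Proof.
move=> sS sT; have [AS _] := sS; have [AT _] := sT.
apply: sa_intro; first exact: (sa_comp As).
by move=> x y /=; rewrite !sa_sym// (sa_comm As y AS AT).
Qed.

Lemma qfD S T x : qf (S + T) x = qf S x + qf T x.
Proof. by rewrite /qf rdotDl. Qed.

Lemma qfB S T x : qf (S - T) x = qf S x - qf T x.
Proof. by rewrite /qf rdotBl. Qed.

Lemma qfN S x : qf (- S) x = - qf S x.
Proof. by rewrite /qf rdotNl. Qed.

Lemma qfZ r S x : qf ((r%:C)%C *: S) x = r * qf S x.
Proof. by rewrite /qf rdotZl. Qed.

Lemma qf0 x : qf 0 x = 0.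
Proof. by rewrite /qf rdot0l. Qed.

Lemma qf_square S x : sa S -> qf (S \o S) x = nrm (S x) ^+ 2.
Proof. by move=> sS; rewrite /qf /= sa_sym// rdotxx. Qed.

Lemma qf_bound T : bounded_op T -> exists2 c, 0 < c & forall x, `|qf T x| <= c * nrm x ^+ 2.
Proof.
move=> /bounded_opP[lT [c c0 cT]]; exists c => // x.
apply: le_trans (cauchy_schwarz dot_norm _ _) _; rewrite expr2 mulrA.
by apply: ler_wpM2r; [exact: nrm_ge0|exact: cT].
Qed.

(** Vigier's theorem: a bounded directed family converges strongly to an upper bound. By
    [positive_op_norm], [|Ux - Sx|^2] is controlled by [qf U x - qf S x], so convergence of real
    numbers forces strong convergence. That the limit is the least upper bound is added in
    [sa_sup_exists]. *)
Lemma vigier (D : set (H -> H)) (c : R) : D `<=` sa -> D !=set0 ->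
  (forall S T, D S -> D T -> exists U, [/\ D U, qle S U & qle T U]) ->
  (forall S x, D S -> qf S x <= c * nrm x ^+ 2) ->
  exists T, [/\ sa T, forall S, D S -> qle S T &
    forall x e, 0 < e -> exists2 S, D S & forall U, D U -> qle S U -> nrm (U x - T x) < e].
Proof.
move=> Dsa [S0 DS0] Ddir Dc.
have [c0 c00 hc0] := qf_bound (sa_bounded As (proj1 (Dsa _ DS0))).
(* For [S0 <= S <= U] in [D], the form of [U - S] at [z] is at most [c |z|^2 - qf S0 z], hence at
   most [C |z|^2]. *)
pose C := `|c| + c0; have C0 : 0 < C by rewrite ltr_wpDl.
have bnd S U x : D S -> D U -> qle S0 S -> qle S U ->
    nrm (U x - S x) ^+ 2 <= C * (qf U x - qf S x).
  move=> DS DU S0S SU; have sS := Dsa _ DS; have sU := Dsa _ DU.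
  have sUS := sa_sub sU sS.
  rewrite -qfB; apply: (@positive_op_norm _ _ _ dot_norm (U - S) C x (ltW C0)).
  - exact: sa_linear.
  - exact: sa_symmetric.
  move=> z; rewrite -/(qf (U - S) z) qfB subr_ge0 SU /= /C mulrDl.
  have := Dc _ z DU; have := S0S z; have := hc0 z; rewrite ler_norml => /andP[h1 _] h2 h3.
  have : c * nrm z ^+ 2 <= `|c| * nrm z ^+ 2 by rewrite ler_wpM2r ?sqr_ge0 ?ler_norm.
  lra.
(* The numbers [qf U x] with [U] in [D] above [S0] have a supremum; once [S] is within [d ^+ 2 / C]
   of it, [bnd] leaves a strong distance of at most [d]. *)
have key x d : 0 < d -> exists S, [/\ D S, qle S0 S & forall U, D U -> qle S U -> nrm (U x - S x) <= d].
  move=> d0; pose E := [set qf U x | U in [set U | D U /\ qle S0 U]].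
  have hE : has_sup E.
    split; first by exists (qf S0 x); exists S0 => //; split.
    by exists (c * nrm x ^+ 2) => _ [U [DU _] <-]; exact: Dc.
  have e0 : 0 < d ^+ 2 / C by rewrite divr_gt0 ?exprn_gt0.
  have [_ [S [DS S0S] <-] hS] := sup_adherent e0 hE.
  exists S; split=> // U DU SU; rewrite -(@ler_pXn2r _ 2) ?nnegrE ?nrm_ge0 ?(ltW d0)//.
  apply: le_trans (bnd _ _ _ DS DU S0S SU) _; rewrite -ler_pdivlMl// mulrC.
  have : qf U x <= sup E.
    apply: sup_upper_bound => //; exists U => //; split=> // z.
    by apply: le_trans (S0S z) (SU z).
  lra.
have /choice[T hT] : forall x, exists y, forall e, 0 < e -> exists2 S, D S & forall U, D U -> qle S U -> nrm (U x - y) < e.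
  move=> x; have /choice[S hS] : forall n : nat, exists S, [/\ D S, qle S0 S & forall U, D U -> qle S U -> nrm (U x - S x) <= n.+1%:R^-1].
    by move=> n; apply: key; rewrite invr_gt0.
  have [y hy] : exists y, forall e : R, 0 < e -> exists N, forall n, (N <= n)%N ->
      nrm (S n x - y) < e.
    apply: nrm_cauchy => e e0; have e20 : 0 < e / 2 by rewrite divr_gt0.
    have [N hN] := natSinv_small e20; exists N => n m Nn Nm.
    have [Dn _ hn] := hS n; have [Dm _ hm] := hS m.
    have [U [DU nU mU]] := Ddir _ _ Dn Dm.
    have h1 := le_lt_trans (hn U DU nU) (hN n Nn).
    have h2 := le_lt_trans (hm U DU mU) (hN m Nm).
    have := nrm_tri (S n x) (U x) (S m x); rewrite (nrmBC (S n x) (U x)); lra.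
  exists y => e e0; have e20 : 0 < e / 2 by rewrite divr_gt0.
  have [N hN] := natSinv_small e20; have [M hM] := hy _ e20.
  pose n := maxn N M; have [Dn _ hn] := hS n; exists (S n) => // U DU nU.
  have h1 := le_lt_trans (hn U DU nU) (hN n (leq_maxl _ _)); have h3 := hM n (leq_maxr _ _).
  have := nrm_tri (U x) (S n x) y; lra.
have ev (s : seq H) (e : R) : 0 < e -> exists S, [/\ D S, qle S0 S &
    forall U, D U -> qle S U -> forall x, x \in s -> nrm (U x - T x) < e].
  move=> e0; elim: s => [|y s [S [DS S0S hS]]]; first by exists S0; split.
  have [V DV hV] := hT y e e0; have [W [DW SW VW]] := Ddir _ _ DS DV.
  exists W; split=> //; first exact: qle_trans S0S SW.
  move=> U DU WU x; rewrite inE => /orP[/eqP->|xs].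
    by apply: hV => //; exact: qle_trans VW WU.
  by apply: hS => //; exact: qle_trans SW WU.
have aT : sot_approx D T.
  by move=> s e e0; have [S [DS _ hS]] := ev s e e0; exists S => //; exact: hS.
have lT : linear T by apply: sot_approx_linear aT => S /Dsa/sa_linear.
have sT : symmetric_op dot T.
  by apply: (sot_approx_symmetric dot_norm _ aT) => S /Dsa/sa_symmetric.
have qT S : D S -> qle S T.
  move=> DS x; apply/ler_addgt0Pl => e e0.
  have n0 : 0 < nrm x + 1 by rewrite ltr_wpDl ?nrm_ge0.
  have [V DV hV] := hT x (e / (nrm x + 1)) (divr_gt0 e0 n0).
  have [W [DW SW VW]] := Ddir _ _ DS DV; have h := hV W DW VW.
  apply: le_trans (SW x) _; rewrite -lerBlDr -rdotBl.
  apply: le_trans (ler_norm _) _; apply: le_trans (cauchy_schwarz dot_norm _ _) _.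
  move: h; rewrite ltr_pdivlMr// => /ltW; apply: le_trans.
  by rewrite ler_wpM2l ?nrm_ge0// lerDl.
exists T; split=> //.
apply: sa_intro => //; apply: Acl; last first.
  by move=> s e e0; have [S DS hS] := aT s e e0; exists S => //; case: (Dsa _ DS).
(* Boundedness of [T]: every [U] in [D] above [S0] satisfies [|Ux - S0 x| <= C |x|], and [S0] is
   bounded by [k]. *)
have [lS0 [k k0 hk]] := (bounded_opP S0).1 (sa_bounded As (proj1 (Dsa _ DS0))).
apply/bounded_opP; split=> //; exists (C + k); first exact: addr_gt0.
move=> x; apply/ler_addgt0Pl => e e0.
have [U [DU S0U /(_ _ DU)]] := ev [:: x] e e0.
move=> /(_ (fun _ => lexx _) x); rewrite inE eqxx => /(_ isT).
rewrite nrmBC => h1.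
have h2 : nrm (U x - S0 x) <= C * nrm x.
  have Cx : 0 <= C * nrm x by rewrite mulr_ge0 ?(ltW C0) ?nrm_ge0.
  rewrite -(@ler_pXn2r _ 2) ?nnegrE ?nrm_ge0//.
  apply: le_trans (bnd S0 U x DS0 DU (fun _ => lexx _) S0U) _.
  rewrite exprMn expr2 -mulrA ler_pM2l// /C mulrDl.
  have := Dc _ x DU; have := hc0 x; rewrite ler_norml => /andP[h2 _] h3.
  have : c * nrm x ^+ 2 <= `|c| * nrm x ^+ 2 by rewrite ler_wpM2r ?sqr_ge0 ?ler_norm.
  lra.
have h3 := hk x.
have := nrm_tri (T x) (U x) 0; have := nrm_tri (U x) (S0 x) 0.
rewrite !subr0 mulrDl; lra.
Qed.

End closed_star_alg.

(** * Suprema and projections *)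

Section suprema.
Context {R : realType} {H : completeNormedModType R[i]}.
Context (dot : {dot H for Num.conj}).
Context (dot_norm : forall x : H, dot x x = `|x| ^+ 2).
Context (A : set (H -> H)) (As : star_alg dot A).
Context (Acl : forall T, bounded_op T -> sot_approx A T -> A T).
Implicit Types (x y z : H) (p q r S T : H -> H).

Local Notation sa := (sa_part dot A).
Local Notation qf := (qf dot).
Local Notation qle := (qle dot).

Lemma sa_supP (D : set (H -> H)) T : D `<=` sa -> is_sup (op_le dot) sa D T <->
  [/\ sa T, forall S, D S -> qle S T
    & forall U, sa U -> (forall S, D S -> qle S U) -> qle T U].
Proof.
move=> Dsa; split=> -[sT h1 h2]; split=> //.
- by move=> S DS; apply/(sa_leP As (Dsa _ DS) sT); exact: h1.
- move=> U sU hU; apply/(sa_leP As sT sU); apply: h2 => // S DS.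
  by apply/(sa_leP As (Dsa _ DS) sU); exact: hU.
- by move=> S DS; apply/(sa_leP As (Dsa _ DS) sT); exact: h1.
- move=> U sU hU; apply/(sa_leP As sT sU); apply: h2 => // S DS.
  by apply/(sa_leP As (Dsa _ DS) sU); exact: hU.
Qed.

Lemma sa_sup_unique (D : set (H -> H)) T T' : D `<=` sa ->
  is_sup (op_le dot) sa D T -> is_sup (op_le dot) sa D T' -> T = T'.
Proof.
move=> Dsa /(sa_supP _ Dsa)[sT uT lT] /(sa_supP _ Dsa)[sT' uT' lT'].
by apply: (sa_le_anti dot_norm As) => //; [exact: lT|exact: lT'].
Qed.

Lemma qle_limit (D : set (H -> H)) T U :
  (forall x (e : R), 0 < e -> exists2 S, D S & nrm (S x - T x) < e) ->
  (forall S, D S -> qle S U) -> qle T U.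
Proof.
move=> hT hU x; apply/ler_addgt0Pl => e e0.
have n0 : 0 < nrm x + 1 by rewrite ltr_wpDl ?nrm_ge0.
have [V DV h] := hT x (e / (nrm x + 1)) (divr_gt0 e0 n0).
rewrite -lerBlDr; apply: le_trans (lerB (lexx _) (hU V DV x)) _.
rewrite -(qfB dot); rewrite ltr_pdivlMr// in h.
apply: le_trans (ler_norm _) _; apply: le_trans (cauchy_schwarz dot_norm _ _) _.
rewrite opE oppopE nrmBC; apply: le_trans (ltW h).
by rewrite ler_wpM2l ?nrm_ge0// lerDl.
Qed.

Definition qdirected (D : set (H -> H)) :=
  forall S T, D S -> D T -> exists U, [/\ D U, qle S U & qle T U].

Lemma sa_sup_exists (D : set (H -> H)) (c : R) : D `<=` sa -> D !=set0 ->
  qdirected D -> (forall S x, D S -> qf S x <= c * nrm x ^+ 2) ->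
  exists T, is_sup (op_le dot) sa D T.
Proof.
move=> Dsa D0 Dd Dc; have [T [sT uT hT]] := vigier dot_norm As Acl Dsa D0 Dd Dc.
exists T; apply/(sa_supP _ Dsa); split=> // U sU; apply: qle_limit => x e e0.
by have [V DV h] := hT x e e0; exists V => //; exact: h.
Qed.

(** [vigier] provides some strong limit that is a supremum; uniqueness of suprema identifies it with
    the given [T]. *)
Lemma sa_sup_strong (D : set (H -> H)) T : D `<=` sa -> D !=set0 ->
  qdirected D -> is_sup (op_le dot) sa D T ->
  forall x e, 0 < e -> exists2 S, D S & forall U, D U -> qle S U -> nrm (U x - T x) < e.
Proof.
move=> Dsa D0 Dd supT; have [sT uT _] := (sa_supP _ Dsa).1 supT.
have [c c0 hc] := qf_bound dot_norm (sa_bounded As (proj1 sT)).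
have Dc S x : D S -> qf S x <= c * nrm x ^+ 2.
  by move=> DS; apply: le_trans (uT S DS x) _; apply: le_trans (ler_norm _) (hc x).
have [T' [sT' uT' hT']] := vigier dot_norm As Acl Dsa D0 Dd Dc.
suff -> : T = T' by [].
apply: (sa_sup_unique Dsa supT); apply/(sa_supP _ Dsa); split=> // U sU.
by apply: qle_limit => x e e0; have [V DV h] := hT' x e e0; exists V => //; exact: h.
Qed.

Lemma sa_sup_weak (D : set (H -> H)) T : D `<=` sa -> D !=set0 ->
  qdirected D -> is_sup (op_le dot) sa D T ->
  forall x e, 0 < e -> exists2 S, D S & forall U, D U -> qle S U -> qf T x - e < qf U x.
Proof.
move=> Dsa D0 Dd supT x e e0.
have n0 : 0 < nrm x + 1 by rewrite ltr_wpDl ?nrm_ge0.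
have [V DV hV] := sa_sup_strong Dsa D0 Dd supT x (divr_gt0 e0 n0).
exists V => // U DU VU; rewrite ltrBlDl -ltrBlDr -(qfB dot).
have := hV U DU VU; rewrite ltr_pdivlMr// nrmBC => h.
apply: le_lt_trans h; apply: le_trans (ler_norm _) _.
apply: le_trans (cauchy_schwarz dot_norm _ _) _.
by rewrite ler_wpM2l ?nrm_ge0// lerDl.
Qed.

Lemma positive_eq0 T x : sa T -> (forall y, 0 <= qf T y) -> qf T x = 0 -> T x = 0.
Proof.
move=> sT pT Tx; have [c c0 hc] := qf_bound dot_norm (sa_bounded As (proj1 sT)).
apply: nrm_eq0; apply/eqP; rewrite -sqrf_eq0 eq_le sqr_ge0 andbT.
rewrite -(mulr0 c) -Tx; apply: (positive_op_norm dot_norm _ (ltW c0)).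
- exact: sa_linear As _ sT.
- exact: sa_symmetric As _ sT.
- by move=> y; rewrite pT/=; apply: le_trans (ler_norm _) (hc y).
Qed.

Definition saproj p := sa p /\ forall x, p (p x) = p x.

Lemma saproj_qf p x : saproj p -> qf p x = nrm (p x) ^+ 2.
Proof. by move=> [sp pp]; rewrite -(rdotxx dot_norm) -(sa_sym As) ?pp. Qed.

Lemma saproj_nrm p x : saproj p -> nrm (p x) <= nrm x.
Proof.
move=> pp; have [p0|p0] := eqVneq (nrm (p x)) 0; first by rewrite p0 nrm_ge0.
have p1 : 0 < nrm (p x) by rewrite lt_neqAle eq_sym p0 nrm_ge0.
rewrite -(ler_pM2l p1) -expr2 -saproj_qf//.
by apply: le_trans (ler_norm _) (cauchy_schwarz dot_norm _ _).
Qed.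

Lemma saproj_le p q : saproj p -> saproj q -> (forall x, p (q x) = p x) -> qle p q.
Proof.
move=> pp pq h x; rewrite !saproj_qf// -h ler_pXn2r ?nnegrE ?nrm_ge0//.
exact: saproj_nrm.
Qed.

(** At [q x - x] the form of [q] vanishes, hence so does that of [S], which lies between 0 and it; a
    positive operator kills every vector at which its form vanishes. *)
Lemma le_saproj S q x : sa S -> (forall y, 0 <= qf S y) -> saproj q -> qle S q -> S (q x) = S x.
Proof.
move=> sS pS pq Sq; have [sq qq] := pq; apply/eqP; rewrite -subr_eq0 -(linB _ _ (sa_linear As sS)).
apply/eqP; apply: positive_eq0 => //; apply/le_anti; rewrite pS andbT.
apply: le_trans (Sq _) _; rewrite saproj_qf// (linB _ _ (sa_linear As sq)) qq subrr.
by rewrite nrm0 expr0n.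
Qed.

(** [2S - S^2] is [1 - (1 - S)^2] written without the identity. It is at most 1 because
    [(1 - S)^2 >= 0], and at least [S] because [S^2 <= S]. *)
Lemma sa_shift_dbl S : sa S -> (forall x, 0 <= qf S x <= nrm x ^+ 2) ->
  [/\ sa (S + S - (S \o S)), qle S (S + S - (S \o S)) &
    forall x, 0 <= qf (S + S - (S \o S)) x <= nrm x ^+ 2].
Proof.
move=> sS hS; have s2 := sa_add As sS sS; have s3 := sa_mul As sS sS.
have E x : qf (S + S - (S \o S)) x = qf S x + qf S x - nrm (S x) ^+ 2.
  by rewrite qfB qfD (qf_square dot_norm As).
have h x : nrm (S x) ^+ 2 <= qf S x.
  rewrite -[qf S x]mul1r; apply: (positive_op_norm dot_norm) => //.
  - exact: sa_linear As _ sS.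
  - exact: sa_symmetric As _ sS.
  - by move=> y; rewrite mul1r hS.
split; first exact: sa_sub.
  by move=> x; rewrite E; have := h x; lra.
move=> x; rewrite E; have := h x; have /andP[h1 h2] := hS x.
have := sqr_ge0 (nrm (x - S x)).
rewrite -(rdotxx dot_norm (x - S x)) rdotBl !rdotBr !(rdotxx dot_norm) (rdotC _ x) -/(qf S x).
by move=> ? ?; apply/andP; split; lra.
Qed.

Lemma scale_contraction S : sa S -> exists2 c, 0 < c &
  (forall x, 0 <= qf S x) -> forall x, 0 <= qf ((c%:C)%C *: S) x <= nrm x ^+ 2.
Proof.
move=> sS; have [c c0 hc] := qf_bound dot_norm (sa_bounded As (proj1 sS)).
exists c^-1; rewrite ?invr_gt0// => pS x; rewrite qfZ ler_pdivrMl//.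
rewrite mulr_ge0 ?invr_ge0 ?(ltW c0) ?pS//=.
exact: le_trans (ler_norm _) (hc x).
Qed.

(* The sequence [N, 2N - N^2, ...] increases to the range projection. *)
Lemma range_projection S : sa S -> (forall x, 0 <= qf S x) ->
  exists r, [/\ saproj r, forall x, S (r x) = S x & forall x, S x = 0 -> r x = 0].
Proof.
move=> sS pS; have [c c0 /(_ pS) hc] := scale_contraction sS.
pose N0 := (c%:C)%C *: S; have sN0 : sa N0 by exact: sa_scale.
pose N := fix N n := if n is n.+1 then N n + N n - (N n \o N n) else N0.
have hN n : sa (N n) /\ forall x, 0 <= qf (N n) x <= nrm x ^+ 2.
  by elim: n => [//|n [sn hn]] /=; have [] := sa_shift_dbl sn hn.
have NS n : qle (N n) (N n.+1) by have [sn hn] := hN n; have [] := sa_shift_dbl sn hn.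
have Nle n m : (n <= m)%N -> qle (N n) (N m).
  move=> /subnK <-; elim: (m - n)%N => [|k IH]; first by move=> x.
  by apply: (qle_trans IH); exact: NS.
have Dsa : range N `<=` sa by move=> _ [n _ <-]; case: (hN n).
have D0 : range N !=set0 by exists (N 0%N); exists 0%N.
have Dd : qdirected (range N).
  move=> _ _ [n _ <-] [m _ <-]; exists (N (maxn n m)); split; first by exists (maxn n m).
    by apply: Nle; exact: leq_maxl.
  by apply: Nle; exact: leq_maxr.
have Dc T x : range N T -> qf T x <= 1 * nrm x ^+ 2.
  by move=> [n _ <-]; rewrite mul1r; case: (hN n) => _ /(_ x)/andP[].
have [r supr] := sa_sup_exists Dsa D0 Dd Dc.
have [sr ubr lbr] := (sa_supP r Dsa).1 supr.
have lim x e : 0 < e -> exists n, forall m, (n <= m)%N -> nrm (N m x - r x) < e.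
  move=> e0; have [_ [n _ <-] hn] := sa_sup_strong Dsa D0 Dd supr x e0.
  by exists n => m nm; apply: hn; [exists m|exact: Nle].
have Nnrm n x : nrm (N n x) <= nrm x.
  have [sn hn] := hN n; rewrite -(@ler_pXn2r _ 2) ?nnegrE ?nrm_ge0//.
  have /andP[h1 h2] := hn x; apply: le_trans h2; rewrite -[qf _ _]mul1r.
  apply: (positive_op_norm dot_norm) => //.
  - exact: sa_linear As _ sn.
  - exact: sa_symmetric As _ sn.
  - by move=> y; rewrite mul1r hn.
(* [N_n^2 - N_n = N_n - N_{n+1}] tends strongly to 0, which makes the limit idempotent. *)
have rr x : r (r x) = r x.
  apply/eqP; rewrite -subr_eq0; apply/eqP/(@small_nrm_eq0 _ _ _ 5) => e e0.
  have [n1 h1] := lim x e e0; have [n2 h2] := lim (r x) e e0.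
  pose n := maxn n1 n2; have [sn _] := hN n; have ln := sa_linear As sn.
  have a1 := h1 n (leq_maxl _ _); have a2 := h2 n (leq_maxr _ _).
  have a3 := h1 n.+1 (leqW (leq_maxl _ _)).
  have a4 := Nnrm n (r x - N n x); rewrite linB// in a4.
  have a5 : N n (N n x) - N n x = N n x - N n.+1 x.
    rewrite -[N n.+1 x]/(N n x + N n x - N n (N n x)) opprB addrCA; congr (_ + _).
    by rewrite opprD addrA subrr sub0r.
  have b1 := nrm_tri (r (r x)) (N n (r x)) (r x).
  have b2 := nrm_tri (N n (r x)) (N n (N n x)) (r x).
  have b3 := nrm_tri (N n (N n x)) (N n x) (r x).
  have b4 := nrm_tri (N n x) (r x) (N n.+1 x).
  rewrite a5 in b3; rewrite nrmBC in a2; rewrite (nrmBC (r x)) in a4.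
  by rewrite (nrmBC (r x)) in b4; lra.
have rN x : N0 (r x) = N0 x.
  apply: le_saproj => //; first by move=> y; case: (hN 0%N) => _ /(_ y)/andP[].
  by apply: ubr; exists 0%N.
have S0 x : S x = ((c^-1)%:C)%C *: N0 x.
  by rewrite /N0 opE scalerA -rmorphM /= mulVf ?gt_eqF// scale1r.
exists r; split=> //; first by move=> x; rewrite !S0 rN.
move=> x Sx; apply/nrm_lt_eq0 => e e0; have [n hn] := lim x e e0.
have N0x m : N m x = 0.
  elim: m => [|m IH]; first by rewrite /= /N0 opE Sx scaler0.
  have [sm _] := hN m.
  by rewrite /= !opE /= IH (lin0 (sa_linear As sm)) addr0 subrr.
by have := hn n (leqnn _); rewrite N0x sub0r nrmN.
Qed.
Lemma saproj_zero : saproj 0.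
Proof. by split=> //; exact: sa_zero As. Qed.

Lemma sa_comm2 S T x : sa S -> sa T -> S (T x) = T (S x).
Proof. by move=> [AS _] [AT _]; exact: (sa_comm As x AS AT). Qed.

Lemma saproj_join p q : saproj p -> saproj q ->
  [/\ saproj (p + q - (p \o q)), forall x, p ((p + q - (p \o q)) x) = p x
    & forall x, q ((p + q - (p \o q)) x) = q x].
Proof.
move=> [sp pp] [sq qq]; have lp := sa_linear As sp; have lq := sa_linear As sq.
have pj x : p ((p + q - (p \o q)) x) = p x.
  by rewrite !opE /= linB// linD// !pp addrK.
have qj x : q ((p + q - (p \o q)) x) = q x.
  rewrite !opE /= linB// linD// qq (sa_comm2 (q x) sq sp) qq.
  by rewrite (sa_comm2 x sq sp) addrAC subrr add0r.
split=> //; split; first exact: (sa_sub As (sa_add As sp sq) (sa_mul As sp sq)).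
by move=> x; rewrite [LHS]/(p _ + q _ - p (q _)) /= pj qj.
Qed.

Lemma saproj_diff r p : saproj r -> saproj p -> (forall x, r (p x) = p x) ->
  saproj (r - p).
Proof.
move=> [sr rr] [sp pp] rp; have lr := sa_linear As sr; have lp := sa_linear As sp.
split; first exact: sa_sub.
move=> x; rewrite !opE linB// linB// rr rp pp (sa_comm2 x sp sr) rp.
by rewrite subrr subr0.
Qed.

(** [S] is the adjoint of [T] composed with [T]. It replaces an arbitrary member of [A] by a
    positive one with the same kernel, to which [range_projection] applies. *)
Lemma gram_op T : A T -> exists S, [/\ sa S, forall x, qf S x = nrm (T x) ^+ 2
  & forall x, T x = 0 -> S x = 0].
Proof.
move=> AT; have [T' AT' adjT] := sa_adj As AT.
have adjE u v : rdot dot (T u) v = rdot dot u (T' v) by rewrite /rdot adjT.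
exists (T' \o T); split.
- apply: (sa_intro As); first exact: (sa_comp As).
  by move=> u v /=; rewrite rdotC -adjE rdotC adjE.
- by move=> x; rewrite /qf /= rdotC -adjE rdotxx.
- by move=> x Tx; rewrite /= Tx lin0//; exact: (bounded_op_linear (sa_bounded As AT')).
Qed.

(** [e = r - p], where [p] is the largest projection of [A] below [r] that kills [xi]. If
    [T xi = 0], the range projection [q] attached to [T \o r] is a competitor, so [q <= p], and [q]
    vanishes on the range of [e]; hence so does [T]. *)
Lemma vector_support r (xi : H) : saproj r -> r xi = xi ->
  exists e, [/\ saproj e, e xi = xi, forall x, r (e x) = e x &
    forall T, A T -> T xi = 0 -> forall x, T (e x) = 0].
Proof.
move=> pr rxi; have [sr rr] := pr; have lr := sa_linear As sr.
pose D := [set p | [/\ saproj p, p xi = 0 & forall x, r (p x) = p x]].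
have Dsa : D `<=` sa by move=> p [[]].
have D0 : D !=set0.
  by exists 0; split=> //; [exact: saproj_zero|move=> x; rewrite (lin0 lr)].
have Dd : qdirected D.
  move=> p q [pp pxi rp] [pq qxi rq]; have [pj jp jq] := saproj_join pp pq.
  exists (p + q - (p \o q)); split; [split=> //| |].
  - by rewrite !opE /= pxi qxi (lin0 (sa_linear As (proj1 pp))) addr0 subr0.
  - by move=> x; rewrite !opE /= linB// linD// !rp rq.
  - exact: saproj_le.
  - exact: saproj_le.
have Dc T x : D T -> qf T x <= 1 * nrm x ^+ 2.
  move=> [pT _ _]; rewrite mul1r saproj_qf// ler_pXn2r ?nnegrE ?nrm_ge0//.
  exact: saproj_nrm.
have [p supp] := sa_sup_exists Dsa D0 Dd Dc.
have [sp ubp lbp] := (sa_supP p Dsa).1 supp; have lp := sa_linear As sp.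
have lim2 x y e : 0 < e -> exists q, [/\ D q, nrm (q x - p x) < e & nrm (q y - p y) < e].
  move=> e0; have [q1 D1 h1] := sa_sup_strong Dsa D0 Dd supp x e0.
  have [q2 D2 h2] := sa_sup_strong Dsa D0 Dd supp y e0.
  have [q [Dq q1q q2q]] := Dd _ _ D1 D2.
  by exists q; split=> //; [exact: h1|exact: h2].
have pxi : p xi = 0.
  apply: nrm_lt_eq0 => e e0; have [q [[_ qxi _] h _]] := lim2 xi xi e e0.
  by move: h; rewrite qxi sub0r nrmN.
have rp x : r (p x) = p x.
  apply/eqP; rewrite -subr_eq0; apply/eqP/(@small_nrm_eq0 _ _ _ 2) => e e0.
  have [q [[pq _ rq] h _]] := lim2 x x e e0.
  have := nrm_tri (r (p x)) (r (q x)) (p x); rewrite -linB// rq.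
  by have := saproj_nrm (p x - q x) pr; rewrite nrmBC in h; rewrite -(nrmBC (p x) (q x)) in h *;
    lra.
have ppr : saproj p.
  split=> // x; apply/eqP; rewrite -subr_eq0; apply/eqP/(@small_nrm_eq0 _ _ _ 3) => e e0.
  have [q [[pq _ rq] h1 h2]] := lim2 x (p x) e e0.
  have lq := sa_linear As (proj1 pq).
  have b1 := nrm_tri (p (p x)) (q (p x)) (p x); have b2 := nrm_tri (q (p x)) (q (q x)) (p x).
  rewrite -linB// pq.2 in b2.
  have b3 := saproj_nrm (p x - q x) pq.
  by rewrite (nrmBC (p (p x)) (q (p x))) in b1; rewrite (nrmBC (p x) (q x)) in b3; lra.
have pe := saproj_diff pr ppr rp.
exists (r - p); split=> //.
- by rewrite !opE rxi pxi subr0.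
- by move=> x; rewrite !opE linB// rr rp.
move=> T AT Txi x; have lT := bounded_op_linear (sa_bounded As AT).
(* [T \o r] rather than [T]: its kernel contains every [x - r x], which puts [q] below [r], as
   membership in [D] requires. *)
have [S [sS qS S0]] := gram_op (sa_comp As AT (proj1 sr)).
have pS y : 0 <= qf S y by rewrite qS sqr_ge0.
have [q [pq Sq q0]] := range_projection sS pS.
have lq := sa_linear As (proj1 pq).
have qr y : q (r y) = q y.
  apply/eqP; rewrite -subr_eq0 -linB//; apply/eqP/q0/S0.
  by rewrite /= linB// rr subrr (lin0 lT).
have Dq : D q.
  split=> //; first by apply/q0/S0; rewrite /= rxi.
  by move=> y; rewrite -(sa_comm2 y (proj1 pq) sr).
have qp y : q (p y) = q y.
  apply: (le_saproj y (proj1 pq) _ ppr (ubp _ Dq)).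
  by move=> z; rewrite saproj_qf// sqr_ge0.
have re : r ((r - p) x) = (r - p) x by rewrite !opE linB// rr rp.
have Se : S ((r - p) x) = 0.
  by rewrite -Sq !opE linB// qr qp subrr (lin0 (sa_linear As sS)).
have : nrm ((T \o r) ((r - p) x)) ^+ 2 = 0 by rewrite -qS /qf Se rdot0l.
by move=> /eqP; rewrite sqrf_eq0 => /eqP/nrm_eq0 /=; rewrite re.
Qed.

Definition separated_by p (xi : H) := forall T, A T -> T xi = 0 -> forall x, T (p x) = 0.

(** [f] need only cover [D], with [t0] as filler, so an empty [D] is no exception. *)
Lemma seq_range (Y : Type) (t0 : Y) (D : set Y) : countable D ->
  exists f : nat -> Y, forall t, D t -> exists n, f n = t.
Proof.
move=> /countable_injP[g gi].
have /choice[f hf] : forall n : nat, exists t : Y, forall u, D u -> g u = n -> t = u.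
  move=> n; have [[u [Du gu]]|no] := pselect (exists u, D u /\ g u = n).
    by exists u => v Dv gv; apply: gi; rewrite ?inE// gu gv.
  by exists t0 => v Dv gv; case: no; exists v.
by exists f => t Dt; exists (g t); exact: hf.
Qed.

Definition separating (xi : nat -> H) :=
  forall T, A T -> (forall j, T (xi j) = 0) -> forall x, T x = 0.

(** Zorn's lemma gives a maximal orthogonal family [Q] of nonzero projections of [A], each separated
    by some vector; it is countable. If [T] kills all these vectors but not [x0], the range
    projection [r] attached to [T] is orthogonal to [Q], and the support of [r x0] below [r] would
    enlarge [Q]. *)
Lemma sigma_finite_separating : algebra_sigma_finite dot A ->
  exists xi : nat -> H, separating xi.
Proof.
move=> sf; pose P := [set Q : set (H -> H) |
  (forall p, Q p -> [/\ saproj p, p <> 0 & exists xi, separated_by p xi]) /\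
  (forall p q, Q p -> Q q -> p <> q -> p \o q = 0)].
have [F FP Ftot|Q [[Q1 Q2] Qmax]] := @Zorn_bigcup _ P.
  split; first by move=> p [X FX Xp]; have [h _] := FP X FX; exact: h.
  move=> p q [X FX Xp] [Y FY Yq]; have [XY|YX] := Ftot X Y FX FY.
    by have [_ h] := FP Y FY; apply: h => //; exact: XY.
  by have [_ h] := FP X FX; apply: h => //; exact: YX.
have Qc : countable Q.
  apply: sf; first by move=> p /Q1[[[]]].
  - move=> p /Q1[[[Ap sp] pp] p0 _]; split=> //; split=> //; exact/funext.
  - exact: Q2.
have [pi hpi] := seq_range 0 Qc.
have /choice[xi hxi] : forall n, exists xi, Q (pi n) -> separated_by (pi n) xi.
  move=> n; have [Qn|] := pselect (Q (pi n)); last by exists 0.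
  by have [_ _ [xi h]] := Q1 _ Qn; exists xi.
exists xi => T AT Txi; apply: contrapT => /existsNP[x0 Tx0].
have lT := bounded_op_linear (sa_bounded As AT).
have Tp p x : Q p -> T (p x) = 0.
  by move=> /[dup] Qp /hpi[n np]; rewrite -np in Qp *; apply: (hxi n Qp).
have [S [sS qS S0]] := gram_op AT.
have [r [pr Sr r0]] := range_projection sS (fun y => eq_ind_r (fun t => 0 <= t) (sqr_ge0 _) (qS y)).
have [sr rr] := pr.
have rx0 : r x0 <> 0.
  move=> rx0; apply: Tx0; apply/nrm_eq0/eqP; rewrite -sqrf_eq0 -qS /qf -Sr rx0.
  by rewrite (lin0 (sa_linear As sS)) rdot0l.
have [e [pe exi re sepe]] := vector_support pr (rr x0).
have rp p x : Q p -> r (p x) = 0 by move=> Qp; apply/r0/S0/Tp.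
have ep p : Q p -> e \o p = 0.
  move=> Qp; apply/funext => x /=; have [[sp _] _ _] := Q1 _ Qp.
  rewrite -re (sa_comm2 _ sr (proj1 pe)) rp//.
  exact: lin0 (sa_linear As (proj1 pe)).
have pe0 p : Q p -> p \o e = 0.
  move=> Qp; rewrite -(ep p Qp); apply/funext => x /=; have [[sp _] _ _] := Q1 _ Qp.
  exact: sa_comm2 sp (proj1 pe).
have e0 : e <> 0 by move=> e0; apply: rx0; rewrite -exi e0.
have nQe : ~ Q e.
  move=> Qe; apply: e0; rewrite -(ep e Qe); apply/funext => x /=.
  by rewrite pe.2.
apply: (Qmax (Q `|` [set e])).
  split; last by move=> h; apply: nQe; apply: h; right.
  by move=> p Qp; left.
split.
  by move=> p [/Q1//|->]; split=> //; exists (r x0).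
move=> p q [Qp|->] [Qq|->] // pq; first exact: Q2.
- exact: pe0.
- exact: ep.
Qed.

(** An increasing sequence of indices is chosen whose [n]-th member is within [1 / (n + 1)] of [x]
    at [xi 0, ..., xi n]. Its supremum [y] satisfies [y <= x], and the form of [x - y] vanishes at
    every [xi j]. By positivity [x - y] kills each [xi j], so it is 0. *)
Lemma separating_csp (xi : nat -> H) : separating xi ->
  countable_sup_property (op_le dot) sa (sa_pos dot A).
Proof.
move=> sep I leI u x [i0] leII leT dir uP xP umono supx.
have su i : sa (u i) by case: (uP i).
have Dsa (B : set I) : u @` B `<=` sa by move=> _ [i _ <-].
have umono2 i j : leI i j -> qle (u i) (u j).
  by move=> ij; apply/(sa_leP As (su i) (su j)); exact: umono.
have Dr : range u `<=` sa by exact: Dsa.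
have Dd : qdirected (range u).
  move=> _ _ [i _ <-] [j _ <-]; have [k [ik jk]] := dir i j.
  by exists (u k); split; [exists k|exact: umono2|exact: umono2].
have D0 : range u !=set0 by exists (u i0); exists i0.
have [sx ubx lbx] := (sa_supP x Dr).1 supx.
(* The estimate is demanded at all indices above [k], which is what lets the induction on the number
   of vectors move on to a larger index. *)
have stepe n i : exists k, leI i k /\ forall j, (j <= n)%N ->
    forall l, leI k l -> qf x (xi j) - n.+1%:R^-1 < qf (u l) (xi j).
  have e0 : 0 < n.+1%:R^-1 :> R by rewrite invr_gt0.
  suff H1 m : exists k, leI i k /\ forall j, (j < m)%N ->
      forall l, leI k l -> qf x (xi j) - n.+1%:R^-1 < qf (u l) (xi j).
    by have [k [ik hk]] := H1 n.+1; exists k; split.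
  elim: m => [|m [k [ik hk]]]; first by exists i; split.
  have [_ [a _ <-] ha] := sa_sup_weak Dr D0 Dd supx (xi m) e0.
  have [b [kb ab]] := dir k a; exists b; split; first exact: leT kb.
  move=> j; rewrite ltnS leq_eqVlt => /orP[/eqP-> l bl|jm l bl].
    by apply: ha; [exists l|apply: umono2; exact: leT bl].
  by apply: hk => //; exact: leT bl.
have [f hf] : exists f : nat -> I -> I, forall n i, leI i (f n i) /\
    forall j, (j <= n)%N -> forall l, leI (f n i) l ->
      qf x (xi j) - n.+1%:R^-1 < qf (u l) (xi j).
  have /choice[g hg] : forall ni : nat * I, exists k, leI ni.2 k /\
    forall j, (j <= ni.1)%N -> forall l, leI k l ->
      qf x (xi j) - ni.1.+1%:R^-1 < qf (u l) (xi j).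
    by move=> [n i]; exact: stepe.
  by exists (fun n i => g (n, i)) => n i; exact: (hg (n, i)).
pose l := fix l n := if n is n'.+1 then f n (l n') else f 0%N i0.
have ll n : leI (l n) (l n.+1) by case: (hf n.+1 (l n)).
have lmono n m : (n <= m)%N -> leI (l n) (l m).
  by move=> /subnK <-; elim: (m - n)%N => // k IH; apply: leT IH (ll _).
have lxi n j : (j <= n)%N -> qf x (xi j) - n.+1%:R^-1 < qf (u (l n)) (xi j).
  by case: n => [|n] jn; [have [_ h] := hf 0%N i0|have [_ h] := hf n.+1 (l n)]; apply: h.
exists l; have Er : range (u \o l) `<=` sa by move=> _ [n _ <-] /=.
have Ed : qdirected (range (u \o l)).
  move=> _ _ [n _ <-] [m _ <-]; exists (u (l (maxn n m))); split.
  - by exists (maxn n m).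
  - by apply: umono2; apply: lmono; exact: leq_maxl.
  - by apply: umono2; apply: lmono; exact: leq_maxr.
have E0 : range (u \o l) !=set0 by exists (u (l 0%N)); exists 0%N.
have [c c0 hc] := qf_bound dot_norm (sa_bounded As (proj1 sx)).
have Ec S z : range (u \o l) S -> qf S z <= c * nrm z ^+ 2.
  move=> [n _ <-]; apply: le_trans (_ : qf x z <= _); first by apply: ubx; exists (l n).
  exact: le_trans (ler_norm _) (hc z).
have [y supy] := sa_sup_exists Er E0 Ed Ec.
have [sy uby lby] := (sa_supP y Er).1 supy.
have yx : qle y x by apply: lby => // S [n _ <-]; apply: ubx; exists (l n).
suff <- : y = x by [].
apply/funext => z; apply/eqP; rewrite eq_sym -subr_eq0; apply/eqP.
have sxy := sa_sub As sx sy.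
apply: (sep (x - y) (proj1 sxy)) => j; apply: positive_eq0 => //.
  by move=> w; rewrite qfB subr_ge0 yx.
apply/eqP; rewrite eq_le qfB subr_ge0 yx andbT.
apply/ler_addgt0Pl => e e0; have [N hN] := natSinv_small e0.
rewrite addr0; pose n := maxn N j.
have h1 := lxi n j (leq_maxr _ _); have h2 := hN n (leq_maxl _ _).
have : qf (u (l n)) (xi j) <= qf y (xi j) by apply: uby; exists n.
move: h1 h2; set a := _^-1; lra.
Qed.

End suprema.

(** * The countable sup property and sigma-finiteness *)

Section countable_sup.
Context {R : realType} {H : completeNormedModType R[i]}.
Context (dot : {dot H for Num.conj}).
Context (dot_norm : forall x : H, dot x x = `|x| ^+ 2).
Context (A : set (H -> H)) (As : star_alg dot A).
Context (Acl : forall T, bounded_op T -> sot_approx A T -> A T).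
Implicit Types (x y z : H) (p q S T : H -> H).

Local Notation sa := (sa_part dot A).
Local Notation qf := (qf dot).
Local Notation qle := (qle dot).
Local Notation saproj := (saproj dot A).

Lemma nrm_closure (D : set H) y (e : R) : closure D y -> 0 < e ->
  exists2 d, D d & nrm (d - y) < e.
Proof.
move=> clD e0; have ec : 0 < (e%:C)%C by rewrite ltcR.
have [d [Dd]] := clD _ (nbhsx_ballx y _ ec).
by rewrite -ball_normE /= normE ltcR nrmBC => h; exists d.
Qed.

Lemma closure_nrm (D : set H) y :
  (forall e : R, 0 < e -> exists2 d, D d & nrm (d - y) < e) -> closure D y.
Proof.
move=> h B /nbhs_ballP[d d0 dB].
have [er eE] : exists er : R, d = (er%:C)%C.
  by exists (complex.Re d); case: d d0 {dB} => a b /=; rewrite ltcE /= => /andP[/eqP->].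
move: d0 dB; rewrite eE /= ltcR => er0 dB.
have [z Dz hz] := h _ er0; exists z; split=> //; apply: dB.
by rewrite -ball_normE /= normE ltcR nrmBC.
Qed.

(** [T] kills a dense sequence of [N], hence [N] itself. By commutativity
    [|Tx|^2 = <x, T'T x> = <x, T T'x>] with [T'x] in [N], so [T] vanishes everywhere, not merely on
    [N]. *)
Lemma separable_separating (N : set H) : (forall T x, A T -> N (T x)) ->
  separable_set N -> exists xi : nat -> H, separating A xi.
Proof.
move=> AN [D [cD DN ND]]; have [xi hxi] := seq_range 0 cD.
exists xi => T AT Txi x; have [lT [c c0 hc]] := (bounded_opP T).1 (sa_bounded As AT).
have TN y : N y -> T y = 0.
  move=> /ND clD; apply: (@small_nrm_eq0 _ _ _ c) => e e0.
  have [d /hxi[n dn] hd] := nrm_closure clD e0.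
  have := hc (d - y); rewrite linB// -dn Txi sub0r nrmN => h; apply: le_trans h _.
  by rewrite mulrC ler_pM2r// dn ltW.
have [S [sS qS _]] := gram_op dot_norm As AT.
have [T' AT' adjT] := sa_adj As AT.
apply/nrm_eq0/eqP; rewrite -sqrf_eq0 -(rdotxx dot_norm) /rdot adjT.
by rewrite -(sa_comm As x AT AT') TN ?linear0r//; exact: AN.
Qed.

(** Sequences represent finite sets of projections. [undup] discards repetitions, so that inclusion
    of the underlying sets is all that matters in [proj_sum_absorb2]. *)
Definition proj_sum (s : seq (H -> H)) : H -> H := \sum_(p <- undup s) p.

Lemma proj_sum_cons p s : p \notin s -> proj_sum (p :: s) = p + proj_sum s.
Proof. by move=> ps; rewrite /proj_sum /= (negbTE ps) big_cons. Qed.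

Lemma proj_sumE s x : proj_sum s x = \sum_(p <- undup s) p x.
Proof.
rewrite /proj_sum; elim: (undup s) => [|p t IH]; first by rewrite !big_nil.
by rewrite !big_cons addopE IH.
Qed.

Section orthogonal_projections.
Context (P : set (H -> H)) (Pproj : forall p, P p -> saproj p).
Context (Porth : forall p q, P p -> P q -> p <> q -> p \o q = 0).

Lemma proj_sum_absorb p s x : (forall q, q \in s -> P q) -> p \in s ->
  p (proj_sum s x) = p x.
Proof.
move=> sP ps; rewrite proj_sumE; have [sp pp] := Pproj (sP p ps).
have lp := sa_linear As sp.
have -> : forall t, p (\sum_(q <- t) q x) = \sum_(q <- t) p (q x).
  by elim=> [|q t IH]; rewrite ?big_nil ?(lin0 lp)// !big_cons linD// IH.
rewrite (bigD1_seq p) ?undup_uniq ?mem_undup//= pp big1_seq ?addr0// => q.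
rewrite mem_undup => /andP[qp qs]; have pq : p <> q by move/eqP: qp => qp /esym.
by have := Porth (sP p ps) (sP q qs) pq; move=> /(congr1 (fun f => f x)).
Qed.

Lemma sa_proj_sum s : (forall q, q \in s -> P q) -> sa (proj_sum s).
Proof.
move=> sP; rewrite /proj_sum.
have : forall q, q \in undup s -> P q by move=> q; rewrite mem_undup; exact: sP.
elim: (undup s) => [|p t IH] tP; first by rewrite big_nil; exact: sa_zero As.
rewrite big_cons; apply: (sa_add As); first by case: (Pproj (tP p (mem_head _ _))).
by apply: IH => q qt; apply: tP; rewrite inE qt orbT.
Qed.

Lemma proj_sum_absorb2 s t x : (forall q, q \in t -> P q) -> {subset s <= t} ->
  proj_sum s (proj_sum t x) = proj_sum s x.
Proof.
move=> tP st; rewrite [LHS]proj_sumE [RHS]proj_sumE; rewrite [LHS]big_seq [RHS]big_seq.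
by apply: eq_bigr => p; rewrite mem_undup => /st pt; rewrite proj_sum_absorb.
Qed.

Lemma saproj_proj_sum s : (forall q, q \in s -> P q) -> saproj (proj_sum s).
Proof. by move=> sP; split; [exact: sa_proj_sum|move=> x; exact: proj_sum_absorb2]. Qed.

End orthogonal_projections.

(** Finite subsets of [P], ordered by inclusion, index a bounded increasing net of projections, with
    supremum [x]. A [p] in [P] missed by all of the countably many selected subsets can be added to
    each selected sum without leaving [x]. So [x - p] bounds these sums, whence [x <= x - p] and
    [p = 0]. *)
Lemma csp_sigma_finite :
  countable_sup_property (op_le dot) sa (sa_pos dot A) -> algebra_sigma_finite dot A.
Proof.
move=> csp P PA Pproj Porth.
have Ps p : P p -> saproj p.
  move=> Pp; have [[sp pp] _] := Pproj p Pp; split; first by split=> //; exact: PA.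
  by move=> x; rewrite -[in RHS]pp.
pose I := {s : seq (H -> H) | forall q, q \in s -> P q}.
pose u (i : I) := proj_sum (sval i).
have ups i : saproj (u i) by apply: (saproj_proj_sum Ps Porth); exact: (svalP i).
pose leI (i j : I) := {subset sval i <= sval j}.
have umono i j : leI i j -> qle (u i) (u j).
  move=> ij; apply: (saproj_le dot_norm As) => // x.
  by apply: (proj_sum_absorb2 Ps Porth) => //; exact: (svalP j).
have nilP : forall q : H -> H, q \in [::] -> P q by [].
pose i0 : I := exist _ [::] nilP.
have dir i j : exists k, leI i k /\ leI j k.
  have catP q : q \in sval i ++ sval j -> P q.
    by rewrite mem_cat => /orP[|]; [exact: (svalP i)|exact: (svalP j)].
  exists (exist _ _ catP); split=> q qs; rewrite /= mem_cat qs ?orbT//.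
have Dsa : range u `<=` sa by move=> _ [i _ <-]; case: (ups i).
have D0 : range u !=set0 by exists (u i0); exists i0.
have Dd : qdirected dot (range u).
  move=> _ _ [i _ <-] [j _ <-]; have [k [ik jk]] := dir i j.
  by exists (u k); split; [exists k|exact: umono|exact: umono].
have Dc T x : range u T -> qf T x <= 1 * nrm x ^+ 2.
  move=> [i _ <-]; rewrite mul1r (saproj_qf dot_norm As)// ler_pXn2r ?nnegrE ?nrm_ge0//.
  exact: (saproj_nrm dot_norm As).
have [x supx] := sa_sup_exists dot_norm As Acl Dsa D0 Dd Dc.
have [sx ubx lbx] := (sa_supP As x Dsa).1 supx.
have pos i : sa_pos dot A (u i).
  split; first by case: (ups i).
  apply/(sa_leP As (sa_zero As) (proj1 (ups i))) => y.
  by rewrite qf0 (saproj_qf dot_norm As)// sqr_ge0.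
have xpos : sa_pos dot A x.
  split=> //; apply/(sa_leP As (sa_zero As) sx); apply: (qle_trans (T := u i0)).
    by have [_ /(sa_leP As (sa_zero As) (proj1 (ups i0)))] := pos i0.
  by apply: ubx; exists i0.
have umono' i j : leI i j -> op_le dot (u i) (u j).
  by move=> ij; apply/(sa_leP As (proj1 (ups i)) (proj1 (ups j))); exact: umono.
have [l supl] := csp I leI u x (inhabits i0) (fun i q => id)
  (fun i j k ij jk q iq => jk q (ij q iq)) dir pos xpos umono' supx.
have Esa : range (u \o l) `<=` sa by move=> _ [n _ <-]; apply: Dsa; exists (l n).
have [_ ubl lbl] := (sa_supP As x Esa).1 supl.
suff sub : P `<=` \bigcup_(n in [set: nat]) [set` sval (l n)].
  apply: (sub_countable (subset_card_le sub)).
  by apply: bigcup_countable => // n _; apply: finite_set_countable; exact: finite_seq.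
move=> p Pp; apply: contrapT => nlp.
have [sp pp] := Ps p Pp.
have xpx : qle x (x - p).
  apply: lbl; first exact: (sa_sub As sx sp).
  move=> _ [n _ <-] y /=; rewrite qfB lerBrDr.
  have pn : p \notin sval (l n) by apply/negP => h; apply: nlp; exists n.
  have cP q : q \in p :: sval (l n) -> P q.
    by rewrite inE => /orP[/eqP->//|]; exact: (svalP (l n)).
  have hu : range u (p + proj_sum (sval (l n))).
    by exists (exist _ _ cP) => //; rewrite /u /= proj_sum_cons.
  by have := ubx _ hu y; rewrite qfD addrC.
have [_ p0] := Pproj p Pp; apply: p0; apply/funext => y; apply: nrm_eq0; apply/eqP.
rewrite -sqrf_eq0 -(saproj_qf dot_norm As)// eq_le; apply/andP; split.
  by have := xpx y; rewrite qfB; lra.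
by rewrite (saproj_qf dot_norm As)// sqr_ge0.
Qed.

End countable_sup.

(** * Integration of bounded Borel functions *)

(* Lebesgue integration is only available over pointed types. *)
Definition pointed_copy (X : Type) (x0 : X) : Type := X.
HB.instance Definition _ (X : choiceType) (x0 : X) := Choice.on (pointed_copy x0).
HB.instance Definition _ (X : choiceType) (x0 : X) :=
  isPointed.Build (pointed_copy x0) x0.

Section bounded_borel_functions.
Context {R : realType} {X : topologicalType}.
Implicit Types (f g : X -> R) (D : set X).
Local Notation bb := (bounded_borel X R).

Definition borel_type (x0 : X) :=
  g_sigma_algebraType ([set U : set X | open U] : set (set (pointed_copy x0))).

(** Quantifying over the base point [x0] covers the empty space too, where there is no [borel_type]
    and every preimage is empty. *)
Lemma bounded_borelP f : bb f <->
  (exists M, forall x, `|f x| <= M) /\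
  forall x0 : X, measurable_fun setT (f : borel_type x0 -> R).
Proof.
split=> -[h1 h2]; split=> //.
- move=> x0; apply: (measurability _ (measurable_realfun.RGenOInfty.measurableE R)).
  by move=> _ [B [a ->] <-]; rewrite setTI; apply: h1; exact: rray_open.
- move=> U oU; have [[x0 _]|noX] := pselect (exists x : X, True).
    have := h2 x0 measurableT U (open_measurable oU); rewrite setTI; exact.
  suff -> : f @^-1` U = set0 by exact: sigma_algebra0.
  by apply/seteqP; split=> // x; case: noX; exists x.
Qed.

Lemma borelT : borel X setT.
Proof. exact: sub_sigma_algebra openT. Qed.

Lemma borel0 : borel X set0.
Proof. exact: sigma_algebra0. Qed.

Lemma borelC D : borel X D -> borel X (~` D).
Proof. by move=> bD; rewrite -setTD; exact: sigma_algebraCD. Qed.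

Lemma borel_bigcup (D : nat -> set X) : (forall n, borel X (D n)) ->
  borel X (\bigcup_n D n).
Proof. exact: sigma_algebra_bigcup. Qed.

Lemma borelU D E : borel X D -> borel X E -> borel X (D `|` E).
Proof.
move=> bD bE; rewrite -bigcup2E; apply: borel_bigcup => -[|[|n]] //=.
exact: borel0.
Qed.

Lemma borelI D E : borel X D -> borel X E -> borel X (D `&` E).
Proof.
by move=> bD bE; rewrite -[_ `&` _]setCK setCI; apply: borelC; apply: borelU; exact: borelC.
Qed.

Lemma borelD D E : borel X D -> borel X E -> borel X (D `\` E).
Proof. by move=> bD bE; rewrite setDE; apply: borelI => //; exact: borelC. Qed.

Lemma borel_open D : open D -> borel X D.
Proof. exact: sub_sigma_algebra. Qed.

Lemma borel_closed D : closed D -> borel X D.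
Proof. by move=> cD; rewrite -[D]setCK; apply: borelC; apply: borel_open; rewrite openC. Qed.

Lemma bbD f g : bb f -> bb g -> bb (fun x => f x + g x).
Proof.
move=> /bounded_borelP[[M hM] mf] /bounded_borelP[[N hN] mg]; apply/bounded_borelP; split.
  by exists (M + N) => x; apply: le_trans (ler_normD _ _) (lerD (hM x) (hN x)).
by move=> x0; exact: (measurable_funD (mf x0) (mg x0)).
Qed.

Lemma bbM f g : bb f -> bb g -> bb (fun x => f x * g x).
Proof.
move=> /bounded_borelP[[M hM] mf] /bounded_borelP[[N hN] mg]; apply/bounded_borelP; split.
  by exists (M * N) => x; rewrite normrM ler_pM.
by move=> x0; exact: (measurable_funM (mf x0) (mg x0)).
Qed.

Lemma bb_cst (a : R) : bb (cst a).
Proof.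
by apply/bounded_borelP; split=> [|x0]; [by exists (`|a|)|exact: measurable_cst].
Qed.

Lemma bbZ (a : R) f : bb f -> bb (fun x => a * f x).
Proof. exact: bbM (bb_cst a). Qed.

Lemma bbN f : bb f -> bb (fun x => - f x).
Proof.
by move=> bf; rewrite (_ : (fun x => - f x) = fun x => -1 * f x); [exact: bbZ|apply/funext => x;
  rewrite mulN1r].
Qed.

Lemma bbB f g : bb f -> bb g -> bb (fun x => f x - g x).
Proof. by move=> bf bg; apply: bbD => //; exact: bbN. Qed.

Lemma bb_max f g : bb f -> bb g -> bb (fun x => Num.max (f x) (g x)).
Proof.
move=> /bounded_borelP[[M hM] mf] /bounded_borelP[[N hN] mg]; apply/bounded_borelP; split.
  exists (Num.max M N) => x; rewrite le_max.
  by case: (leP (f x) (g x)) => _; rewrite ?hM ?hN ?orbT.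
by move=> x0; exact: (measurable_maxr (mf x0) (mg x0)).
Qed.

Lemma bb_indic D : borel X D -> bb (\1_D : X -> R).
Proof.
move=> bD; apply/bounded_borelP; split.
  by exists 1 => x; rewrite indicE ger0_norm// lern1; case: (_ \in _).
by move=> x0; exact: measurable_indic.
Qed.

Lemma bb_abs f : bb f -> bb (fun x => `|f x|).
Proof.
move=> bf; rewrite (_ : (fun x => _) = (fun x => Num.max (f x) (- f x))).
  by apply: bb_max => //; exact: bbN.
by apply/funext => x; rewrite maxrN.
Qed.

Lemma bb_lim (f_ : nat -> X -> R) f (M : R) : (forall n, bb (f_ n)) ->
  (forall n x, `|f_ n x| <= M) -> (forall x, f_ n x @[n --> \oo] --> f x) -> bb f.
Proof.
move=> bf fM cf; apply/bounded_borelP; split.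
  exists M => x; have h : `|f_ n x| @[n --> \oo] --> `|f x| by apply: cvg_norm; exact: cf.
  rewrite -(cvg_lim _ h)//; apply: limr_le; first exact: cvgP h.
  by apply: nearW => n; exact: fM.
move=> x0; apply: (@measurable_fun_cvg _ (borel_type x0) R setT f_ f) => // n.
by have /bounded_borelP[_] := bf n; apply.
Qed.

Lemma bb_continuous f (M : R) : continuous f -> (forall x, `|f x| <= M) -> bb f.
Proof.
move=> cf fM; split; last by exists M.
by move=> U oU; apply: borel_open; exact: open_comp.
Qed.

Lemma borel_ltr f g : bb f -> bb g -> borel X [set x | f x < g x].
Proof.
move=> bf bg; have [h _] := bbB bg bf.
rewrite (_ : [set x | f x < g x] = (fun x => g x - f x) @^-1` `]0, +oo[); first by apply: h;
  exact: rray_open.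
by apply/seteqP; split=> x /=; rewrite in_itv/= andbT subr_gt0.
Qed.

Lemma borel_neq f g : bb f -> bb g -> borel X [set x | f x != g x].
Proof.
move=> bf bg; rewrite (_ : [set x | f x != g x] = [set x | f x < g x] `|` [set x | g x < f x]).
  by apply: borelU; exact: borel_ltr.
by apply/seteqP; split=> x /=; rewrite neq_lt => /orP.
Qed.

End bounded_borel_functions.

(** * Scalar integrals for finite Borel measures *)

Section integration.
Context {R : realType} {X : topologicalType}.
Implicit Types (f g : X -> R) (D : set X).
Local Notation bb := (bounded_borel X R).

Definition finite_measure (m : set X -> R) :=
  [/\ m set0 = 0, forall D, borel X D -> 0 <= m D
    & forall D : nat -> set X, (forall n, borel X (D n)) -> trivIset setT D ->
      (fun N => \sum_(n < N) m (D n)) @ \oo --> m (\bigcup_n D n)].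

(** What is used of the Lebesgue integral, restricted to bounded Borel functions, all of which a
    finite measure integrates. The last field is dominated convergence with a constant bound; values
    of [E] on other functions are unspecified. *)
Record is_integral (m : set X -> R) (E : (X -> R) -> R) : Prop := IsIntegral {
  intg_D : forall f g, bb f -> bb g -> E (fun x => f x + g x) = E f + E g;
  intg_Z : forall (a : R) f, bb f -> E (fun x => a * f x) = a * E f;
  intg_ge0 : forall f, bb f -> (forall x, 0 <= f x) -> 0 <= E f;
  intg_indic : forall D, borel X D -> E (\1_D) = m D;
  intg_cvg : forall (f_ : nat -> X -> R) f M, (forall n, bb (f_ n)) ->
    (forall n x, `|f_ n x| <= M) -> (forall x, f_ n x @[n --> \oo] --> f x) ->
    E (f_ n) @[n --> \oo] --> E f }.

Lemma intg_exists (m : set X -> R) : finite_measure m -> exists E, is_integral m E.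
Proof.
move=> [m0 m_ge0 m_sig].
have [[x0 _]|noX] := pselect (exists x : X, True); last first.
  have D0 D : D = set0 by apply/seteqP; split=> // x; case: noX; exists x.
  exists (fun _ => 0); split=> //.
  - by move=> *; rewrite addr0.
  - by move=> *; rewrite mulr0.
  - by move=> D _; rewrite (D0 D) m0.
  - by move=> *; exact: cvg_cst.
(* [m] is constrained on Borel sets only, whereas nonnegativity of a measure is asked on all sets;
   hence the value 0 elsewhere. *)
pose m' (D : set (borel_type x0)) : \bar R := if `[< borel X D >] then (m D)%:E else 0%E.
have m'E D : borel X D -> m' D = (m D)%:E by move=> bD; rewrite /m'; case: asboolP.
have m'0 : m' set0 = 0%E by rewrite m'E ?m0//; exact: borel0.
have m'ge0 D : (0 <= m' D)%E.
  by rewrite /m'; case: asboolP => // bD; rewrite lee_fin m_ge0.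
have m'sig : semi_sigma_additive m'.
  move=> F mF tF mUF; rewrite m'E//.
  have -> : (fun n => (\sum_(0 <= i < n) m' (F i))%E) = EFin \o (fun n => \sum_(i < n) m (F i)).
    apply/funext => n /=; rewrite big_mkord -sumEFin.
    by apply: eq_bigr => i _; rewrite m'E//; exact: mF.
  by apply: cvg_EFin; [exact: nearW|exact: m_sig].
pose mixin := isMeasure.Build _ (borel_type x0) R m' m'0 m'ge0 m'sig.
pose mu : {measure set (borel_type x0) -> \bar R} := HB.pack m' mixin.
have muT : (mu setT < +oo)%E by rewrite /= m'E ?ltry//; exact: borelT.
have int f : bb f -> mu.-integrable setT (EFin \o (f : borel_type x0 -> R)).
  move=> /bounded_borelP[[M hM] mf]; apply: measurable_bounded_integrable => //.
  exists M; split; first exact: num_real.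
  by move=> N MN x _; apply: le_trans (hM x) (ltW MN).
exists (fun f => Rintegral mu setT (f : borel_type x0 -> R)); split.
- by move=> f g bf bg; rewrite RintegralD//; exact: int.
- by move=> a f bf; rewrite RintegralZl//; exact: int.
- by move=> f bf f0; exact: Rintegral_ge0.
- by move=> D bD; rewrite /Rintegral integral_indic// setIT /= m'E.
move=> f_ f M bf fM cf.
have bbf : bb f by exact: bb_lim bf fM cf.
have /bounded_borelP[_ mf] := bbf.
have mf_ n : measurable_fun setT (f_ n : borel_type x0 -> R).
  by have /bounded_borelP[_] := bf n.
have [] := @dominated_convergence _ (borel_type x0) R mu setT measurableT
  (fun n => EFin \o f_ n) (EFin \o f) (fun=> M%:E).
- by move=> n; apply/measurable_EFinP.
- exact/measurable_EFinP.
- by apply: aeW => x _; apply: cvg_EFin; [exact: nearW|exact: cf].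
- exact: (int (cst M) (bb_cst M)).
- by apply: aeW => x n _; rewrite lee_fin fM.
move=> _ _ h.
apply: fine_cvg; apply: cvg_trans h _.
by rewrite fineK//; exact: (integrable_fin_num measurableT (int f bbf)).
Qed.

Section intg_theory.
Context (m : set X -> R) (E : (X -> R) -> R) (mE : is_integral m E).

Lemma intg_B f g : bb f -> bb g -> E (fun x => f x - g x) = E f - E g.
Proof.
move=> bf bg; rewrite -mulN1r -(intg_Z mE)// -(intg_D mE)//; last exact: bbZ.
by congr E; apply/funext => x; rewrite mulN1r.
Qed.

Lemma intg_le f g : bb f -> bb g -> (forall x, f x <= g x) -> E f <= E g.
Proof.
move=> bf bg fg; rewrite -subr_ge0 -intg_B//; apply: (intg_ge0 mE).
  exact: bbB.
by move=> x; rewrite subr_ge0.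
Qed.

Lemma intg_0 : E (fun=> 0) = 0.
Proof.
rewrite -[RHS](mul0r (E (cst 0))) -(intg_Z mE 0 (bb_cst 0)).
by congr E; apply/funext => x; rewrite mul0r.
Qed.

Lemma intg_sum (I : Type) (s : seq I) (P : pred I) (F : I -> X -> R) :
  (forall i, bb (F i)) ->
  E (fun x => \sum_(i <- s | P i) F i x) = \sum_(i <- s | P i) E (F i).
Proof.
move=> bF; suff [] : E (fun x => \sum_(i <- s | P i) F i x) = \sum_(i <- s | P i) E (F i)
  /\ bb (fun x => \sum_(i <- s | P i) F i x) by [].
elim: s => [|i s [IH bs]].
  rewrite big_nil; under eq_fun do rewrite big_nil.
  by split; [exact: intg_0|exact: bb_cst].
rewrite big_cons; under eq_fun do rewrite big_cons.
case: (P i) => //; split; last exact: bbD.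
by rewrite (intg_D mE)// IH.
Qed.

Lemma m_ge0 D : borel X D -> 0 <= m D.
Proof. by move=> bD; rewrite -(intg_indic mE)//; apply: (intg_ge0 mE) => //; exact: bb_indic. Qed.

Lemma measure_bigcup_null (D : nat -> set X) : (forall n, borel X (D n)) ->
  (forall n, m (D n) = 0) -> m (\bigcup_n D n) = 0.
Proof.
move=> bD D0; pose U n := \big[setU/set0]_(i < n) D i.
have bU n : borel X (U n).
  rewrite /U; elim: n => [|n IH]; first by rewrite big_ord0; exact: borel0.
  by rewrite big_ord_recr /=; exact: borelU.
have U0 n : m (U n) = 0.
  rewrite /U; elim: n => [|n IH].
    by rewrite big_ord0 -(intg_indic mE borel0) indic0 intg_0.
  have bn := bU n; rewrite /U in bn; rewrite big_ord_recr /=; apply/le_anti/andP; split; last first.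
    by apply: m_ge0; exact: borelU.
  rewrite -(addr0 0) -[X in _ <= X + _]IH -[X in _ <= _ + X](D0 n) -!(intg_indic mE)//;
    last exact: borelU.
  rewrite -(intg_D mE); try exact: bb_indic.
  apply: intg_le; [by apply: bb_indic; exact: borelU|by apply: bbD; exact: bb_indic|].
  move=> x; rewrite !indicE in_setU; case: (_ \in _) => /=; case: (x \in D n) => //=; lra.
have bUD : borel X (\bigcup_n D n) by exact: borel_bigcup.
have : E (\1_(U n)) @[n --> \oo] --> E (\1_(\bigcup_n D n)).
  apply: (@intg_cvg _ _ mE _ _ 1).
  - by move=> n; exact: bb_indic.
  - by move=> n x; rewrite indicE ger0_norm ?lern1//; case: (_ \in _).
  move=> x; have [[k _ Dkx]|nD] := pselect ((\bigcup_n D n) x).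
    have -> : \1_(\bigcup_n D n) x = 1 :> R by rewrite indicE mem_set//; exists k.
    apply: cvg_near_cst; exists k.+1 => //= n kn; rewrite indicE mem_set//.
    by rewrite /U -bigcup_mkord; exists k.
  have -> : \1_(\bigcup_n D n) x = 0 :> R by rewrite indicE memNset.
  apply: cvg_near_cst; exists 0%N => //= n _; rewrite indicE memNset//.
  by rewrite /U -bigcup_mkord => -[k _ Dkx]; apply: nD; exists k.
under eq_fun do rewrite (intg_indic mE)// U0.
by move=> h; rewrite -(intg_indic mE)// -(cvg_lim _ h)// lim_cst.
Qed.

(** Markov's inequality makes each set [f > 1 / (n + 1)] null, and these exhaust [f != 0]. *)
Lemma intg_eq0_ae f : bb f -> (forall x, 0 <= f x) -> E f = 0 ->
  m [set x | f x != 0] = 0.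
Proof.
move=> bf f0 Ef0.
pose D n := [set x | n.+1%:R^-1 < f x].
have bD n : borel X (D n) by apply: (borel_ltr (f := cst n.+1%:R^-1)) => //; exact: bb_cst.
have -> : [set x | f x != 0] = \bigcup_n D n.
  apply/seteqP; split=> x /=.
    move=> fx; have fx0 : 0 < f x by rewrite lt_neqAle eq_sym fx f0.
    by have [N _ hN] := near_infty_natSinv_lt (PosNum fx0); exists N => //; exact: hN N (leqnn N).
  by move=> [n _]; rewrite /D /=; apply: contraTN => /eqP->; rewrite -leNgt.
apply: measure_bigcup_null => // n; apply/le_anti; rewrite m_ge0// andbT.
have n0 : 0 < n.+1%:R^-1 :> R by rewrite invr_gt0.
rewrite -(ler_pM2l n0) mulr0 -(intg_indic mE)// -(intg_Z mE); last exact: bb_indic.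
rewrite -Ef0; apply: intg_le => //; first by apply: bbZ; exact: bb_indic.
move=> x; rewrite indicE; case: (boolP (x \in D n)) => [/set_mem xD|_]; rewrite ?mulr1 ?mulr0//.
exact: ltW.
Qed.

Lemma intg_ae0 f D : bb f -> borel X D -> m D = 0 -> (forall x, ~ D x -> f x = 0) -> E f = 0.
Proof.
move=> bf bD D0 fD; have [_ [M fM]] := bf.
have h g : bb g -> (forall x, ~ D x -> g x = 0) -> (forall x, `|g x| <= M) -> E g <= 0.
  move=> bg gD gM; rewrite -(mulr0 M) -D0 -(intg_indic mE)// -(intg_Z mE); last exact: bb_indic.
  apply: intg_le => //; first by apply: bbZ; exact: bb_indic.
  move=> x; rewrite indicE; case: (boolP (x \in D)) => [_|/negP xD]; rewrite ?mulr1 ?mulr0.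
    exact: le_trans (ler_norm _) (gM x).
  by rewrite gD// => /mem_set.
apply/le_anti; rewrite h//= -oppr_le0 -mulN1r -(intg_Z mE)//; apply: h.
- exact: bbZ.
- by move=> x /fD->; rewrite mulr0.
- by move=> x; rewrite mulN1r normrN.
Qed.

Lemma intg_ae f g D : bb f -> bb g -> borel X D -> m D = 0 ->
  (forall x, ~ D x -> f x = g x) -> E f = E g.
Proof.
move=> bf bg bD D0 fg; apply/eqP; rewrite -subr_eq0 -intg_B//; apply/eqP.
apply: (@intg_ae0 _ D) => //; first exact: bbB.
by move=> x /fg->; rewrite subrr.
Qed.

End intg_theory.
End integration.

(** * Approximation by simple functions *)

Section simple_functions.
Context {R : realType} {X : topologicalType}.
Local Notation bb := (bounded_borel X R).

Lemma bb_sf_val (phi : @simple_fun R X) : bounded_borel X R (sf_val phi).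
Proof.
rewrite /sf_val; elim: (index_enum _) => [|i s IH].
  rewrite [Y in bounded_borel _ _ Y](_ : _ = cst 0); first exact: bb_cst.
  by apply/funext => t; rewrite big_nil.
rewrite [Y in bounded_borel _ _ Y](_ : _ = fun t => sf_coef i * \1_(sf_set i) t +
   \sum_(j <- s) sf_coef j * \1_(sf_set j) t); last first.
  by apply/funext => t; rewrite big_cons.
by apply: bbD => //; apply: bbZ; apply: bb_indic; exact: sf_set_borel.
Qed.

Lemma sf_val_ge0 (phi : @simple_fun R X) (t : X) : 0 <= sf_val phi t.
Proof. by apply: sumr_ge0 => i _; rewrite mulr_ge0 ?sf_coef_ge0// indicE. Qed.

Lemma intg_sf (m : set X -> R) I (phi : @simple_fun R X) : is_integral m I ->
  I (sf_val phi) = \sum_i sf_coef i * m (sf_set (s := phi) i).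
Proof.
move=> mI; rewrite /sf_val.
rewrite (@intg_sum R X m I mI _ (index_enum _) xpredT
  (fun (i : 'I_(sf_size phi)) t => sf_coef i * \1_(sf_set i) t)).
  apply: eq_bigr => i _; rewrite (intg_Z mI) ?(intg_indic mI)//.
    exact: sf_set_borel.
  by apply: bb_indic; exact: sf_set_borel.
by move=> i; apply: bbZ; apply: bb_indic; exact: sf_set_borel.
Qed.

(* The dyadic approximations [floor (2^n f) / 2^n]. *)
Lemma simple_approximation (f : X -> R) : bb f -> (forall t, 0 <= f t) ->
  exists phi : nat -> @simple_fun R X,
    [/\ forall n t, sf_val (phi n) t <= sf_val (phi n.+1) t,
        forall n t, sf_val (phi n) t <= f t
      & forall t, sf_val (phi n) t @[n --> \oo] --> f t].
Proof.
move=> bf f0; have [_ [M0 fM0]] := bf.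
(* An integer strictly above [f]: at level [n] the integer part of [2^n f] is then one of [M 2^n]
   values, so there are finitely many level sets. *)
pose M := (Num.truncn `|M0|).+1.
have fM t : f t < M%:R.
  apply: le_lt_trans (ler_norm _) _; apply: le_lt_trans (fM0 t) _.
  by apply: le_lt_trans (ler_norm _) _; exact: truncnS_gt.
pose P n : R := 2 ^+ n.
have P0 n : 0 < P n by rewrite exprn_gt0.
pose k n t := Num.truncn (P n * f t).
have kM n t : (k n t < M * 2 ^ n)%N.
  rewrite -(ltr_nat R) natrM natrX /k; apply: le_lt_trans (_ : P n * f t < _).
    by rewrite truncn_le// mulr_ge0 ?(ltW (P0 n)).
  by rewrite mulrC ltr_pM2r.
have kP n t : (k n t)%:R <= P n * f t < (k n t).+1%:R.
  by rewrite truncn_itv// mulr_ge0// ltW.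
pose D n (i : 'I_(M * 2 ^ n)) := [set t | k n t = i].
have bk n m : borel X [set t | (m <= k n t)%N].
  rewrite (_ : [set t | _] = ~` [set t | P n * f t < m%:R]).
    by apply: borelC; apply: (borel_ltr (g := cst m%:R)); [exact: bbZ|exact: bb_cst].
  apply/seteqP; split=> t /=.
    move=> mk; apply/negP; rewrite -leNgt; have /andP[h _] := kP n t.
    by apply: le_trans h; rewrite ler_nat.
  move=> /negP; rewrite -leNgt => h; have /andP[_ h2] := kP n t.
  by have := le_lt_trans h h2; rewrite ltr_nat ltnS.
have bD n i : borel X (D n i).
  rewrite (_ : D n i = [set t | (i <= k n t)%N] `\` [set t | (i.+1 <= k n t)%N]).
    exact: borelD.
  apply/seteqP; split=> t; rewrite /D /=; first by move=> ->; rewrite leqnn ltnn.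
  by move=> [h1 /negP]; rewrite -leqNgt => h2; apply/eqP; rewrite eqn_leq h1 h2.
have tD n : trivIset setT (D n).
  by move=> i j _ _ [t []]; rewrite /D /= => -> /ord_inj.
have c0 n (i : 'I_(M * 2 ^ n)) : 0 <= (i%:R : R) / P n by rewrite divr_ge0// ltW.
pose phi n := SimpleFun (c0 n) (bD n) (tD n).
have phiE n t : sf_val (phi n) t = (k n t)%:R / P n.
  rewrite /sf_val /= (bigD1 (Ordinal (kM n t)))//= big1 ?addr0.
    by rewrite indicE mem_set ?mulr1.
  move=> i ik; rewrite indicE memNset ?mulr0// => /= ki; move/eqP: ik; apply.
  by apply: val_inj.
exists phi; split.
(* Monotonicity in [n] is the inequality [2 floor(y) <= floor(2 y)]. *)
- move=> n t; rewrite !phiE ler_pdivrMr// mulrAC ler_pdivlMr//.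
  rewrite /P exprS mulrCA mulrA ler_pM2r// -natrM ler_nat mulnC.
  rewrite /k truncn_ge_nat; last by rewrite mulr_ge0// ltW.
  rewrite natrM mulrC /P exprS -mulrA ler_pM2l//; by case/andP: (kP n t).
- by move=> n t; rewrite phiE ler_pdivrMr// mulrC; case/andP: (kP n t).
- move=> t; apply/cvgrPdist_lt => e e0.
  have [N _ hN] := near_infty_natSinv_lt (PosNum e0).
  exists N => // n /= Nn; rewrite phiE.
  have /andP[h1 h2] := kP n t.
  have h3 : f t - (k n t)%:R / P n < (P n)^-1.
    rewrite -(ltr_pM2l (P0 n)) mulrBr mulfV ?gt_eqF// mulrCA mulfV ?gt_eqF// mulr1.
    by rewrite ltrBlDl -natr1 in h2 *.
  rewrite ger0_norm; last by rewrite subr_ge0 ler_pdivrMr// mulrC.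
  apply: lt_trans h3 _; apply: le_lt_trans (hN n Nn).
  rewrite lef_pV2 ?posrE// /P -natrX ler_nat; exact: ltn_expl.
Qed.

End simple_functions.

(** * Continuous functions and their representation *)

Section continuous_functions.
Context {R : realType} {X : topologicalType}.
Implicit Types (f g h : X -> R) (K V : set X).

Lemma cont_cst (a : R) : continuous (fun _ : X => a).
Proof. by move=> x; exact: cst_continuous. Qed.

Lemma cont_max f g : continuous f -> continuous g ->
  continuous (fun x => Num.max (f x) (g x)).
Proof. by move=> cf cg x; exact: (@continuous_max R X f g x (cf x) (cg x)). Qed.

Lemma cont_min f g : continuous f -> continuous g ->
  continuous (fun x => Num.min (f x) (g x)).
Proof. by move=> cf cg x; exact: (@continuous_min R X f g x (cf x) (cg x)). Qed.

Lemma cont_sub f g : continuous f -> continuous g -> continuous (fun x => f x - g x).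
Proof. by move=> cf cg x; exact: (@continuousB R R X f g x (cf x) (cg x)). Qed.

Lemma cont_mul f g : continuous f -> continuous g -> continuous (fun x => f x * g x).
Proof. by move=> cf cg x; exact: (@continuousM R X f g x (cf x) (cg x)). Qed.

Lemma cont_comp f (phi : R -> R) : continuous phi -> continuous f ->
  continuous (fun x => phi (f x)).
Proof. by move=> cp cf x; exact: (@continuous_comp X R R f phi x (cf x) (cp _)). Qed.

Lemma closure_sub_closed (S C : set X) : closed C -> S `<=` C -> closure S `<=` C.
Proof. by move=> cC /closure_subset; rewrite -((closure_id C).1 cC). Qed.

(** The one-point compactification is normal, so [K] can be separated there from the complement of
    [V], which contains infinity. The support of the separating [f] may still reach infinity;
    [max 0 (2 f - 1)] vanishes where [f < 1 / 2], in particular near infinity, and so has compact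
    support. *)
Lemma urysohn_Cc K V : hausdorff_space X -> locally_compact [set: X] ->
  compact K -> open V -> K `<=` V ->
  exists g, [/\ Cc X R g, forall x, 0 <= g x <= 1, forall x, K x -> g x = 1
    & forall x, ~ V x -> g x = 0].
Proof.
move=> hX lX cK oV KV.
pose Y := one_point_compactification X.
have hY : hausdorff_space Y by exact: one_point_compactification_hausdorff.
have cY : compact [set: Y] by exact: one_point_compactification_compact.
have nY : normal_space Y by exact: compact_normal.
have sc : continuous (Some : X -> Y) by exact: one_point_compactification_some_continuous.
pose A : set Y := ~` (Some @` V); pose B : set Y := Some @` K.
have cA : closed A by apply: open_closedC; exact: one_point_compactification_open_some.
have cB : closed B.
  apply: compact_closed => //; apply: continuous_compact => //.
  exact: continuous_subspaceT.
have AB : A `&` B = set0.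
  by apply/seteqP; split=> // y [nA [x Kx xy]]; apply: nA; exists x => //; exact: KV.
have /(@uniform_separatorP _ R)[f [cf f01 fA fB]] := (@normal_separatorP R Y).1 nY A B cA cB AB.
have cfs : continuous (f \o Some : X -> R) by move=> x; apply: continuous_comp;
  [exact: sc|exact: cf].
have f01' x : 0 <= f x <= 1 by have := f01 (f x) (ex_intro2 _ _ x I erefl); rewrite /= in_itv.
have f0 x : A x -> f x = 0 by move=> Ax; apply: (fA (f x)); exists x.
have f1 x : B x -> f x = 1 by move=> Bx; apply: (fB (f x)); exists x.
exists (fun x => Num.max 0 (2 * f (Some x) - 1)); split.
- have cg : continuous (fun x => Num.max 0 (2 * f (Some x) - 1)).
    apply: cont_max; first exact: cont_cst.
    apply: cont_sub; last exact: cont_cst.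
    by apply: cont_mul; [exact: cont_cst|exact: cfs].
  split=> //.
  have [C [cC clC] CN] : nbhs (None : Y) [set y | f y < 1 / 2].
    have h12 : 0 < 1 / 2 :> R by rewrite divr_gt0.
    have /cvgrPdist_lt/(_ _ h12) := cf None.
    apply: filterS => y /=; rewrite f0; last by move=> [].
    by rewrite sub0r normrN; apply: le_lt_trans (ler_norm _).
  apply: (subclosed_compact _ cC); first exact: closed_closure.
  have sub : [set x | Num.max 0 (2 * f (Some x) - 1) != 0] `<=` C.
    move=> x /= gx; apply: contrapT => nCx; move/negP: gx; apply.
    have /= h : f (Some x) < 1 / 2 by apply: CN; left; exists x.
    by rewrite max_l//; lra.
  exact: closure_sub_closed.
- move=> x; have := f01' (Some x) => /andP[h1 h2].
  by rewrite le_max lexx /= ge_max ler01 /=; lra.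
- by move=> x Kx; rewrite f1; [rewrite max_r; lra|exists x].
- move=> x nVx; rewrite f0; first by rewrite max_l; lra.
  by move=> [y Vy [yx]]; apply: nVx; rewrite -yx.
Qed.

Lemma Cc_sub f g : continuous g -> (forall x, f x = 0 -> g x = 0) -> Cc X R f -> Cc X R g.
Proof.
move=> cg fg [cf kf]; split=> //; apply: (subclosed_compact _ kf).
  exact: closed_closure.
by apply: closure_subset => x /=; apply: contra => /eqP/fg->.
Qed.

Lemma Cc_sub2 f g h : continuous h -> (forall x, f x = 0 -> g x = 0 -> h x = 0) ->
  Cc X R f -> Cc X R g -> Cc X R h.
Proof.
move=> ch fgh [cf kf] [cg kg]; split=> //; apply: (subclosed_compact _ (compactU kf kg)).
  exact: closed_closure.
rewrite -closureU; apply: closure_subset => x /= hx.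
have [fx|fx] := eqVneq (f x) 0; last by left.
by right; apply: contra hx => /eqP gx; apply/eqP/fgh.
Qed.

Lemma Cc_bounded f : Cc X R f -> exists2 M, 0 < M & forall x, `|f x| <= M.
Proof.
move=> [cf kf].
have : compact (f @` closure [set x | f x != 0]).
  by apply: continuous_compact => //; exact: continuous_subspaceT.
move=> /compact_bounded[M [Mr hM]]; exists (`|M| + 1); first by rewrite ltr_wpDl.
move=> x; have [->|fx] := eqVneq (f x) 0; first by rewrite normr0 addr_ge0.
apply: (hM (`|M| + 1)); first by rewrite (le_lt_trans (ler_norm _))// ltrDl.
by exists x => //; exact: subset_closure.
Qed.

Lemma bb_Cc f : Cc X R f -> bounded_borel X R f.
Proof. by move=> cf; have [M _ fM] := Cc_bounded cf; apply: bb_continuous fM; case: cf. Qed.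

Lemma Cc_comp f (phi : R -> R) : continuous phi -> phi 0 = 0 -> Cc X R f ->
  Cc X R (fun x => phi (f x)).
Proof.
move=> cphi p0 cf; apply: (Cc_sub _ _ cf); last by move=> x ->.
by apply: cont_comp => //; case: cf.
Qed.

Lemma Cc_max f g : Cc X R f -> Cc X R g -> Cc X R (fun x => Num.max (f x) (g x)).
Proof.
move=> cf cg; apply: (Cc_sub2 _ _ cf cg); last by move=> x -> ->; rewrite maxxx.
by apply: cont_max; [case: cf|case: cg].
Qed.

Lemma Cc0 : Cc X R (fun=> 0).
Proof.
split; first exact: cont_cst.
rewrite (_ : [set x | _] = set0) ?closure0; first exact: compact0.
by apply/seteqP; split=> x //=; rewrite eqxx.
Qed.

Lemma C0_dom f g : continuous g ->
  (forall e : R, 0 < e -> exists2 d : R, 0 < d & forall x, `|f x| < d -> `|g x| < e) ->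
  C0 X R f -> C0 X R g.
Proof.
move=> cg fg [cf kf]; split=> // e e0; have [d d0 h] := fg e e0.
by have [D cD hD] := kf d d0; exists D => // x /hD/h.
Qed.

Lemma Cc_C0 f : Cc X R f -> C0 X R f.
Proof.
move=> [cf kf]; split=> // e e0; exists (closure [set x | f x != 0]) => // x nx.
have [->|fx] := eqVneq (f x) 0; first by rewrite normr0.
by exfalso; apply: nx; exact: subset_closure.
Qed.

Lemma C0_comp f (phi : R -> R) : continuous phi -> phi 0 = 0 -> C0 X R f ->
  C0 X R (fun x => phi (f x)).
Proof.
move=> cphi p0 cf; apply: (C0_dom _ _ cf).
  by apply: cont_comp => //; case: cf.
move=> e e0; have /cvgrPdist_lt /(_ e e0) := cphi 0.
rewrite p0 => /nbhs_ballP[d /= d0 hd]; exists d => // x fx.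
by have := hd (f x); rewrite /= sub0r normrN; apply; rewrite /ball /= sub0r normrN.
Qed.

(** Soft thresholding: [f] minus its truncation to [[-e, e]] vanishes wherever [|f| < e], hence
    outside a compact set. *)
Lemma C0_approx f (e : R) : hausdorff_space X -> C0 X R f -> 0 < e ->
  exists2 g, Cc X R g & forall x, `|f x - g x| <= e.
Proof.
move=> hX [cf kf] e0; have [D cD hD] := kf e e0.
exists (fun x => f x - Num.max (- e) (Num.min (f x) e)); last first.
  by move=> x; rewrite opprB addrC subrK ler_norml le_max lexx /= ge_max ge_min lexx orbT andbT;
    lra.
split.
  apply: cont_sub; first exact: cf.
  apply: cont_max; first exact: cont_cst.
  by apply: cont_min; [exact: cf|exact: cont_cst].
apply: (subclosed_compact _ cD); first exact: closed_closure.
apply: closure_sub_closed; first exact: compact_closed.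
move=> x /=; apply: contraNP => /hD; rewrite ltr_norml => /andP[h1 h2].
by rewrite min_l ?(ltW h2)// max_r ?(ltW h1)// subrr.
Qed.

End continuous_functions.

(** * Complex-valued functions vanishing at infinity *)

Section complex_functions.
Context {R : realType} {X : topologicalType}.
Local Notation C0C := (C0 X R[i]).
Local Notation contC f := (continuous (f : X -> (R[i] : numFieldType))).
Implicit Types (f g : X -> R[i]) (u : X -> R).

Lemma cabsE (z : R[i]) : `|z| = ((complex.Re `|z|)%:C)%C.
Proof. by case: z. Qed.

Lemma posC_real (e : R[i]) : 0 < e -> exists2 d : R, 0 < d & e = (d%:C)%C.
Proof.
case: e => a b; rewrite ltcE /= => /andP[/eqP-> a0]; by exists a.
Qed.

Lemma cabs_lt (z : R[i]) (e : R) : (`|z| < (e%:C)%C) = (complex.Re `|z| < e).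
Proof. by rewrite cabsE ltcR. Qed.

Lemma cabs_real (a : R) : complex.Re `|(a%:C)%C : R[i]| = `|a|.
Proof. by rewrite /= expr0n /= addr0 sqrtr_sqr. Qed.

Lemma cabs_Re (z : R[i]) : `|complex.Re z| <= complex.Re `|z|.
Proof.
case: z => a b /=; rewrite -sqrtr_sqr ler_wsqrtr// lerDl; exact: sqr_ge0.
Qed.

Lemma cabs_Im (z : R[i]) : `|complex.Im z| <= complex.Re `|z|.
Proof.
case: z => a b /=; rewrite -sqrtr_sqr ler_wsqrtr// lerDr; exact: sqr_ge0.
Qed.

Lemma cabs_conj (z : R[i]) : `|Num.conj z| = `|z|.
Proof. exact: norm_conjC. Qed.

Lemma cabsM (z w : R[i]) : complex.Re `|z * w| = complex.Re `|z| * complex.Re `|w|.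
Proof. by rewrite normrM (cabsE z) (cabsE w) -rmorphM. Qed.

Lemma continuousCP f : contC f <-> forall x (e : R), 0 < e ->
  \forall y \near x, complex.Re `|f x - f y| < e.
Proof.
split=> cf x.
  move=> e e0; have ec : 0 < (e%:C)%C by rewrite ltcR.
  have /cvgrPdist_lt/(_ _ ec) := cf x.
  by apply: filterS => y; rewrite cabs_lt.
apply/cvgrPdist_lt => e /posC_real[d d0 ->]; apply: filterS (cf x d d0) => y.
by rewrite cabs_lt.
Qed.

Lemma C0CP f : C0C f <-> contC f /\ forall e : R, 0 < e ->
  exists2 D : set X, compact D & forall x, ~ D x -> complex.Re `|f x| < e.
Proof.
split=> -[cf kf]; split=> //.
  move=> e e0; have ec : 0 < (e%:C)%C by rewrite ltcR.
  by have [D cD h] := kf _ ec; exists D => // x /h; rewrite cabs_lt.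
move=> e /posC_real[d d0 ->]; have [D cD h] := kf d d0.
by exists D => // x /h; rewrite cabs_lt.
Qed.

Lemma C0_toC u : C0 X R u -> C0C (toC u).
Proof.
move=> [cu ku]; apply/C0CP; split; last first.
  by move=> e /ku[D cD h]; exists D => // x /h; rewrite /toC cabs_real.
apply/continuousCP => x e e0; have /cvgrPdist_lt/(_ _ e0) := cu x.
by apply: filterS => y; rewrite /toC -rmorphB cabs_real.
Qed.

Lemma C0_Re f : C0C f -> C0 X R (fun x => complex.Re (f x)).
Proof.
move=> /C0CP[cf kf]; split; last first.
  move=> e /kf[D cD h]; exists D => // x /h; exact: le_lt_trans (cabs_Re _).
move=> x; apply/cvgrPdist_lt => e e0; have /continuousCP/(_ x e e0) := cf.
apply: filterS => y; apply: le_lt_trans.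
have -> : complex.Re (f x) - complex.Re (f y) = complex.Re (f x - f y).
  by case: (f x) => ? ?; case: (f y).
exact: cabs_Re.
Qed.

Lemma C0C_lin (a : R[i]) f g : C0C f -> C0C g -> C0C (a *: f + g).
Proof.
move=> /C0CP[cf kf] /C0CP[cg kg]; apply/C0CP.
have n (e : R) : 0 < e -> 0 < e / 2 / (complex.Re `|a| + 1).
  by move=> e0; rewrite !divr_gt0// ltr_wpDl ?cabs_ge0.
have key (z w : R[i]) (e : R) : 0 < e -> complex.Re `|z| < e / 2 / (complex.Re `|a| + 1) ->
    complex.Re `|w| < e / 2 -> complex.Re `|a * z + w| < e.
  move=> e0; rewrite ltr_pdivlMr ?ltr_wpDl ?cabs_ge0// => hz hw.
  have := ler_normD (a * z) w; rewrite normrM (cabsE (_ + w)) (cabsE a) (cabsE z) (cabsE w).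
  rewrite -rmorphM -rmorphD lecR => h; apply: le_lt_trans h _.
  have := cabs_ge0 a; have := cabs_ge0 z; nra.
split.
  apply/continuousCP => x e e0; have e20 : 0 < e / 2 by rewrite divr_gt0.
  have /continuousCP/(_ x _ (n e e0)) hf := cf; have /continuousCP/(_ x _ e20) hg := cg.
  apply: filterS (filterI hf hg) => y [h1 h2].
  rewrite [X in `|X|](_ : _ = a * (f x - f y) + (g x - g y)); first exact: key.
  by rewrite mulrBr addrACA -opprD.
move=> e e0; have e20 : 0 < e / 2 by rewrite divr_gt0.
have [D cD hD] := kf _ (n e e0); have [E cE hE] := kg _ e20.
exists (D `|` E); first exact: compactU.
by move=> x /not_orP[/hD h1 /hE h2]; apply: key.
Qed.

Lemma C0C0 : C0C 0.
Proof.
rewrite (_ : 0 = toC (fun _ : X => 0 : R)); first by apply: C0_toC; apply: Cc_C0; exact: Cc0.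
by apply/funext.
Qed.

Lemma C0C_mul f g : C0C f -> C0C g -> C0C (f \* g).
Proof.
move=> /C0CP[cf kf] /C0CP[cg kg]; apply/C0CP; split.
  by move=> x; apply: cvgM; [exact: cf|exact: cg].
move=> e e0; have [D cD hD] := kf _ ltr01; have [E cE hE] := kg _ e0.
exists (D `|` E); first exact: compactU.
move=> x /not_orP[/hD h1 /hE h2]; rewrite -[(f \* g) x]/(f x * g x) cabsM.
by have := cabs_ge0 (f x); have := cabs_ge0 (g x); nra.
Qed.

Lemma C0C_conj f : C0C f -> C0C (fun x => Num.conj (f x)).
Proof.
move=> /C0CP[cf kf]; apply/C0CP; split; last first.
  by move=> e /kf[D cD h]; exists D => // x /h; rewrite cabs_conj.
apply/continuousCP => x e e0; have /continuousCP/(_ x e e0) := cf.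
by apply: filterS => y; rewrite -rmorphB cabs_conj.
Qed.

End complex_functions.

(** * Real functions and self-adjoint operators *)

Section representation.
Context {R : realType} {X : topologicalType} {H : completeNormedModType R[i]}.
Context (dot : {dot H for Num.conj}).
Context (dot_norm : forall x : H, dot x x = `|x| ^+ 2).
Context (pi : (X -> R[i]) -> H -> H) (pi_hom : star_homomorphism dot pi).
Local Notation C0C := (C0 X R[i]).
Local Notation C0R := (C0 X R).

Lemma pi_lin (a : R[i]) f g : C0C f -> C0C g -> pi (a *: f + g) = a *: pi f + pi g.
Proof. by case: pi_hom => _ h _ _; exact: h. Qed.

Lemma pi0 : pi 0 = 0.
Proof.
have := pi_lin (-1) C0C0 C0C0; rewrite !scaleN1r oppr0 addr0 => ->.
exact: addNr.
Qed.

Lemma pi_mul f g : C0C f -> C0C g -> pi (f \* g) = pi f \o pi g.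
Proof. by case: pi_hom => _ _ h _; exact: h. Qed.

Lemma star_alg_pi : star_alg dot (pi @` C0C).
Proof.
have [pb pl pm pa] := pi_hom; split.
- by move=> _ [f cf <-]; exact: pb.
- by exists 0; [exact: C0C0|exact: pi0].
- move=> a _ _ [f cf <-] [g cg <-]; exists (a *: f + g); [exact: C0C_lin|exact: pl].
- move=> _ _ [f cf <-] [g cg <-]; exists (f \* g); [exact: C0C_mul|exact: pm].
- move=> _ _ x [f cf <-] [g cg <-].
  have := pm f g cf cg; have := pm g f cg cf.
  have -> : g \* f = f \* g by apply/funext => y /=; rewrite mulrC.
  by move=> -> /(congr1 (fun T => T x)).
- move=> _ [f cf <-]; exists (pi (fun x => Num.conj (f x))); last exact: pa.
  by exists (fun x => Num.conj (f x)) => //; exact: C0C_conj.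
Qed.

Definition piR (f : X -> R) : H -> H := pi (toC f).

Lemma piR_add f g : C0R f -> C0R g -> piR (fun x => f x + g x) = piR f + piR g.
Proof.
move=> /C0_toC cf /C0_toC cg; rewrite -[piR f]scale1r -pi_lin//; congr pi.
by apply/funext => x; rewrite scale1r /toC rmorphD.
Qed.

Lemma piR_scale (a : R) f : C0R f -> piR (fun x => a * f x) = ((a%:C)%C : R[i]) *: piR f.
Proof.
move=> /C0_toC cf; rewrite -[RHS]addr0 -pi0 -pi_lin//; last exact: C0C0.
by congr pi; apply/funext => x; rewrite addr0 /toC rmorphM.
Qed.

Lemma piR_mul f g : C0R f -> C0R g -> piR (fun x => f x * g x) = piR f \o piR g.
Proof.
move=> /C0_toC cf /C0_toC cg; rewrite -pi_mul//; congr pi.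
by apply/funext => x; rewrite /toC rmorphM.
Qed.

Lemma piR_selfadjoint f : C0R f -> selfadjoint dot (piR f).
Proof.
move=> /C0_toC cf; have [_ _ _ pa] := pi_hom; have := pa _ cf.
have -> : (fun x => Num.conj (toC f x)) = toC f; last by [].
by apply/funext => x; rewrite /toC /Num.conj /= oppr0.
Qed.

Lemma piR_sa f : C0R f -> sa_part dot (pi @` C0C) (piR f).
Proof.
move=> cf; split; last exact: piR_selfadjoint.
by exists (toC f) => //; exact: C0_toC.
Qed.

Lemma piR_real_part f : C0C f -> exists T, [/\ (pi @` C0C) T,
  is_adjoint dot (pi f) T &
  piR (fun x => complex.Re (f x)) = ((2^-1)%:C)%C *: (pi f + T)].
Proof.
move=> cf; have [_ _ _ pa] := pi_hom; have cf' := C0C_conj cf.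
exists (pi (fun x => Num.conj (f x))); split; [by exists (fun x => Num.conj (f x))|exact: pa|].
rewrite -[pi f]scale1r -pi_lin// -[RHS]addr0 -pi0 -pi_lin//; last 2 first.
- exact: C0C_lin.
- exact: C0C0.
congr pi; apply/funext => x.
have E (z : R[i]) : ((complex.Re z)%:C)%C = ((2^-1)%:C)%C * (z + Num.conj z).
  case: z => a b; rewrite /Num.conj /=; apply/eqP; rewrite eq_complex /=.
  by apply/andP; split; apply/eqP; field.
by rewrite addr0 /toC E scale1r.
Qed.

(** The square root of [f] is again in [C_0], so the operator is the square of a self-adjoint
    one. *)
Lemma piR_ge0 f : C0R f -> (forall x, 0 <= f x) -> forall x, 0 <= qf dot (piR f) x.
Proof.
move=> cf f0 x; have ch : C0R (fun x => Num.sqrt (f x)).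
  by apply: C0_comp cf; [exact: sqrt_continuous|exact: sqrtr0].
have -> : f = fun x => Num.sqrt (f x) * Num.sqrt (f x).
  by apply/funext => y; rewrite -expr2 sqr_sqrtr.
by rewrite piR_mul// (qf_square dot_norm star_alg_pi x (piR_sa ch)) sqr_ge0.
Qed.

(* With [g = M - sqrt (M^2 - f^2)] one has [M^2 - f^2 = (M - g)^2]; subtracting
   from [M] keeps [g] inside [C_0]. *)
Lemma piR_contract f (M : R) x : C0R f -> 0 <= M -> (forall x, `|f x| <= M) ->
  nrm (piR f x) <= M * nrm x.
Proof.
move=> cf M0 fM; pose g x := M - Num.sqrt (M ^+ 2 - f x ^+ 2).
have cg : C0R g.
  pose phi (t : R) := M - Num.sqrt (M ^+ 2 - t * t).
  have cphi : continuous phi.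
    apply: cont_sub; first exact: cont_cst.
    apply: (cont_comp (phi := Num.sqrt)); first exact: sqrt_continuous.
    apply: cont_sub; first exact: cont_cst.
    by apply: cont_mul => t; exact: cvg_id.
  have := C0_comp cphi _ cf; rewrite /phi mulr0 subr0 sqrtr_sqr ger0_norm// subrr.
  by move=> /(_ erefl).
have f2 y : f y ^+ 2 <= M ^+ 2.
  by rewrite -(real_normK (num_real (f y))) ler_pXn2r ?nnegrE.
have fg y : f y * f y = 2 * M * g y + (-1) * (g y * g y).
  have : (M - g y) ^+ 2 = M ^+ 2 - f y ^+ 2.
    by rewrite /g opprB addrC subrK sqr_sqrtr// subr_ge0.
  by rewrite !expr2 => h; lra.
have cgg : C0R (fun y => g y * g y).
  apply: (C0_comp (phi := fun t => t * t)) cg; last by rewrite mulr0.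
  by apply: cont_mul => t; exact: cvg_id.
have c2 a h : C0R h -> C0R (fun y => a * h y).
  move=> ch; apply: (C0_comp (phi := fun t => a * t)) ch; last by rewrite mulr0.
  by apply: cont_mul; [exact: cont_cst|move=> t; exact: cvg_id].
(* This is [f^2 = 2 M g - g^2] under [pi]. The claim then follows from [0 <= |M x - pi g x|^2]. *)
have key : nrm (piR f x) ^+ 2 = 2 * M * qf dot (piR g) x - nrm (piR g x) ^+ 2.
  rewrite -(qf_square dot_norm star_alg_pi x (piR_sa cf)) -(piR_mul cf cf).
  rewrite -(qf_square dot_norm star_alg_pi x (piR_sa cg)) -(piR_mul cg cg).
  rewrite (_ : (fun y => f y * f y) = fun y => 2 * M * g y + (-1) * (g y * g y)); last exact/funext.
  rewrite (piR_add (c2 _ _ cg) (c2 _ _ cgg)) (piR_scale _ cg) (piR_scale _ cgg).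
  by rewrite qfD !qfZ mulN1r.
rewrite -(@ler_pXn2r _ 2) ?nnegrE ?mulr_ge0 ?nrm_ge0// key.
have := sqr_ge0 (nrm (((M%:C)%C : R[i]) *: x - piR g x)).
rewrite -(rdotxx dot_norm (_ - _)) rdotBl !rdotBr !rdotZl !rdotZr (rdotC _ x) -/(qf dot (piR g) x).
by rewrite !(rdotxx dot_norm) exprMn; lra.
Qed.

Let A := sot_closure (pi @` C0C).

(** Taking adjoints is not strongly continuous in general. Here [pi f - T] is normal, so [pi f] and
    its adjoint are equally close to a self-adjoint [T] at each vector, and their average
    [pi (Re f)] is at least as close. *)
Lemma sa_closure_piR : sa_part dot A = sot_closure (piR @` C0R).
Proof.
have As := star_alg_sot_closure dot_norm star_alg_pi.
apply/seteqP; split=> T; last first.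
  move=> /sot_closureP[bT aT].
  have AT : A T.
    apply/sot_closureP; split=> // s e e0; have [_ [f cf <-] hf] := aT s e e0.
    by exists (piR f) => //; exists (toC f) => //; exact: C0_toC.
  apply: (sa_intro As AT); apply: (sot_approx_symmetric dot_norm _ aT).
  by move=> _ [f cf <-]; apply: (sa_symmetric star_alg_pi); exact: piR_sa.
move=> sT; have [AT saT] := sT; have [bT aT] := (sot_closureP _ _).1 AT.
apply/sot_closureP; split=> // s e e0; have [_ [f cf <-] hf] := aT s e e0.
have [U' [AU' adjU hU']] := piR_real_part cf.
exists (piR (fun x => complex.Re (f x))); first by exists (fun x => complex.Re (f x)) => //;
  exact: C0_Re.
move=> x xs; rewrite hU' !opE.
have sub := sub_sot_closure star_alg_pi.
have Apf : A (pi f) by apply: sub; exists f.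
have h2 : nrm (U' x - T x) = nrm (pi f x - T x).
  have E (P Q : H -> H) : (-1 *: Q + P) x = P x - Q x by rewrite !opE scaleN1r addrC.
  rewrite -!E; apply: (star_alg_normal dot_norm x As).
  - exact: (sa_lin As).
  - by apply: (sa_lin As) => //; exact: sub.
  - move=> y z; rewrite !opE !scaleN1r linearDl linearDr linearNl linearNr /=.
    by rewrite adjU saT.
have -> : ((2^-1)%:C)%C *: (pi f x + U' x) - T x =
   ((2^-1)%:C)%C *: ((pi f x - T x) + (U' x - T x)).
  rewrite addrACA -opprD scalerBr; congr (_ - _).
  rewrite -{2 3}[T x]scale1r -scalerDl scalerA -[LHS]scale1r; congr (_ *: _).
  by apply/eqP; rewrite eq_complex /=; apply/andP; split; apply/eqP; field.
rewrite nrmZ ger0_norm ?invr_ge0//.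
have := nrmD (pi f x - T x) (U' x - T x); rewrite h2.
by have := hf x xs; lra.
Qed.

End representation.

(** * The order integral *)

Section operator_measure.
Context {R : realType} {X : topologicalType} {H : completeNormedModType R[i]}.
Context (dot : {dot H for Num.conj}).
Context (dot_norm : forall x : H, dot x x = `|x| ^+ 2).
Context (A : set (H -> H)) (As : star_alg dot A).
Context (Acl : forall T, bounded_op T -> sot_approx A T -> A T).
Local Notation sa := (sa_part dot A).
Local Notation qf := (qf dot).
Local Notation qle := (qle dot).
Local Notation le := (op_le dot).
Context (mu : set X -> option (H -> H)) (muv : is_vmeasure le sa mu).
Implicit Types (x y z : H) (S T : H -> H) (D E : set X).

(** Infinity is sent to 0, which loses nothing once [mu] is known to be finite. *)
Definition opm D : H -> H := odflt 0 (mu D).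

Local Notation ext_sup := (is_sup (ext_le le) (ext_space sa)).

Lemma sa_le_refl T : sa T -> le T T.
Proof. by move=> sT; apply/(sa_leP As sT sT). Qed.

Lemma sa_le_antisym S T : sa S -> sa T -> le S T -> le T S -> S = T.
Proof.
move=> sS sT /(sa_leP As sS sT) h1 /(sa_leP As sT sS) h2.
exact: (sa_le_anti dot_norm As).
Qed.

Lemma ext_sup_finite (B : set (option (H -> H))) a T : ext_sup B a -> sa T ->
  (forall b, B b -> ext_le le b (Some T)) -> exists2 S, sa S & a = Some S.
Proof.
move=> [Fa _ lub] sT BT; have := lub (Some T) sT BT.
by case: a Fa {lub} => [S|]// sS _; exists S.
Qed.

Lemma ext_sup_some (D : set (H -> H)) T : D `<=` sa ->
  ext_sup [set Some S | S in D] (Some T) <-> is_sup le sa D T.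
Proof.
move=> Dsa; split=> -[FT ub lub]; split=> //.
- by move=> S DS; apply: (ub (Some S)); exists S.
- by move=> S sS h; apply: (lub (Some S)) => // _ [U DU <-]; exact: h.
- by move=> _ [S DS <-]; exact: ub.
- by move=> [S|]// sS h; apply: lub => // U DU; apply: (h (Some U)); exists U.
Qed.

Lemma mu_some_sa D T : borel X D -> mu D = Some T -> sa T /\ forall x, 0 <= qf T x.
Proof.
move=> bD muD; have [h _ _] := muv; have := h D bD; rewrite muD => -[sT T0].
split=> // x; have := (sa_leP As (sa_zero As) sT).1 T0 x; by rewrite qf0.
Qed.

Lemma big_ext_add (I : Type) (s : seq I) (F : I -> option (H -> H)) (v : I -> H -> H) :
  (forall i, F i = Some (v i)) ->
  \big[@ext_add R (H -> H)/Some 0]_(i <- s) F i = Some (\sum_(i <- s) v i).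
Proof.
move=> Fv; apply: (big_rec2 (fun a b => a = Some b)) => // i b a _ ->.
by rewrite Fv.
Qed.

(** Countable additivity on the sequence [D], the rest of [E], then empty sets: the first partial
    sum is already [mu D], and it lies below the supremum [mu E]. *)
Lemma mu_sub D E T : borel X D -> borel X E -> D `<=` E -> mu E = Some T ->
  exists S, [/\ mu D = Some S, sa S & qle S T].
Proof.
move=> bD bE DE muE; have [_ mu0 sig] := muv.
have [sT _] := mu_some_sa bE muE.
pose F n := nth set0 [:: D; E `\` D] n.
have bF n : borel X (F n).
  by case: n => [|[|n]] //; [exact: borelD|rewrite /F /= nth_nil; exact: borel0].
have tF : trivIset setT F.
  apply/trivIsetP => -[|[|i]] [|[|j]] _ _ //= _; rewrite /F /= ?nth_nil ?setI0 ?set0I//.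
    by apply/seteqP; split=> // t [? []].
  by apply/seteqP; split=> // t [[]].
have UF : \bigcup_n F n = E.
  apply/seteqP; split=> t; first by move=> [[|[|n]] _]; rewrite /F /= ?nth_nil//; [exact: DE|case].
  move=> Et; have [Dt|nDt] := pselect (D t); first by exists 0%N.
  by exists 1%N.
have := sig F bF tF; rewrite UF muE => -[_ ub _].
have := ub (mu D); case muD : (mu D) => [S|] h; last first.
  exfalso; apply: h; exists 0%N => //; rewrite big_ord_recl big_ord0 /= /F /= muD//.
exists S; have [sS _] := mu_some_sa bD muD; split=> //.
apply/(sa_leP As sS sT); apply: h; exists 0%N => //.
by rewrite big_ord_recl big_ord0 /F /= muD /ext_add /= addr0.
Qed.

Lemma qf_sum (I : Type) (s : seq I) (v : I -> H -> H) x :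
  qf (\sum_(i <- s) v i) x = \sum_(i <- s) qf (v i) x.
Proof.
apply: (big_rec2 (fun a b => qf a x = b)); first by rewrite qf0.
by move=> i b a _ <-; rewrite qfD.
Qed.

Lemma sa_sum (I : Type) (s : seq I) (v : I -> H -> H) :
  (forall i, sa (v i)) -> sa (\sum_(i <- s) v i).
Proof.
move=> sv; apply: big_ind => //; first exact: sa_zero As.
by move=> S T; exact: (sa_add As).
Qed.

Lemma increasing_sup_cvg (v : nat -> H -> H) T x : (forall n, sa (v n)) ->
  (forall n m, (n <= m)%N -> qle (v n) (v m)) -> is_sup le sa (range v) T ->
  qf (v n) x @[n --> \oo] --> qf T x.
Proof.
move=> sv vm supT.
have Dsa : range v `<=` sa by move=> _ [n _ <-].
have D0 : range v !=set0 by exists (v 0%N); exists 0%N.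
have Dd : qdirected dot (range v).
  move=> _ _ [n _ <-] [m _ <-]; exists (v (maxn n m)); split; first by exists (maxn n m).
    by apply: vm; exact: leq_maxl.
  by apply: vm; exact: leq_maxr.
have [sT ub _] := (sa_supP As T Dsa).1 supT.
apply/cvgrPdist_lt => e e0.
have [_ [n _ <-] hn] := sa_sup_weak dot_norm As Acl Dsa D0 Dd supT x e0.
exists n => // m /= nm; have vT : qf (v m) x <= qf T x by apply: ub; exists m.
rewrite ger0_norm ?subr_ge0// ltrBlDr -ltrBlDl.
by apply: hn; [exists m|exact: vm].
Qed.

Lemma increasing_sup_strong (v : nat -> H -> H) T x : (forall n, sa (v n)) ->
  (forall n m, (n <= m)%N -> qle (v n) (v m)) -> is_sup le sa (range v) T ->
  forall e, 0 < e -> exists N, forall n, (N <= n)%N -> nrm (v n x - T x) < e.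
Proof.
move=> sv vm supT.
have Dsa : range v `<=` sa by move=> _ [n _ <-].
have D0 : range v !=set0 by exists (v 0%N); exists 0%N.
have Dd : qdirected dot (range v).
  move=> _ _ [n _ <-] [m _ <-]; exists (v (maxn n m)); split; first by exists (maxn n m).
    by apply: vm; exact: leq_maxl.
  by apply: vm; exact: leq_maxr.
move=> e e0; have [_ [n _ <-] hn] := sa_sup_strong dot_norm As Acl Dsa D0 Dd supT x e0.
by exists n => m nm; apply: hn; [exists m|exact: vm].
Qed.

(** Restriction to a set [E] of finite measure makes scalar measures available before [mu] is known
    to be finite: [E] is a compact set at first, the whole space later. *)
Lemma finite_measure_qf E T x : borel X E -> mu E = Some T ->
  finite_measure (fun D => qf (opm (D `&` E)) x).
Proof.
move=> bE muE; have [_ mu0 sig] := muv.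
have fin D : borel X D -> exists S, [/\ mu (D `&` E) = Some S, sa S & forall y, 0 <= qf S y].
  move=> bD; have bDE := borelI bD bE.
  have [S [muS sS _]] := mu_sub bDE bE (@subIsetr _ D E) muE.
  by exists S; have [_ p] := mu_some_sa bDE muS; split.
split.
- by rewrite set0I /opm mu0 /= qf0.
- by move=> D /fin[S [muS _ p]]; rewrite /opm muS /= p.
move=> D bD tD; have /choice[v hv] := fun n => fin (D n) (bD n).
have sv n : sa (v n) by case: (hv n).
pose w N := \sum_(n < N) v n.
have w1 N : w N.+1 = w N + v N by rewrite /w big_ord_recr.
have wm n m : (n <= m)%N -> qle (w n) (w m).
  move=> /subnK <-; elim: (m - n)%N => [|k IH y]; first by move=> y.
  rewrite addSn w1 qfD; apply: le_trans (IH y) _.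
  by rewrite lerDl; case: (hv (k + n)%N).
have sw n : sa (w n) by exact: sa_sum.
have bU : borel X (\bigcup_n D n) by exact: borel_bigcup.
have [S [muS sS _]] := fin _ bU.
have tDE : trivIset setT (fun n => D n `&` E) by exact: trivIset_setIr.
have := sig _ (fun n => borelI (bD n) bE) tDE; rewrite -setI_bigcupl muS.
have -> : (fun N => \big[@ext_add R (H -> H)/Some 0]_(n < N.+1) mu (D n `&` E)) =
    Some \o (fun N => w N.+1).
  by apply/funext => N /=; rewrite (@big_ext_add _ _ _ (fun n : 'I_N.+1 => v n))// => i;
    case: (hv i).
rewrite -image_comp => /ext_sup_some supS.
have sw1 : range (fun N => w N.+1) `<=` sa by move=> _ [n _ <-]; exact: sw.
have h : (fun N => qf (w N) x) @ \oo --> qf S x.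
  rewrite -cvg_shiftS.
  exact: (increasing_sup_cvg (x := x) (fun n => sw n.+1) (fun n m nm =>
    wm n.+1 m.+1 nm) (supS sw1)).
rewrite /opm muS /= (_ : (fun N => _) = fun N => qf (w N) x)//.
by apply/funext => N; rewrite qf_sum; apply: eq_bigr => i _; have [-> _ _] := hv i.
Qed.

Lemma qf_measure_integral E T x : borel X E -> mu E = Some T ->
  exists I, is_integral (fun D => qf (opm (D `&` E)) x) I.
Proof. by move=> bE muE; apply: intg_exists; exact: finite_measure_qf bE muE. Qed.

(** A finite sum has finite terms, so [mu] is finite wherever the coefficient is nonzero. Where it
    is 0 the product is 0 even for infinite [mu], in agreement with the default value of [opm]. *)
Lemma sf_oint_some (phi : @simple_fun R X) T x : sf_oint mu phi = Some T ->
  [/\ forall i, sf_coef (s := phi) i != 0 -> exists S, mu (sf_set (s := phi) i) = Some S,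
  sa T & qf T x = \sum_i sf_coef i * qf (opm (sf_set (s := phi) i)) x].
Proof.
rewrite /sf_oint => h.
suff key (s : seq 'I_(sf_size phi)) U :
    \big[@ext_add R (H -> H)/Some 0]_(i <- s) ext_scale (sf_coef i) (mu (sf_set i)) = Some U ->
    [/\ forall i, i \in s -> sf_coef i != 0 -> exists S, mu (sf_set i) = Some S,
      sa U & qf U x = \sum_(i <- s) sf_coef i * qf (opm (sf_set i)) x].
  have [h1 hs h2] := key _ _ h; split; [|exact: hs|exact: h2].
  by move=> i; apply: h1; rewrite mem_index_enum.
elim: s U => [|i s IH] U; first by rewrite !big_nil => -[<-]; split; rewrite ?qf0//;
  exact: sa_zero As.
rewrite !big_cons; case: (\big[_/_]_(_ <- _) _) IH => [V|] IH; last by case: (ext_scale _ _).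
rewrite /ext_add; case mi : (ext_scale _ _) => [W|]// [<-].
have [h1 sV h2] := IH V erefl.
have [c1 sW c2] : [/\ sf_coef i != 0 -> exists S, mu (sf_set i) = Some S, sa W &
    qf W x = sf_coef i * qf (opm (sf_set i)) x].
  move: mi; rewrite /opm; case mS : (mu _) => [S|] /=.
    have [sS _] := mu_some_sa (@sf_set_borel _ _ phi i) mS.
    by move=> [<-]; rewrite qfZ; split=> //; [exists S|exact: sa_scale].
  by case: eqP => // -> [<-]; rewrite mul0r qf0; split=> //; exact: sa_zero As.
split; [|exact: sa_add|by rewrite qfD c2 h2].
by move=> j; rewrite inE => /orP[/eqP->//|/h1].
Qed.

Lemma xget_some (P : set (option (H -> H))) T : xget None P = Some T -> P (Some T).
Proof. by case: xgetP => // a -> Pa aT; rewrite -aT. Qed.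

(* No finiteness of [mu] is available here: it is tested on subsets of a compact set. *)
Lemma measure_le_oint K (f : X -> R) T S x : borel X K -> mu K = Some S ->
  bounded_borel X R f -> (forall t, 0 <= f t) -> (forall t, K t -> f t = 1) ->
  is_oint_pos le sa mu (EFin \o f) (Some T) -> qf S x <= qf T x.
Proof.
move=> bK muK bf f0 f1 [phi [phi_up phi_cvg supT]].
have [I mI] := qf_measure_integral x bK muK.
have [sT ub _] := supT.
have cf t : sf_val (phi n) t @[n --> \oo] --> f t.
  by have := phi_cvg t; move/fine_cvg.
have le_f n t : sf_val (phi n) t <= f t.
  rewrite -(cvg_lim _ (cf t))//; apply: nondecreasing_cvgn_le; last exact: cvgP (cf t).
  by apply/nondecreasing_seqP => k; exact: phi_up.
have [_ [M fM]] := bf.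
have Icvg : I (sf_val (phi n)) @[n --> \oo] --> I f.
  apply: (intg_cvg mI (M := M)) => // [n|n t]; first exact: bb_sf_val.
  by rewrite ger0_norm ?sf_val_ge0//; apply: le_trans (le_f n t) (le_trans (ler_norm _) (fM t)).
(* [I] integrates over [K] only; for each set with a nonzero coefficient, its part inside [K] has
   smaller measure than the whole set. *)
have In n : I (sf_val (phi n)) <= qf T x.
  have := ub (sf_oint mu (phi n)) (ex_intro2 _ _ n Logic.I erefl).
  case os : (sf_oint mu (phi n)) => [U|]// UT.
  have [fin sU qU] := sf_oint_some x os.
  have := (sa_leP As sU sT).1 UT x; apply: le_trans; rewrite qU (intg_sf _ mI).
  apply: ler_sum => i _; have [->|ci] := eqVneq (sf_coef i) 0; first by rewrite !mul0r.
  apply: ler_wpM2l; first exact: sf_coef_ge0.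
  have [V muV] := fin i ci; have bi := @sf_set_borel _ _ (phi n) i.
  have [W [muW sW WV]] := mu_sub (borelI bi bK) bi (@subIsetl _ _ _) muV.
  by rewrite /opm muV muW /=.
have IT : I f <= qf T x.
  rewrite -(cvg_lim _ Icvg)//; apply: limr_le; first exact: cvgP Icvg.
  exact: nearW.
apply: le_trans IT; have -> : qf S x = I (\1_K).
  by rewrite (intg_indic mI)// setIid /opm muK.
apply: (intg_le mI) => //; first exact: bb_indic.
move=> t; rewrite indicE; case: (boolP (t \in K)) => [/set_mem/f1->|_] //=.
Qed.

End operator_measure.

(** * The order integral for a finite operator measure *)

Section finite_operator_measure.
Context {R : realType} {X : topologicalType} {H : completeNormedModType R[i]}.
Context (dot : {dot H for Num.conj}).
Context (dot_norm : forall x : H, dot x x = `|x| ^+ 2).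
Context (A : set (H -> H)) (As : star_alg dot A).
Context (Acl : forall T, bounded_op T -> sot_approx A T -> A T).
Local Notation sa := (sa_part dot A).
Local Notation qf := (qf dot).
Local Notation qle := (qle dot).
Local Notation le := (op_le dot).
Context (mu : set X -> option (H -> H)) (muv : is_vmeasure le sa mu).
Local Notation bb := (bounded_borel X R).
Local Notation mop := (opm mu).
Local Notation oi := (oint le sa mu).
Context (mu_fin : forall D, borel X D -> mu D = Some (mop D)).
Implicit Types (x y z : H) (S T : H -> H) (D E : set X) (f g : X -> R) (t : X).

Lemma opm_sa D : borel X D -> sa (mop D).
Proof. by move=> bD; have [] := mu_some_sa As muv bD (mu_fin bD). Qed.

Lemma opm_ge0 D x : borel X D -> 0 <= qf (mop D) x.
Proof. by move=> bD; have [_] := mu_some_sa As muv bD (mu_fin bD). Qed.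

Lemma qf_integrals_exist : exists E : H -> (X -> R) -> R,
  forall x, is_integral (fun D => qf (mop D) x) (E x).
Proof.
suff ex x : exists I, is_integral (fun D => qf (mop D) x) I.
  by have /choice[E hE] := ex; exists E.
have [I mI] := qf_measure_integral dot_norm As Acl muv x borelT (mu_fin borelT).
exists I; have -> : (fun D => qf (mop D) x) = fun D => qf (mop (D `&` setT)) x.
  by apply/funext => D; rewrite setIT.
exact: mI.
Qed.

Context (E : H -> (X -> R) -> R).
Context (mE : forall x, is_integral (fun D => qf (mop D) x) (E x)).

Definition sf_op (phi : @simple_fun R X) : H -> H :=
  \sum_i ((sf_coef (s := phi) i)%:C)%C *: mop (sf_set (s := phi) i).

Lemma sf_op_sa phi : sa (sf_op phi).
Proof.
apply: sa_sum => // i; apply: sa_scale => //; apply: opm_sa; exact: sf_set_borel.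
Qed.

Lemma sf_oint_op phi : sf_oint mu phi = Some (sf_op phi).
Proof.
apply: big_ext_add => i; rewrite mu_fin//; exact: sf_set_borel.
Qed.

Lemma qf_sf_op phi x : qf (sf_op phi) x = E x (sf_val phi).
Proof.
rewrite (intg_sf _ (mE x)) qf_sum; apply: eq_bigr => i _.
by rewrite qfZ.
Qed.

Lemma E_bound f (M : R) x : bb f -> (forall t, `|f t| <= M) ->
  `|E x f| <= M * qf (mop setT) x.
Proof.
move=> bf fM; rewrite -(intg_indic (mE x) borelT) -(intg_Z (mE x)); last exact: bb_indic borelT.
have bM : bb (fun t => M * \1_[set: X] t) by apply: bbZ; exact: bb_indic borelT.
rewrite ler_norml -[X in X <= _]mulN1r -(intg_Z (mE x))//; apply/andP; split.
  apply: (intg_le (mE x)) => //; first exact: bbZ.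
  by move=> t; rewrite indicE in_setT mulr1 mulN1r; have := fM t; rewrite ler_norml => /andP[].
apply: (intg_le (mE x)) => // t; rewrite indicE in_setT mulr1.
exact: le_trans (ler_norm _) (fM t).
Qed.

Section approximating_simple_functions.
Context (f : X -> R) (bf : bb f) (phi : nat -> @simple_fun R X).
Context (phi_up : forall n t, sf_val (phi n) t <= sf_val (phi n.+1) t).
Context (phi_cvg : forall t, sf_val (phi n) t @[n --> \oo] --> f t).

Lemma sf_le_limit n t : sf_val (phi n) t <= f t.
Proof.
rewrite -(cvg_lim _ (@phi_cvg t))//; apply: nondecreasing_cvgn_le; last exact: cvgP (@phi_cvg t).
by apply/nondecreasing_seqP => k; exact: phi_up.
Qed.

Lemma E_sf_cvg x : E x (sf_val (phi n)) @[n --> \oo] --> E x f.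
Proof.
have [_ [M fM]] := bf; apply: (intg_cvg (mE x) (M := M)) => // [n|n t]; first exact: bb_sf_val.
rewrite ger0_norm ?sf_val_ge0//; apply: le_trans (sf_le_limit n t) _.
exact: le_trans (ler_norm _) (fM t).
Qed.

Lemma sf_op_mono n m : (n <= m)%N -> qle (sf_op (phi n)) (sf_op (phi m)).
Proof.
move=> nm x; rewrite !qf_sf_op; apply: (intg_le (mE x)); try exact: bb_sf_val.
move=> t; elim: m nm => [|m IH]; first by rewrite leqn0 => /eqP->.
rewrite leq_eqVlt => /orP[/eqP->//|]; rewrite ltnS => /IH h; exact: le_trans h (phi_up m t).
Qed.

Lemma sf_op_sup : exists T, is_sup le sa (range (fun n => sf_op (phi n))) T.
Proof.
have [_ [M fM]] := bf; have [c c0 hc] := qf_bound dot_norm (sa_bounded As (proj1 (opm_sa borelT))).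
apply: (@sa_sup_exists _ _ _ dot_norm _ As Acl _ (`|M| * c)).
- by move=> _ [n _ <-]; exact: sf_op_sa.
- by exists (sf_op (phi 0%N)); exists 0%N.
- move=> _ _ [n _ <-] [m _ <-]; exists (sf_op (phi (maxn n m))).
  split; first by exists (maxn n m).
    by apply: sf_op_mono; exact: leq_maxl.
  by apply: sf_op_mono; exact: leq_maxr.
move=> _ x [n _ <-]; rewrite qf_sf_op.
apply: le_trans (ler_norm _) _; apply: le_trans (E_bound x (M := `|M|) (bb_sf_val _) _) _.
  move=> t; rewrite ger0_norm ?sf_val_ge0//; apply: le_trans (sf_le_limit n t) _.
  exact: le_trans (ler_norm _) (le_trans (fM t) (ler_norm _)).
rewrite -mulrA ler_wpM2l//; exact: le_trans (ler_norm _) (hc x).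
Qed.

Lemma sf_op_sup_qf T : is_sup le sa (range (fun n => sf_op (phi n))) T ->
  sa T /\ forall x, qf T x = E x f.
Proof.
move=> supT; have Dsa : range (fun n => sf_op (phi n)) `<=` sa by move=> _ [n _ <-];
  exact: sf_op_sa.
have [sT _ _] := (sa_supP As T Dsa).1 supT; split=> // x.
have := increasing_sup_cvg dot_norm As Acl (x := x) (fun n => sf_op_sa (phi n)) sf_op_mono supT.
have -> : (fun n => qf (sf_op (phi n)) x) = (fun n => E x (sf_val (phi n))).
  by apply/funext => n; rewrite qf_sf_op.
by move=> h; rewrite -(cvg_lim _ h)// -(cvg_lim _ (@E_sf_cvg x)).
Qed.

Lemma sf_op_sup_strong T x : is_sup le sa (range (fun n => sf_op (phi n))) T ->
  forall e, 0 < e -> exists N, forall n, (N <= n)%N -> nrm (sf_op (phi n) x - T x) < e.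
Proof.
exact: (increasing_sup_strong dot_norm As Acl x (fun n => sf_op_sa (phi n)) sf_op_mono).
Qed.

End approximating_simple_functions.

Lemma sf_oint_range (phi : nat -> @simple_fun R X) :
  range (fun n => sf_oint mu (phi n)) = [set Some S | S in range (fun n => sf_op (phi n))].
Proof.
rewrite image_comp; suff -> : (fun n => sf_oint mu (phi n)) = Some \o (fun n =>
  sf_op (phi n)) by [].
by apply/funext => n /=; rewrite sf_oint_op.
Qed.

(** Whatever the approximating sequence, the form of the resulting supremum is the Lebesgue integral
    of [f]. The choice hidden in [oint_pos] is therefore harmless. *)
Lemma is_oint_pos_qf f a : bb f -> is_oint_pos le sa mu (EFin \o f) a ->
  exists T, [/\ a = Some T, sa T & forall x, qf T x = E x f].
Proof.
move=> bf [phi [phi_up phi_cvg]]; rewrite sf_oint_range => supa.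
have cf t : sf_val (phi n) t @[n --> \oo] --> f t.
  by have := phi_cvg t; move/fine_cvg.
have [T supT] := sf_op_sup bf phi_up cf.
have Dsa : range (fun n => sf_op (phi n)) `<=` sa by move=> _ [n _ <-]; exact: sf_op_sa.
have [sT ub _] := (sa_supP As T Dsa).1 supT.
have [S sS aS] : exists2 S, sa S & a = Some S.
  apply: (ext_sup_finite supa sT) => _ [_ [n _ <-] <-] /=.
  by apply/(sa_leP As (sf_op_sa _) sT); apply: ub; exists n.
exists S; split=> //; rewrite aS in supa.
by have /(sf_op_sup_qf bf phi_up cf)[] := (ext_sup_some S Dsa).1 supa.
Qed.

Lemma oint_pos_qf f : bb f -> (forall t, 0 <= f t) ->
  exists T, [/\ oint_pos le sa mu (EFin \o f) = Some T, sa T & forall x, qf T x = E x f].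
Proof.
move=> bf f0; suff ex : exists a, is_oint_pos le sa mu (EFin \o f) a.
  have [T [h sT qT]] := is_oint_pos_qf bf (xgetPex None ex).
  by exists T; split.
have [phi [up lef cf]] := simple_approximation bf f0.
have [T supT] := sf_op_sup bf up cf.
have Dsa : range (fun n => sf_op (phi n)) `<=` sa by move=> _ [n _ <-]; exact: sf_op_sa.
exists (Some T), phi; split=> //.
  by move=> t; apply: cvg_EFin; [exact: nearW|exact: cf].
by rewrite sf_oint_range; apply/(ext_sup_some T Dsa).
Qed.

Lemma bb_pos f : bb f -> bb (f^\+).
Proof. by move=> bf; apply: bb_max => //; exact: bb_cst. Qed.

Lemma bb_neg f : bb f -> bb (f^\-).
Proof. by move=> bf; apply: bb_max; [exact: bbN|exact: bb_cst]. Qed.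

Lemma oint_qf f : bb f ->
  [/\ ointegrable le sa mu f, sa (oi f) & forall x, qf (oi f) x = E x f].
Proof.
move=> bf.
have [T [hT sT qT]] := oint_pos_qf (bb_pos bf) (fun t => funrpos_ge0 f t).
have [S [hS sS qS]] := oint_pos_qf (bb_neg bf) (fun t => funrneg_ge0 f t).
have [U [hU sU qU]] := oint_pos_qf (bb_abs bf) (fun t => normr_ge0 (f t)).
split; first by exists U.
  by rewrite /oint hT hS /=; exact: sa_sub.
move=> x; rewrite /oint hT hS /= qfB qT qS -(intg_B (mE x)); [|exact: bb_pos|exact: bb_neg].
congr (E x); apply/funext => t; rewrite /funrpos /funrneg.
have [h|h] := leP 0 (f t); first by rewrite max_r ?subr0// oppr_le0.
by rewrite max_l ?sub0r ?opprK// oppr_ge0 ltW.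
Qed.

Lemma oint_sa f : bb f -> sa (oi f).
Proof. by move=> /oint_qf[]. Qed.

Lemma qf_oint f x : bb f -> qf (oi f) x = E x f.
Proof. by move=> /oint_qf[_ _]. Qed.

(** Reduces identities between order integrals to identities between scalar integrals. *)
Lemma oint_eq f T : bb f -> sa T -> (forall x, qf T x = E x f) -> oi f = T.
Proof.
move=> bf sT qT; apply: (sa_eq dot_norm As) => //; first exact: oint_sa.
by move=> x; rewrite qf_oint.
Qed.

Lemma oint_add f g : bb f -> bb g -> oi (fun t => f t + g t) = oi f + oi g.
Proof.
move=> bf bg; apply: oint_eq; [exact: bbD|by apply: sa_add => //; exact: oint_sa|].
by move=> x; rewrite qfD !qf_oint// (intg_D (mE x)).
Qed.

Lemma oint_scale (a : R) f : bb f -> oi (fun t => a * f t) = (a%:C)%C *: oi f.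
Proof.
move=> bf; apply: oint_eq; [exact: bbZ|by apply: sa_scale => //; exact: oint_sa|].
by move=> x; rewrite qfZ !qf_oint// (intg_Z (mE x)).
Qed.

Lemma oint_sub f g : bb f -> bb g -> oi (fun t => f t - g t) = oi f - oi g.
Proof.
move=> bf bg; apply: oint_eq; [exact: bbB|by apply: sa_sub => //; exact: oint_sa|].
by move=> x; rewrite qfB !qf_oint// (intg_B (mE x)).
Qed.

Lemma oint_indic D : borel X D -> oi (\1_D) = mop D.
Proof.
move=> bD; apply: oint_eq; [exact: bb_indic|exact: opm_sa|].
by move=> x; rewrite (intg_indic (mE x)).
Qed.

Lemma oint_le f g : bb f -> bb g -> (forall t, f t <= g t) -> qle (oi f) (oi g).
Proof. by move=> bf bg fg x; rewrite !qf_oint//; exact: (intg_le (mE x)). Qed.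

Lemma mu_null_qf N : borel X N -> (mu N = Some 0 <-> forall x, qf (mop N) x = 0).
Proof.
move=> bN; split=> [h x|h]; first by rewrite /opm h /= qf0.
rewrite mu_fin//; congr Some; apply: (sa_eq dot_norm As); [exact: opm_sa|exact: sa_zero As|].
by move=> x; rewrite h qf0.
Qed.

Lemma nrm_cvg (u : nat -> H) (l : H) :
  (forall e, 0 < e -> exists N, forall n, (N <= n)%N -> nrm (u n - l) < e) ->
  nrm (u n) @[n --> \oo] --> nrm l.
Proof.
move=> h; apply/cvgrPdist_lt => e /h[N hN]; exists N => // n /= Nn.
have := hN n Nn; have := nrm_tri (u n) l 0; have := nrm_tri l (u n) 0.
rewrite !subr0 (nrmBC l) => h1 h2 h3; rewrite ltr_norml; apply/andP; split; lra.
Qed.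

Lemma qf_comp S T x : sa S -> qf (S \o T) x = rdot dot (T x) (S x).
Proof. by move=> sS; rewrite -(sa_sym As (T x) x sS). Qed.

(** * Consequences of spectrality *)

Section spectral.
Context (spec : forall D D', borel X D -> borel X D' -> mop (D `&` D') = mop D \o mop D').

Lemma rdot_suml (I : Type) (s : seq I) (v : I -> H -> H) x y :
  rdot dot ((\sum_(i <- s) v i) x) y = \sum_(i <- s) rdot dot (v i x) y.
Proof.
apply: (big_rec2 (fun (a : H -> H) b => rdot dot (a x) y = b)); first by rewrite rdot0l.
by move=> i b a _ <-; rewrite opE rdotDl.
Qed.

(** Spectrality turns the inner product of [mu(D_i) x] and [mu(D_j) x] into the measure at [x] of
    the intersection, so the expanded square matches the integral term by term. *)
Lemma sf_op_norm phi x : nrm (sf_op phi x) ^+ 2 = E x (fun t => sf_val phi t * sf_val phi t).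
Proof.
rewrite -(rdotxx dot_norm) {1}/sf_op rdot_suml.
pose c i := sf_coef (s := phi) i; pose D i := sf_set (s := phi) i.
have bD i : borel X (D i) by exact: sf_set_borel.
have bc i : bb (fun t => c i * \1_(D i) t) by apply: bbZ; exact: bb_indic.
have -> : (fun t => sf_val phi t * sf_val phi t) =
    fun t => \sum_i \sum_j (c i * c j) * \1_(D i `&` D j) t.
  apply/funext => t; rewrite /sf_val mulr_suml; apply: eq_bigr => i _.
  rewrite mulr_sumr; apply: eq_bigr => j _; rewrite mulrACA; congr (_ * _).
  by rewrite !indicE in_setI; case: (_ \in _); rewrite /= ?mul1r ?mul0r.
have bij i j : bb (fun t => (c i * c j) * \1_(D i `&` D j) t).
  by apply: bbZ; apply: bb_indic; exact: borelI.
have bi i : bb (fun t => \sum_j (c i * c j) * \1_(D i `&` D j) t).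
  elim: (index_enum _) => [|j s IH].
    by rewrite [Y in bounded_borel _ _ Y](_ : _ = cst 0); [exact: bb_cst|apply/funext => t;
      rewrite big_nil].
  rewrite [Y in bounded_borel _ _ Y](_ : _ = fun t => (c i * c j) * \1_(D i `&` D j) t +
     \sum_(j <- s) (c i * c j) * \1_(D i `&` D j) t); first exact: bbD.
  by apply/funext => t; rewrite big_cons.
rewrite (@intg_sum R X _ _ (mE x) _ (index_enum _) xpredT (fun i t =>
  \sum_j (c i * c j) * \1_(D i `&` D j) t))//.
apply: eq_bigr => i _.
rewrite (@intg_sum R X _ _ (mE x) _ (index_enum _) xpredT (fun j t =>
  (c i * c j) * \1_(D i `&` D j) t))//.
rewrite rdotC {1}/sf_op rdot_suml; apply: eq_bigr => j _.
rewrite !opE rdotZl rdotZr mulrA (mulrC (sf_coef j)); rewrite (intg_Z (mE x)); last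
  by apply: bb_indic; exact: borelI.
congr (_ * _); rewrite (intg_indic (mE x)); last exact: borelI.
by rewrite spec// qf_comp//; exact: opm_sa.
Qed.

Lemma oint_norm_ge0 f x : bb f -> (forall t, 0 <= f t) ->
  nrm (oi f x) ^+ 2 = E x (fun t => f t * f t).
Proof.
move=> bf f0; have [phi [up lef cf]] := simple_approximation bf f0.
have [T supT] := sf_op_sup bf up cf; have [sT qT] := sf_op_sup_qf bf up cf supT.
rewrite (oint_eq bf sT qT).
have h1 := nrm_cvg (sf_op_sup_strong up x supT).
have h2 : nrm (sf_op (phi n) x) ^+ 2 @[n --> \oo] --> nrm (T x) ^+ 2.
  by rewrite expr2; under eq_fun do rewrite expr2; exact: cvgM.
have [_ [M fM]] := bf.
have h3 : E x (fun t => sf_val (phi n) t * sf_val (phi n) t) @[n --> \oo] -->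
    E x (fun t => f t * f t).
  apply: (intg_cvg (mE x) (M := M * M)).
  - by move=> n; apply: bbM; exact: bb_sf_val.
  - move=> n t; rewrite normrM; have h : `|sf_val (phi n) t| <= M.
      rewrite ger0_norm ?sf_val_ge0//; apply: le_trans (lef n t) _.
      exact: le_trans (ler_norm _) (fM t).
    exact: ler_pM.
  - by move=> t; apply: cvgM; exact: cf.
have h23 : (fun n => nrm (sf_op (phi n) x) ^+ 2) =
    (fun n => E x (fun t => sf_val (phi n) t * sf_val (phi n) t)).
  by apply/funext => n; rewrite sf_op_norm.
by rewrite -(cvg_lim _ h2)// -(cvg_lim _ h3)// h23.
Qed.

(** Polarisation of the norm identity at [f], [g] and [f + g], all of which are nonnegative. *)
Lemma oint_rdot_ge0 f g x : bb f -> bb g -> (forall t, 0 <= f t) -> (forall t, 0 <= g t) ->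
  rdot dot (oi f x) (oi g x) = E x (fun t => f t * g t).
Proof.
move=> bf bg f0 g0; have h1 := oint_norm_ge0 x bf f0; have h2 := oint_norm_ge0 x bg g0.
have := oint_norm_ge0 x (bbD bf bg) (fun t => addr_ge0 (f0 t) (g0 t)).
rewrite oint_add// opE; move: h1 h2; move: (oi f x) (oi g x) => a b h1 h2.
rewrite -(rdotxx dot_norm) rdotDl !rdotDr !(rdotxx dot_norm) h1 h2 (rdotC dot b).
have -> : (fun t => (f t + g t) * (f t + g t)) =
    (fun t => (f t * f t + g t * g t) + 2 * (f t * g t)).
  by apply/funext => t; ring.
rewrite (intg_D (mE x)) ?(intg_D (mE x)) ?(intg_Z (mE x)); first by lra.
all: by repeat (first [exact: bf|exact: bg|apply: bbD|apply: bbZ|apply: bbM]).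
Qed.

Lemma oint_rdot f g x : bb f -> bb g ->
  rdot dot (oi f x) (oi g x) = E x (fun t => f t * g t).
Proof.
have dec h : bb h -> exists p n, [/\ bb p, bb n, forall t, 0 <= p t, forall t, 0 <= n t &
    h = fun t => p t - n t].
  move=> bh; exists (h^\+), (h^\-); split;
    [exact: bb_pos|exact: bb_neg|exact: funrpos_ge0|exact: funrneg_ge0|].
  apply/funext => t; rewrite /funrpos /funrneg.
  have [h0|h0] := leP 0 (h t); first by rewrite max_r ?subr0// oppr_le0.
  by rewrite max_l ?sub0r ?opprK// oppr_ge0 ltW.
move=> /dec[p [n [bp bn p0 n0 ->]]] /dec[p' [n' [bp' bn' p0' n0' ->]]].
rewrite !oint_sub// !opE.
have e1 := oint_rdot_ge0 x bp bp' p0 p0'; have e2 := oint_rdot_ge0 x bp bn' p0 n0'.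
have e3 := oint_rdot_ge0 x bn bp' n0 p0'; have e4 := oint_rdot_ge0 x bn bn' n0 n0'.
move: e1 e2 e3 e4; move: (oi p x) (oi n x) (oi p' x) (oi n' x) => a b c d e1 e2 e3 e4.
rewrite rdotBl !rdotBr e1 e2 e3 e4.
have -> : (fun t => (p t - n t) * (p' t - n' t)) =
   fun t => (p t * p' t - p t * n' t) - (n t * p' t - n t * n' t).
  by apply/funext => t; ring.
by rewrite !(intg_B (mE x))//; repeat (first [exact: bp|exact: bn|exact: bp'|exact: bn'|apply: bbB|apply: bbM]).
Qed.

(** The form of [oi f \o oi g] at [x] is [<oi g x, oi f x>], which [oint_rdot] evaluates. *)
Lemma oint_mul f g : bb f -> bb g -> oi (fun t => f t * g t) = oi f \o oi g.
Proof.
move=> bf bg; apply: oint_eq; [exact: bbM|by apply: sa_mul => //; exact: oint_sa|].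
move=> x; rewrite (qf_comp _ _ (oint_sa bf)) (oint_rdot x bg bf).
by congr (E x); apply/funext => t; rewrite mulrC.
Qed.

Lemma oint_norm f x : bb f -> nrm (oi f x) ^+ 2 = E x (fun t => f t * f t).
Proof. by move=> bf; rewrite -(rdotxx dot_norm) oint_rdot. Qed.

(** The integral of [(f - g)^2] at [x] is [|oi f x - oi g x|^2]. If it is 0 for all [x], the set
    where [f] and [g] differ is null for every scalar measure, hence for [mu]. *)
Lemma oint_ae f g : bb f -> bb g -> mu_ae mu (fun t => f t = g t) <-> oi f = oi g.
Proof.
move=> bf bg; split.
  move=> [N [bN muN fg]]; apply: oint_eq => //; first exact: oint_sa.
  move=> x; rewrite qf_oint//; have := (mu_null_qf bN).1 muN x => m0.
  by rewrite (intg_ae (mE x) bg bf bN m0)// => t /fg.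
move=> fg; have bfg := bbB bf bg; pose h t := (f t - g t) * (f t - g t).
have bh : bb h by exact: bbM.
have h0 t : 0 <= h t by rewrite /h -expr2 sqr_ge0.
have bN : borel X [set t | h t != 0] by apply: (borel_neq (g := cst 0)) => //; exact: bb_cst.
exists [set t | h t != 0]; split=> //; last first.
  move=> t /= /negP; rewrite negbK /h -expr2 sqrf_eq0 subr_eq0 => /eqP //.
apply/(mu_null_qf bN) => x; apply: (intg_eq0_ae (mE x)) => //.
by rewrite /h -oint_norm// oint_sub// fg subrr nrm0 expr0n.
Qed.

End spectral.
End finite_operator_measure.

(** * Complex-valued bounded Borel functions *)

Section complex_valued_functions.
Context {R : realType} {X : topologicalType}.
Local Notation bb := (bounded_borel X R).
Local Notation bbC := (bounded_borel X R[i]).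
Implicit Types (f g : X -> R[i]) (u v : X -> R) (t : X).

Definition Ref f : X -> R := fun t => complex.Re (f t).
Definition Imf f : X -> R := fun t => complex.Im (f t).

Lemma cball_open (V : set R) (p : R[i] -> R) : open V ->
  (forall z w : R[i], `|p z - p w| <= complex.Re `|z - w|) -> open (p @^-1` V : set (R[i] : numFieldType)).
Proof.
move=> oV hp; rewrite openE => z Vz; apply/nbhs_ballP.
have /nbhs_ballP[e e0 he] : nbhs (p z) V by exact: open_nbhs_nbhs.
exists (e%:C)%C; first by rewrite /= ltcR.
move=> w; rewrite /ball /= cabs_lt => zw; apply: he; rewrite /ball /=.
exact: le_lt_trans (hp z w) zw.
Qed.

Lemma cabs_le_ReIm (z : R[i]) : complex.Re `|z| <= `|complex.Re z| + `|complex.Im z|.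
Proof.
case: z => x y /=; rewrite -(@ler_pXn2r _ 2) ?nnegrE ?sqrtr_ge0 ?addr_ge0//.
rewrite sqr_sqrtr ?addr_ge0 ?sqr_ge0// sqrrD !real_normK ?num_real//.
by rewrite lerD2r lerDl mulrn_wge0// mulr_ge0.
Qed.

(** Real and imaginary parts are 1-Lipschitz, which gives one direction. For the other, an open set
    of complex numbers is the union of the countably many rational squares inside it, and the
    preimage of a square is an intersection of two real preimages. *)
Lemma bbC_ReIm f : bbC f <-> bb (Ref f) /\ bb (Imf f).
Proof.
split=> [[bf [M fM]]|[[br [M fM]] [bi [N fN]]]].
  have sub (p : R[i] -> R) : (forall z w : R[i], `|p z - p w| <= complex.Re `|z - w|) ->
      (forall z, `|p z| <= complex.Re `|z|) -> bb (fun t => p (f t)).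
    move=> hp pz; split; first by move=> V oV; exact: (bf _ (cball_open oV hp)).
    exists (complex.Re M) => t; apply: le_trans (pz _) _.
    by have := fM t; rewrite cabsE lecE /= => /andP[].
  split; apply: sub => [z w|z]; rewrite -?raddfB;
    [exact: cabs_Re|exact: cabs_Re|exact: cabs_Im|exact: cabs_Im].
split; last first.
  exists ((M + N)%:C)%C => t; rewrite cabsE lecR; apply: le_trans (cabs_le_ReIm _) _.
  by apply: lerD; [exact: fM|exact: fN].
move=> U oU.
pose box (a b r : R) : set R[i] := [set z | `|a - complex.Re z| < r /\ `|b - complex.Im z| < r].
pose C (c : rat * rat * nat) := box (ratr c.1.1) (ratr c.1.2) c.2.+1%:R^-1.
pose D n := if unpickle n is Some c then if `[< C c `<=` U >] then f @^-1` C c else set0 else set0.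
have bD n : borel X (D n).
  rewrite /D; case: unpickle => [c|]; last exact: borel0.
  case: asboolP => _; last exact: borel0.
  have -> : f @^-1` C c = (Ref f @^-1` ball (ratr c.1.1 : R) c.2.+1%:R^-1) `&`
     (Imf f @^-1` ball (ratr c.1.2 : R) c.2.+1%:R^-1) by [].
  by apply: borelI; [apply: br|apply: bi]; exact: ball_open.
rewrite (_ : f @^-1` U = \bigcup_n D n); first exact: borel_bigcup.
apply/seteqP; split=> t; last first.
  by move=> [n _]; rewrite /D; case: unpickle => // c; case: asboolP => // h; exact: h.
move=> /= Ut; have /nbhs_ballP[e0 /= /posC_real[e e_gt0 ->] he] : nbhs (f t : (R[i] : numFieldType)) U.
  exact: open_nbhs_nbhs.
(* With a rational centre within [r] of [f t] in each coordinate, every point of the square is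
   within [2 r < e / 2] of [f t] in each coordinate, hence in the [e]-ball. *)
have e40 : 0 < e / 4 by rewrite divr_gt0.
have [k hk] := natSinv_small e40; set r := k.+1%:R^-1 : R.
have r0 : 0 < r by rewrite invr_gt0.
have re : r < e / 4 by exact: hk.
have near (s : R) : exists a : rat, `|ratr a - s| < r.
  have [|a] := @rat_in_itvoo R (s - r) (s + r); first by lra.
  by rewrite in_itv /= => /andP[h1 h2]; exists a; rewrite ltr_norml; apply/andP; split; lra.
have [a ha] := near (complex.Re (f t)); have [b hb] := near (complex.Im (f t)).
exists (pickle (a, b, k)); first exact: Logic.I.
rewrite /D pickleK; case: asboolP => [_|[]]; first by split.
move=> z [h1 h2]; apply: he; rewrite /ball /= cabs_lt; apply: le_lt_trans (cabs_le_ReIm _) _.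
rewrite !raddfB /=; move: ha hb h1 h2; rewrite -/r !ltr_norml =>
  /andP[? ?] /andP[? ?] /andP[? ?] /andP[? ?].
have : `|complex.Re (f t) - complex.Re z| < 2 * r by rewrite ltr_norml; apply/andP; split; lra.
have : `|complex.Im (f t) - complex.Im z| < 2 * r by rewrite ltr_norml; apply/andP; split; lra.
lra.
Qed.

Lemma Ref_lin (p q : R) f g :
  Ref ((p +i* q)%C *: f + g) = fun t => (p * Ref f t - q * Imf f t) + Ref g t.
Proof.
apply/funext => t; rewrite /Ref /Imf -[(_ + _) t]/((p +i* q)%C * f t + g t).
by case: (f t); case: (g t).
Qed.

Lemma Imf_lin (p q : R) f g :
  Imf ((p +i* q)%C *: f + g) = fun t => (p * Imf f t + q * Ref f t) + Imf g t.
Proof.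
apply/funext => t; rewrite /Ref /Imf -[(_ + _) t]/((p +i* q)%C * f t + g t).
by case: (f t); case: (g t).
Qed.

Lemma Ref_mul f g : Ref (f \* g) = fun t => Ref f t * Ref g t - Imf f t * Imf g t.
Proof. by apply/funext => t; rewrite /Ref /Imf /=; case: (f t); case: (g t). Qed.

Lemma Imf_mul f g : Imf (f \* g) = fun t => Ref f t * Imf g t + Imf f t * Ref g t.
Proof. by apply/funext => t; rewrite /Ref /Imf /=; case: (f t); case: (g t). Qed.

Lemma Ref_conj f : Ref (fun t => Num.conj (f t)) = Ref f.
Proof. by apply/funext => t; rewrite /Ref; case: (f t). Qed.

Lemma Imf_conj f : Imf (fun t => Num.conj (f t)) = fun t => - Imf f t.
Proof. by apply/funext => t; rewrite /Imf; case: (f t). Qed.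

Lemma bbC_lin (a : R[i]) f g : bbC f -> bbC g -> bbC (a *: f + g).
Proof.
move=> /bbC_ReIm[rf jf] /bbC_ReIm[rg jg]; apply/bbC_ReIm; case: a => p q.
rewrite Ref_lin Imf_lin; split; apply: bbD => //; first by apply: bbB; exact: bbZ.
by apply: bbD; exact: bbZ.
Qed.

Lemma bbC_mul f g : bbC f -> bbC g -> bbC (f \* g).
Proof.
move=> /bbC_ReIm[rf jf] /bbC_ReIm[rg jg]; apply/bbC_ReIm; rewrite Ref_mul Imf_mul.
by split; [apply: bbB|apply: bbD]; exact: bbM.
Qed.

Lemma bbC_conj f : bbC f -> bbC (fun t => Num.conj (f t)).
Proof.
move=> /bbC_ReIm[rf jf]; apply/bbC_ReIm; rewrite Ref_conj Imf_conj.
by split=> //; exact: bbN.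
Qed.

End complex_valued_functions.

Lemma increasing_limit (R : realType) (X : Type) (u : nat -> X -> R) (a b : R) :
  (forall n t, u n t <= u n.+1 t) -> (forall n t, a <= u n t <= b) ->
  exists f, [/\ forall t, u n t @[n --> \oo] --> f t, forall n t, u n t <= f t
    & forall t, a <= f t <= b].
Proof.
move=> up ab; exists (fun t => lim (u n t @[n --> \oo])).
have c t : cvg (u n t @[n --> \oo]).
  apply: nondecreasing_is_cvgn; first by apply/nondecreasing_seqP => n; exact: up.
  by exists b => _ [n _ <-]; have /andP[] := ab n t.
have le n t : u n t <= lim (u n t @[n --> \oo]).
  by apply: nondecreasing_cvgn_le => //; apply/nondecreasing_seqP => k; exact: up.
split=> // t; apply/andP; split.
  by apply: le_trans (le 0%N t); have /andP[] := ab 0%N t.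
by apply: limr_le => //; apply: nearW => n; have /andP[] := ab n t.
Qed.

Lemma decreasing_limit (R : realType) (X : Type) (u : nat -> X -> R) (a b : R) :
  (forall n t, u n.+1 t <= u n t) -> (forall n t, a <= u n t <= b) ->
  exists f, [/\ forall t, u n t @[n --> \oo] --> f t, forall n t, f t <= u n t
    & forall t, a <= f t <= b].
Proof.
move=> down ab; have [||f [c le fab]] := @increasing_limit R X (fun n t => - u n t) (- b) (- a).
- by move=> n t; rewrite lerN2.
- by move=> n t; rewrite !lerN2 andbC.
exists (fun t => - f t); split=> [t|n t|t]; last by rewrite lerNl lerNr andbC.
  by under eq_fun do rewrite -[u _ t]opprK; apply: cvgN; exact: c.
by rewrite lerNl.
Qed.

Lemma C0_sub (R : realType) (X : topologicalType) (f g : X -> R) : C0 X R f -> C0 X R g ->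
  C0 X R (fun t => f t - g t).
Proof.
move=> /C0_toC cf /C0_toC cg; have := C0_Re (C0C_lin (-1) cg cf); congr (C0 X R _).
by apply/funext => t; rewrite scaleN1r addrC.
Qed.

Lemma piR_sub (R : realType) (X : topologicalType) (H : completeNormedModType R[i])
    (dot : {dot H for Num.conj}) (pi : (X -> R[i]) -> H -> H) (f g : X -> R) :
  star_homomorphism dot pi -> C0 X R f -> C0 X R g ->
  piR pi (fun t => f t - g t) = piR pi f - piR pi g.
Proof.
move=> pi_hom /C0_toC cf /C0_toC cg; rewrite /piR addrC -scaleN1r -(pi_lin pi_hom)//; congr pi.
by apply/funext => t; rewrite scaleN1r addrC /toC rmorphB.
Qed.

(** * Running maxima *)

Section running_maximum.
Context {R : realType} {X : Type}.
Implicit Types (f : nat -> X -> R).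

Fixpoint run_max f (n k : nat) : X -> R :=
  if k is k'.+1 then fun t => Num.max (run_max f n k' t) (f (n + k)%N t) else f n.

Lemma run_max_ge f n k t : f (n + k)%N t <= run_max f n k t.
Proof. by case: k => [|k] /=; rewrite ?addn0// le_max lexx orbT. Qed.

Lemma run_max_ind (P : (X -> R) -> Prop) f n k : (forall m, P (f m)) ->
  (forall g h, P g -> P h -> P (fun t => Num.max (g t) (h t))) -> P (run_max f n k).
Proof. by move=> Pf Pm; elim: k => [|k IH] //=; apply: Pm. Qed.

(** The maximum on the left omits [f n]. In the limit [k --> oo] this makes the suprema of the tails
    decrease with [n]. *)
Lemma run_max_shift f n k t : run_max f n.+1 k t <= run_max f n k.+1 t.
Proof.
elim: k => [|k IH] /=; first by rewrite addn1 le_max lexx orbT.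
rewrite ge_max [X in X && _](le_trans IH) /=; last by rewrite /= le_max lexx.
by rewrite addSnnS le_max lexx orbT.
Qed.

End running_maximum.

Lemma norm_clamped (R : realDomainType) (a b r : R) : a <= 0 <= b -> a <= r <= b ->
  `|r| <= b - a.
Proof.
by move=> /andP[a0 b0] /andP[h1 h2]; rewrite ler_norml; apply/andP; split; lra.
Qed.

Lemma complex_scale (R : realType) (V : lmodType R[i]) (p q : R) (u v : V) :
  (p +i* q)%C *: (u + (0 +i* 1)%C *: v) =
  ((p%:C)%C *: u - (q%:C)%C *: v) + (0 +i* 1)%C *: ((p%:C)%C *: v + (q%:C)%C *: u).
Proof.
rewrite !scalerDr !scalerA.
have -> : (p +i* q)%C = (p%:C)%C + (0 +i* 1)%C * (q%:C)%C :> R[i].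
  by apply/eqP; rewrite eq_complex /=; apply/andP; split; apply/eqP; ring.
rewrite mulrDl scalerDl scalerDl.
have -> : (0 +i* 1)%C * (q%:C)%C * (0 +i* 1)%C = - (q%:C)%C :> R[i].
  by apply/eqP; rewrite eq_complex /=; apply/andP; split; apply/eqP; ring.
rewrite scaleNr [X in _ + X]addrC addrACA; congr (_ + _).
by rewrite addrC mulrC.
Qed.

(** * Real and imaginary parts of operators *)

Section cartesian_decomposition.
Context {R : realType} {H : completeNormedModType R[i]}.
Context (dot : {dot H for Num.conj}).
Context (dot_norm : forall x : H, dot x x = `|x| ^+ 2).
Context (A : set (H -> H)) (As : star_alg dot A).
Local Notation sa := (sa_part dot A).
Local Notation ic := ((0 +i* 1)%C : R[i]).
Implicit Types (x y : H) (S T U V : H -> H).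

Lemma rdot_i x y : rdot dot (ic *: x) y = - rdot dot x (ic *: y).
Proof.
rewrite /rdot linearZl_LR (linearZr_LR dot) /= /Num.conj /=; case: (dot x y) => a b /=.
by rewrite !mul0r !sub0r mulN1r opprK mul1r.
Qed.

(** The form of [U] is real as [U] is self-adjoint, and imaginary as [U] is [i] times a self-adjoint
    operator. *)
Lemma sa_imaginary_eq0 U V : sa U -> sa V -> (forall x, U x = ic *: V x) -> U = 0.
Proof.
move=> sU sV UV; apply: (sa_eq dot_norm As sU (sa_zero As)) => x.
suff h : rdot dot (U x) x = - rdot dot (U x) x by rewrite qf0 /qf; lra.
by rewrite {1}UV rdot_i (sa_sym As _ _ sV) (linZ _ _ (sa_linear As sV)) -UV rdotC.
Qed.

Lemma cartesian_unique U V U' V' : sa U -> sa V -> sa U' -> sa V' ->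
  U + ic *: V = U' + ic *: V' -> U = U' /\ V = V'.
Proof.
move=> sU sV sU' sV' e.
have UU' : U - U' = 0.
  apply: (sa_imaginary_eq0 (sa_sub As sU sU') (sa_sub As sV' sV)) => x.
  have := congr1 (@^~ x) e; rewrite !opE scalerBr => h.
  by apply/eqP; rewrite subr_eq addrAC eq_sym subr_eq h addrC.
have {}UU' : U = U' by apply/eqP; rewrite -subr_eq0 UU'.
split=> //; move: e; rewrite UU' => /addrI e; apply/funext => x.
have := congr1 (fun S => - ic *: S x) e; rewrite !opE !scalerA.
by rewrite (_ : - ic * ic = 1) ?scale1r//; apply/eqP; rewrite eq_complex /=; apply/andP; split;
  apply/eqP; ring.
Qed.

Lemma cartesian T : A T -> exists U V, [/\ sa U, sa V & T = U + ic *: V].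
Proof.
move=> AT; have [S AS TS] := sa_adj As AT.
have [lT _] := sa_bounded As AT; have [lS _] := sa_bounded As AS.
have hTS := (is_adjointP dot T lS).1 TS.
have hST x y : rdot dot (S x) y = rdot dot x (T y) by rewrite rdotC -hTS rdotC.
pose h := ((2^-1)%:C)%C : R[i].
exists (h *: (T + S)), (h *: (- ic *: (T - S))); split.
- apply: (sa_intro As).
    by apply: (alg_scale As); exact: (alg_add As).
  by move=> x y; rewrite !opE rdotZl rdotZr rdotDl rdotDr hTS hST addrC.
- apply: (sa_intro As).
    apply: (alg_scale As); apply: (alg_scale As); apply: (alg_add As) => //.
    by rewrite -scaleN1r; exact: (alg_scale As).
  move=> x y; rewrite !opE rdotZl rdotZr; congr (_ * _).
  rewrite !scaleNr rdotNl rdot_i opprK rdotBl hTS hST -rdotBr (linZ _ _ lS) (linZ _ _ lT) -scalerBr.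
  by rewrite -scalerN opprB.
apply/funext => x; rewrite !opE scalerDr !scalerA.
rewrite (_ : ic * h * - ic = h); last first.
  by apply/eqP; rewrite eq_complex /=; apply/andP; split; apply/eqP; ring.
rewrite scalerBr addrACA subrr addr0 -scalerDl (_ : h + h = 1) ?scale1r//.
by apply/eqP; rewrite eq_complex /=; apply/andP; split; apply/eqP; field.
Qed.

End cartesian_decomposition.

(** * The representing measure *)

Section representing_measure.
Context {R : realType} {X : topologicalType} {H : completeNormedModType R[i]}.
Context (hX : hausdorff_space X) (lX : locally_compact [set: X]).
Context (dot : {dot H for Num.conj}).
Context (dot_norm : forall x : H, dot x x = `|x| ^+ 2).
Context (pi : (X -> R[i]) -> H -> H) (pi_hom : star_homomorphism dot pi).
Local Notation A := (sot_closure (pi @` C0 X R[i])).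
Local Notation sa := (sa_part dot A).
Local Notation qf := (qf dot).
Local Notation qle := (qle dot).
Local Notation le := (op_le dot).
Context (mu : set X -> option (H -> H)).
Context (rep : represents dot sa mu pi).
Local Notation bb := (bounded_borel X R).
Local Notation mop := (opm mu).
Local Notation oi := (oint le sa mu).
Local Notation pR := (piR pi).
Implicit Types (x y z : H) (S T : H -> H) (D E : set X) (f g : X -> R) (t : X).

Lemma closure_alg : star_alg dot A.
Proof. exact: (star_alg_sot_closure dot_norm (star_alg_pi pi_hom)). Qed.

Lemma closure_closed T : bounded_op T -> sot_approx A T -> A T.
Proof. exact: sot_closure_idem. Qed.

Let As := closure_alg.
Let Acl := closure_closed.

Lemma rep_vmeasure : is_vmeasure le sa mu.
Proof. by case: rep => [[]]. Qed.

Let muv := rep_vmeasure.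

Lemma piR_sa_closure f : C0 X R f -> sa (pR f).
Proof.
move=> cf; have [Af sf] := piR_sa pi_hom cf; split=> //.
exact: (sub_sot_closure (star_alg_pi pi_hom)).
Qed.

(** Needed while [mu] may still be infinite, to evaluate the negative part of a nonnegative
    function. A simple function equal to 0 has coefficient 0 on each of its nonempty sets, and 0
    times infinity is 0. *)
Lemma is_oint_pos0 a : is_oint_pos le sa mu (fun _ : X => 0%E) a -> a = Some 0.
Proof.
move=> [phi [phi_up phi_cvg supa]].
have v0 n t : sf_val (phi n) t = 0.
  have c : sf_val (phi n) t @[n --> \oo] --> 0 by have := phi_cvg t; move/fine_cvg.
  apply/le_anti; rewrite sf_val_ge0 andbT -(cvg_lim _ c)//.
  apply: nondecreasing_cvgn_le; last exact: cvgP c.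
  by apply/nondecreasing_seqP => k; exact: phi_up.
have o0 n : sf_oint mu (phi n) = Some 0.
  have -> : (Some 0 : option (H -> H)) = Some (\sum_(i < sf_size (phi n)) 0) by rewrite big1.
  apply: big_ext_add => i; have [_ mu0 _] := muv.
  have [->|/eqP/set0P[t Dt]] := pselect (sf_set (s := phi n) i = set0).
    by rewrite mu0 /= scaler0.
  suff -> : sf_coef (s := phi n) i = 0 by case: (mu _) => [S|] /=; rewrite ?scale0r ?eqxx.
  apply/le_anti; rewrite sf_coef_ge0 andbT -(v0 n t) /sf_val (bigD1 i)//= indicE mem_set// mulr1.
  rewrite lerDl; apply: sumr_ge0 => j _; rewrite mulr_ge0 ?sf_coef_ge0// indicE//.
have [Fa ub lub] := supa.
have h1 := lub (Some 0) (sa_zero As); have h2 := ub (Some 0) (ex_intro2 _ _ 0%N Logic.I (o0 0%N)).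
case: a Fa {supa ub lub} h1 h2 => [S|] /= Fa h1 h2; last first.
  by exfalso; apply: h1 => _ [n _ <-]; rewrite o0; exact: (sa_le_refl As (sa_zero As)).
congr Some; apply: (sa_le_antisym dot_norm As) => //; first exact: sa_zero As.
by apply: h1 => _ [n _ <-]; rewrite o0; exact: (sa_le_refl As (sa_zero As)).
Qed.

Lemma is_oint_pos0_ex : is_oint_pos le sa mu (fun _ : X => 0%E) (Some 0).
Proof.
have b0 : forall i : 'I_0, 0 <= (fun=> 0 : R) i by [].
have b1 : forall i : 'I_0, borel X ((fun=> set0) i) by move=> i; exact: borel0.
have b2 : trivIset [set: 'I_0] (fun=> set0 : set X) by move=> [].
exists (fun=> SimpleFun b0 b1 b2); split=> //.
  by move=> t; rewrite /sf_val big_ord0; exact: cvg_cst.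
split; first exact: sa_zero As.
  by move=> _ [n _ <-]; rewrite /sf_oint big_ord0; exact: (sa_le_refl As (sa_zero As)).
by move=> b _ h; apply: h; exists 0%N => //; rewrite /sf_oint big_ord0.
Qed.

Lemma oint_pos0 : oint_pos le sa mu (fun _ : X => 0%E) = Some 0.
Proof. by apply: is_oint_pos0; apply: xgetPex; exists (Some 0); exact: is_oint_pos0_ex. Qed.

Lemma funrneg_eq0 f : (forall t, 0 <= f t) -> EFin \o f^\- = fun=> 0%E.
Proof.
move=> f0; apply/funext => t /=; rewrite /funrneg; congr EFin; apply/max_idPr.
by rewrite oppr_le0.
Qed.

Lemma funrpos_id f : (forall t, 0 <= f t) -> f^\+ = f.
Proof. by move=> f0; apply/funext => t; rewrite /funrpos; apply/max_idPl. Qed.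

Lemma mu_compact K : compact K -> exists S, [/\ mu K = Some S, sa S &
  forall x, qf S x <= nrm x ^+ 2].
Proof.
move=> cK; have [[_ fK _ _] repC] := rep; have [S sS muK] := fK K cK.
exists S; split=> // x.
have [f [cf f01 f1 _]] := @urysohn_Cc R X K setT hX lX cK openT (fun _ _ => Logic.I).
have f0 t : 0 <= f t by have /andP[] := f01 t.
have [[T sT oT] pif] := repC f cf.
(* Integrability speaks of [|f|], which is [f] here. As the negative part integrates to 0, the
   finite value [T] of the integral is [pR f]. *)
have absf : (fun t => `|f t|%:E) = EFin \o f.
  by apply/funext => t /=; rewrite ger0_norm.
have PT : is_oint_pos le sa mu (EFin \o f) (Some T).
  by apply: xget_some; rewrite -absf.
have eT : pR f = T.
  rewrite /piR pif /oint funrpos_id// funrneg_eq0// oint_pos0 -absf oT /=.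
  by rewrite subr0.
have bK : borel X K by apply: borel_closed; exact: compact_closed.
apply: le_trans (measure_le_oint dot_norm As Acl muv x bK muK (bb_Cc cf) f0 f1 PT) _.
rewrite -eT; apply: le_trans (ler_norm _) _.
apply: le_trans (cauchy_schwarz dot_norm _ _) _; rewrite expr2.
apply: ler_wpM2r; first exact: nrm_ge0.
rewrite -[nrm x]mul1r; apply: (piR_contract dot_norm pi_hom) => //; first exact: Cc_C0.
by move=> t; rewrite ger0_norm//; have /andP[] := f01 t.
Qed.

Let Dop (V : set X) := [set mop K | K in [set K | compact K /\ K `<=` V]].

Lemma compact_ops V : [/\ Dop V `<=` sa, Dop V !=set0, qdirected dot (Dop V) &
  forall S x, Dop V S -> qf S x <= 1 * nrm x ^+ 2].
Proof.
have muK K : compact K -> mu K = Some (mop K).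
  by move=> cK; have [S [h _ _]] := mu_compact cK; rewrite /opm h.
split.
- by move=> _ [K [cK _] <-]; have [S [h sS _]] := mu_compact cK; rewrite /opm h.
- by exists (mop set0); exists set0 => //; split; [exact: compact0|exact: sub0set].
- move=> _ _ [K [cK KV] <-] [L [cL LV] <-].
  have cKL := compactU cK cL; exists (mop (K `|` L)).
  have bor M : compact M -> borel X M by move=> cM; apply: borel_closed; exact: compact_closed.
  have sub M : compact M -> M `<=` K `|` L -> qle (mop M) (mop (K `|` L)).
    move=> cM ML; have [S [h _ hS]] := mu_sub As muv (bor _ cM) (bor _ cKL) ML (muK _ cKL).
    by rewrite [mop M]/opm h.
  split; [by exists (K `|` L) => //; split=> // t [/KV|/LV]|exact: sub|exact: sub].
- by move=> _ x [K [cK _] <-]; have [S [h _ hS]] := mu_compact cK; rewrite /opm h mul1r.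
Qed.

Lemma ext_sup_compact V : open V ->
  is_sup (ext_le le) (ext_space sa) [set Some S | S in Dop V] (mu V).
Proof.
move=> oV; have [[_ _ reg _] _] := rep; have := reg V oV.
congr is_sup; rewrite /Dop image_comp; apply/seteqP; split=> o [K [cK KV] <-].
  by have [S [h _ _]] := mu_compact cK; exists K; rewrite //= /opm h.
by have [S [h _ _]] := mu_compact cK; exists K; rewrite //= /opm h.
Qed.

(** Regularity gives [mu V] as a supremum in the extended space. The measures of compact subsets are
    directed and bounded by the identity, so they have a supremum inside [sa] as well; this finite
    upper bound forces [mu V] to be finite. *)
Lemma mu_open V : open V -> [/\ mu V = Some (mop V), sa (mop V),
  (forall x, 0 <= qf (mop V) x <= nrm x ^+ 2) & is_sup le sa (Dop V) (mop V)].
Proof.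
move=> oV; have sup := ext_sup_compact oV.
have [Dsa D0 Dd D1] := compact_ops V.
have [T supT] := sa_sup_exists dot_norm As Acl Dsa D0 Dd D1.
have [sT ub lub] := (sa_supP As T Dsa).1 supT.
have [S sS muV] : exists2 S, sa S & mu V = Some S.
  apply: (ext_sup_finite sup sT) => _ [S DS <-] /=.
  by apply/(sa_leP As (Dsa _ DS) sT); exact: ub.
have e : mop V = S by rewrite /opm muV.
have supS : is_sup le sa (Dop V) S by apply/(ext_sup_some S Dsa); rewrite -muV.
rewrite e; split=> // x; have ST := sa_sup_unique dot_norm As Dsa supS supT.
have [_ p] := mu_some_sa As muv (borel_open oV) muV; rewrite p /=.
apply/ler_addgt0Pl => d d0.
have [U DU hU] := sa_sup_weak dot_norm As Acl Dsa D0 Dd supS x d0.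
by have := hU U DU (fun _ => lexx _); have := D1 U x DU; rewrite mul1r; lra.
Qed.

Lemma mu_finite D : borel X D -> mu D = Some (mop D).
Proof.
move=> bD; have [muT _ _ _] := mu_open openT.
have [S [h _ _]] := mu_sub As muv bD borelT (fun _ _ => Logic.I) muT.
by rewrite /opm h.
Qed.

Lemma opm_le_id D x : borel X D -> qf (mop D) x <= nrm x ^+ 2.
Proof.
move=> bD; have [muT _ b _] := mu_open openT.
have [S [h _ hS]] := mu_sub As muv bD borelT (fun _ _ => Logic.I) muT.
have /andP[_ h2] := b x; apply: le_trans h2; rewrite {1}/opm h; exact: hS.
Qed.

Lemma piR_oint f : Cc X R f -> pR f = oi f.
Proof. by move=> cf; have [_ repC] := rep; have [_ h] := repC f cf. Qed.

Context (E : H -> (X -> R) -> R).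
Context (mE : forall x, is_integral (fun D => qf (mop D) x) (E x)).

Let osa f := @oint_sa _ _ _ _ dot_norm _ As Acl _ muv mu_finite _ mE f.
Let oqf f x := @qf_oint _ _ _ _ dot_norm _ As Acl _ muv mu_finite _ mE f x.
Let osub f g := @oint_sub _ _ _ _ dot_norm _ As Acl _ muv mu_finite _ mE f g.
Let oscale a f := @oint_scale _ _ _ _ dot_norm _ As Acl _ muv mu_finite _ mE a f.
Let oindic D := @oint_indic _ _ _ _ dot_norm _ As Acl _ muv mu_finite _ mE D.

Lemma qf_piR f x : Cc X R f -> qf (pR f) x = E x f.
Proof.
move=> cf; rewrite piR_oint//.
exact: (oqf x (bb_Cc cf)).
Qed.

(** A Urysohn function for a compact subset of [V] that nearly exhausts the measure of [V] at
    [x]. *)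
Lemma open_approx V x (e : R) : open V -> 0 < e ->
  exists f, [/\ Cc X R f, forall t, 0 <= f t <= 1, forall t, f t <= \1_V t
    & qf (mop V) x - e < E x f].
Proof.
move=> oV e0; have [muV sV _ supV] := mu_open oV.
have [Dsa D0 Dd D1] := compact_ops V.
have [_ [K [cK KV] <-] hK] := sa_sup_weak dot_norm As Acl Dsa D0 Dd supV x e0.
have [f [cf f01 f1 f0]] := @urysohn_Cc R X K V hX lX cK oV KV.
have bK : borel X K by apply: borel_closed; exact: (compact_closed hX cK).
exists f; split=> //.
  move=> t; rewrite indicE; case: (boolP (t \in V)) => [_|/negP tV] /=.
    by have /andP[] := f01 t.
  by rewrite f0// => /mem_set.
have hK' := hK (mop K) (ex_intro2 _ _ K (conj cK KV) erefl) (fun _ => lexx _).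
apply: (lt_le_trans hK').
rewrite -(intg_indic (mE x) bK); apply: (intg_le (mE x)); [exact: bb_indic|exact: bb_Cc|].
move=> t; rewrite indicE; case: (boolP (t \in K)) => [/set_mem/f1->//|_] /=.
by have /andP[] := f01 t.
Qed.

Lemma oint_contract f x : bb f -> (forall t, 0 <= f t <= 1) -> nrm (oi f x) <= nrm x.
Proof.
move=> bf f01; have [_ sf qof] := oint_qf dot_norm As Acl muv mu_finite mE bf.
have b y : 0 <= qf (oi f) y <= 1 * nrm y ^+ 2.
  rewrite qof mul1r (intg_ge0 (mE y)) ?bf//=; last by move=> t; have /andP[] := f01 t.
  apply: le_trans (opm_le_id y borelT); rewrite -(intg_indic (mE y) borelT).
  apply: (intg_le (mE y)) => //; first exact: bb_indic borelT.
  by move=> t; rewrite indicE in_setT; have /andP[] := f01 t.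
rewrite -(@ler_pXn2r _ 2) ?nnegrE ?nrm_ge0//.
have /andP[_ h] := b x; rewrite mul1r in h; apply: le_trans h; rewrite -[qf _ x]mul1r.
apply: (positive_op_norm dot_norm) => //; [exact: (sa_linear As)|exact: (sa_symmetric As)].
Qed.

(** [S^2 <= S] for [S = oi g] between 0 and 1. This is used while multiplicativity of the integral
    is still to be shown. *)
Lemma oint_norm_le g x : bb g -> (forall t, 0 <= g t <= 1) -> nrm (oi g x) ^+ 2 <= E x g.
Proof.
move=> bg g01; have [_ sg qg] := oint_qf dot_norm As Acl muv mu_finite mE bg.
rewrite -qg -[qf _ x]mul1r; apply: (positive_op_norm dot_norm) => //;
  [exact: (sa_linear As)|exact: (sa_symmetric As)|].
move=> y; rewrite -[rdot _ _ _]/(qf _ y) qg mul1r (intg_ge0 (mE y)) //=; last by move=> t;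
  have /andP[] := g01 t.
apply: le_trans (opm_le_id y borelT); rewrite -(intg_indic (mE y) borelT).
apply: (intg_le (mE y)) => //; first exact: bb_indic borelT.
by move=> t; have /andP[_ h] := g01 t; apply: (le_trans h); rewrite indicE in_setT.
Qed.

(** For [f], [g] in [C_c] close to the two indicators, multiplicativity of [pi] gives
    [<pi g x, pi f x> = E x (f g)]. Each side is then compared with its limit. *)
Lemma spectral_open V W : open V -> open W -> mop (V `&` W) = mop V \o mop W.
Proof.
move=> oV oW; have bV := borel_open oV; have bW := borel_open oW.
have sV := opm_sa As muv mu_finite bV; have sW := opm_sa As muv mu_finite bW.
have bVW := borelI bV bW.
apply: (sa_eq dot_norm As); [exact: (opm_sa As muv mu_finite bVW)|exact: sa_mul|].
move=> x; rewrite (qf_comp As _ _ sV); apply/eqP; rewrite -subr_eq0; apply/eqP.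
(* The inner products cost [2 d |x|] and the measures [2 d^2]; with [d <= e] and [d <= 1] the sum is
   at most [e (2 + 2 |x|)]. *)
apply: (small_eq0 (c := 2 + 2 * nrm x)) => e e0.
pose d := Num.min e 1; have d0 : 0 < d by rewrite lt_min e0 ltr01.
have [de d1] : d <= e /\ d <= 1 by split; rewrite ge_min lexx ?orbT.
have d20 : 0 < d ^+ 2 by rewrite exprn_gt0.
have key U : open U -> exists f, [/\ Cc X R f, forall t, 0 <= f t <= 1, forall t, f t <= \1_U t,
    nrm (mop U x - pR f x) <= d & E x (fun t => \1_U t - f t) <= d ^+ 2].
  move=> oU; have [f [cf f01 fU hf]] := open_approx x oU d20.
  have bU := borel_open oU; have bf := bb_Cc cf; have bi := bb_indic (R := R) bU.
  have hE : E x (fun t => \1_U t - f t) <= d ^+ 2.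
    by rewrite (intg_B (mE x))// (intg_indic (mE x))//; lra.
  exists f; split=> //.
  rewrite piR_oint// -(oindic bU).
  have -> : oi \1_U x - oi f x = oi (fun t => \1_U t - f t) x.
    by rewrite osub.
  have bif := bbB bi bf.
  have g01 t : 0 <= \1_U t - f t <= 1.
    have := fU t; have /andP[] := f01 t; have : \1_U t <= 1 :> R by rewrite indicE lern1;
      case: (_ \in _).
    by move=> *; apply/andP; split; lra.
  rewrite -(@ler_pXn2r _ 2) ?nnegrE ?nrm_ge0 ?(ltW d0)//; apply: le_trans hE.
  exact: oint_norm_le.
have [f [cf f01 fV hf1 hf2]] := key V oV; have [g [cg g01 gW hg1 hg2]] := key W oW.
have bf := bb_Cc cf; have bg := bb_Cc cg.
have cfg : Cc X R (fun t => f t * g t).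
  apply: (Cc_sub _ _ cf); last by move=> t ->; rewrite mul0r.
  by apply: cont_mul; [case: cf|case: cg].
have Efg : rdot dot (pR g x) (pR f x) = E x (fun t => f t * g t).
  rewrite -qf_piR// (piR_mul pi_hom (Cc_C0 cf) (Cc_C0 cg)) (qf_comp As)//.
  exact: (piR_sa_closure (Cc_C0 cf)).
have n1 : nrm (mop V x) <= nrm x.
  rewrite -(oindic bV); apply: oint_contract; first exact: bb_indic.
  by move=> t; rewrite indicE ler0n lern1; case: (_ \in _).
have n2 : nrm (pR g x) <= nrm x by rewrite piR_oint//; apply: oint_contract.
have a1 : `|rdot dot (mop W x) (mop V x) - rdot dot (pR g x) (pR f x)| <= 2 * d * nrm x.
  have -> : rdot dot (mop W x) (mop V x) - rdot dot (pR g x) (pR f x) =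
      rdot dot (mop W x - pR g x) (mop V x) + rdot dot (pR g x) (mop V x - pR f x).
    by rewrite rdotBl rdotBr; ring.
  apply: le_trans (ler_normD _ _) _.
  have := cauchy_schwarz dot_norm (mop W x - pR g x) (mop V x).
  have := cauchy_schwarz dot_norm (pR g x) (mop V x - pR f x).
  have := ler_pM (nrm_ge0 _) (nrm_ge0 _) hg1 n1.
  have := ler_pM (nrm_ge0 _) (nrm_ge0 _) n2 hf1.
  lra.
have a2 : `|qf (mop (V `&` W)) x - E x (fun t => f t * g t)| <= 2 * d ^+ 2.
  rewrite -(intg_indic (mE x) bVW) -(intg_B (mE x)); [|exact: bb_indic|exact: bb_Cc].
  have bi := bb_indic (R := R) bVW; have bfg := bb_Cc cfg.
  have bVf := bbB (bb_indic (R := R) bV) bf; have bWg := bbB (bb_indic (R := R) bW) bg.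
  have pt t : 0 <= \1_(V `&` W) t - f t * g t <= (\1_V t - f t) + (\1_W t - g t).
    have := fV t; have := gW t; have /andP[] := f01 t; have /andP[] := g01 t.
    rewrite !indicE in_setI; case: (t \in V); case: (t \in W) => /= *; apply/andP; split; nra.
  rewrite ger0_norm; last first.
    by apply: (intg_ge0 (mE x)); [exact: bbB|move=> t; have /andP[] := pt t].
  apply: le_trans (_ : E x (fun t => (\1_V t - f t) + (\1_W t - g t)) <= _).
    by apply: (intg_le (mE x)); [exact: bbB|exact: bbD|move=> t; have /andP[] := pt t].
  by rewrite (intg_D (mE x))//; lra.
rewrite Efg in a1.
have := ler_distD (E x (fun t => f t * g t)) (qf (mop (V `&` W)) x) (rdot dot (mop W x) (mop V x)).
rewrite (distrC (E x _)); have := nrm_ge0 x.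
nra.
Qed.

Lemma dynkin_borel (P : set (set X)) : (forall V, open V -> P V) ->
  (forall D, borel X D -> P D -> P (~` D)) ->
  (forall D : nat -> set X, (forall n, borel X (D n)) -> trivIset setT D ->
     (forall n, P (D n)) -> P (\bigcup_n D n)) ->
  forall D, borel X D -> P D.
Proof.
move=> Po PC PU D bD; suff [] : [set D | borel X D /\ P D] D by [].
move: D bD; apply: lambda_system_subset.
- by move=> U V oU oV; exact: openI.
- apply/dynkin_lambda_system; split.
  + by split; [exact: borelT|exact: Po openT].
  + by move=> B [bB PB]; split; [exact: borelC|exact: PC].
  + move=> F tF hF; split; first by apply: borel_bigcup => n; case: (hF n).
    by apply: PU => // n; case: (hF n).
- by move=> U oU; split; [exact: borel_open|exact: Po].
- by [].
Qed.

Lemma opm_disjointU B D : borel X B -> borel X D -> B `&` D = set0 ->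
  mop (B `|` D) = mop B + mop D.
Proof.
move=> bB bD BD0; have sB := opm_sa As muv mu_finite bB; have sD := opm_sa As muv mu_finite bD.
apply: (sa_eq dot_norm As); [exact: (opm_sa As muv mu_finite (borelU bB bD))|exact: sa_add|].
move=> x; rewrite qfD -(intg_indic (mE x) bB) -(intg_indic (mE x) bD).
rewrite -(intg_indic (mE x) (borelU bB bD)) -(intg_D (mE x)); [|exact: bb_indic..].
congr (E x); apply/funext => t; rewrite !indicE in_setU.
have : (t \in B) && (t \in D) = false by rewrite -in_setI BD0 in_set0.
by case: (t \in B); case: (t \in D) => //= _; rewrite ?addr0 ?add0r.
Qed.

Lemma opm_bigcup_cvg (F : nat -> set X) D x (e : R) : (forall n, borel X (F n)) -> borel X D ->
  (forall n, F n `<=` D) -> (forall t, D t -> exists N, forall n, (N <= n)%N -> F n t) -> 0 < e ->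
  exists N, forall n, (N <= n)%N -> nrm (mop (F n) x - mop D x) < e.
Proof.
move=> bF bD FD DF e0; have bi := bb_indic (R := R) bD.
have bFi n := bb_indic (R := R) (bF n).
have c : E x (fun t => \1_D t - \1_(F n) t) @[n --> \oo] --> E x (fun=> 0).
  apply: (intg_cvg (mE x) (M := 1)) => [n|n t|t]; first exact: bbB.
    have := @FD n t; rewrite !indicE; case: (boolP (t \in D)) => tD;
      case: (boolP (t \in F n)) => tF;
      rewrite /= ?subrr ?subr0 ?normr0 ?normr1// => h.
    by case/negP: tD; apply/mem_set; apply: h; exact: set_mem.
  apply: cvg_near_cst; have [Dt|nDt] := pselect (D t).
    have [N hN] := DF t Dt; exists N => // n /= Nn.
    by rewrite !indicE !mem_set ?subrr//; exact: hN.
  apply: nearW => n; rewrite !indicE !memNset ?subrr//.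
  by move=> /FD.
have /cvgrPdist_lt/(_ (e ^+ 2)) := c; rewrite exprn_gt0// => /(_ isT)[N _ hN].
exists N => n Nn; have := hN n Nn.
rewrite (_ : E x (fun=> 0) = 0) ?sub0r ?normrN; last exact: (intg_0 (mE x)).
rewrite -(oindic bD) -(oindic (bF n)).
rewrite nrmBC.
have -> : oi \1_D x - oi \1_(F n) x = oi (fun t => \1_D t - \1_(F n) t) x.
  by rewrite osub.
move=> h; rewrite -(@ltr_pXn2r _ 2) ?nnegrE ?nrm_ge0 ?(ltW e0)//.
apply: le_lt_trans (oint_norm_le x _ _) _; first exact: bbB.
  move=> t; have := @FD n t; rewrite !indicE; case: (boolP (t \in D)) => tD;
    case: (boolP (t \in F n)) => tF;
      rewrite /= ?subrr ?subr0 ?lexx ?ler01// => k.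
  by case/negP: tD; apply/mem_set; apply: k; exact: set_mem.
exact: le_lt_trans (ler_norm _) h.
Qed.

Lemma spectral_extend W : borel X W ->
  (forall V, open V -> mop (V `&` W) = mop V \o mop W) ->
  forall D, borel X D -> mop (D `&` W) = mop D \o mop W.
Proof.
move=> bW oV; apply: dynkin_borel => //.
(* Complements are subtracted from [mu W = mu(X) mu(W)], the hypothesis for the open set [X], since
   [mu X] may differ from the identity. *)
- move=> D bD e; have bC := borelC bD.
  have : mop (D `|` ~` D) = mop D + mop (~` D) by apply: opm_disjointU => //; rewrite setICr.
  have : mop ((D `&` W) `|` (~` D `&` W)) = mop (D `&` W) + mop (~` D `&` W).
    by apply: opm_disjointU; [exact: borelI|exact: borelI|rewrite setIACA setICr set0I].
  rewrite -setIUl setUCr setTI e => h1 h2; apply/funext => x /=.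
  have hx : mop W x = mop D (mop W x) + mop (~` D `&` W) x := congr1 (@^~ x) h1.
  have hT : mop W x = mop D (mop W x) + mop (~` D) (mop W x).
    by have /(congr1 (@^~ x)) := oV _ openT; rewrite setTI h2.
  by apply: (addrI (mop D (mop W x))); rewrite -hx -hT.
- move=> D bD tD e; pose F N := \big[setU/set0]_(i < N) D i.
  have bF N : borel X (F N).
    by rewrite /F; elim: N => [|N IH]; rewrite ?big_ord0 ?big_ord_recr;
      [exact: borel0|exact: borelU].
  have FS N : F N.+1 = F N `|` D N by rewrite /F big_ord_recr.
  have dF N : F N `&` D N = set0.
    rewrite /F -bigcup_mkord setIC setI_bigcupr bigcup0// => i /= iN.
    apply/eqP; apply: contraT => /set0P/(tD _ _ Logic.I Logic.I) Ni.
    by move: iN; rewrite Ni ltnn.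
  have PF N : mop (F N `&` W) = mop (F N) \o mop W.
    elim: N => [|N IH].
      have -> : F 0%N = set0 by rewrite /F big_ord0.
      by exact: oV open0.
    rewrite FS setIUl !opm_disjointU// ?IH ?e//; try exact: borelI.
    by rewrite setIACA dF set0I.
  have bD' := borel_bigcup bD.
  have sub n : F n `<=` \bigcup_n D n by move=> t; rewrite /F -bigcup_mkord => -[k _ Dk]; exists k.
  have cov t : (\bigcup_n D n) t -> exists N, forall n, (N <= n)%N -> F n t.
    by move=> [k _ Dk]; exists k.+1 => n kn; rewrite /F -bigcup_mkord; exists k.
  apply/funext => x; apply/eqP; rewrite -subr_eq0; apply/eqP; apply: nrm_lt_eq0 => d d0.
  have d20 : 0 < d / 2 by rewrite divr_gt0.
  (* Continuity is needed at two vectors: at [mop W x] for the unions, at [x] for their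
     intersections with [W]. *)
  have [N1 h1] := opm_bigcup_cvg (mop W x) bF bD' sub cov d20.
  have [||N2 h2] := @opm_bigcup_cvg (fun n => F n `&` W) (\bigcup_n D n `&` W) x _
    (fun n => borelI (bF n) bW) (borelI bD' bW) _ _ d20.
  + by move=> n; apply: setSI.
  + by move=> t [/cov[N hN] Wt]; exists N => n Nn; split=> //; exact: hN.
  have := h1 _ (leq_maxl N1 N2); have := h2 _ (leq_maxr N1 N2).
  rewrite PF /= (nrmBC _ (mop _ x)) => k1 k2.
  by have := nrm_tri (mop (\bigcup_n D n `&` W) x)
    (mop (F (maxn N1 N2)) (mop W x)) (mop (\bigcup_n D n) (mop W x)); lra.
Qed.

(** The extension is made in one argument at a time: against an open set first, then, after
    exchanging the factors by commutativity, against an arbitrary Borel set. *)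
Lemma spectral D W : borel X D -> borel X W -> mop (D `&` W) = mop D \o mop W.
Proof.
move=> bD bW; apply: spectral_extend => // V oV; have bV := borel_open oV.
have [AV _] := opm_sa As muv mu_finite bV; have [AW _] := opm_sa As muv mu_finite bW.
rewrite setIC spectral_extend//; last by move=> U oU; exact: spectral_open.
by apply/funext => x /=; exact: (sa_comm As x AW AV).
Qed.

Let onorm f x := @oint_norm _ _ _ _ dot_norm _ As Acl _ muv mu_finite _ mE spectral f x.
Let omul f g := @oint_mul _ _ _ _ dot_norm _ As Acl _ muv mu_finite _ mE spectral f g.

Lemma nrm_oint_sub f g x : bb f -> bb g ->
  nrm (oi f x - oi g x) ^+ 2 = E x (fun t => (f t - g t) * (f t - g t)).
Proof.
move=> bf bg; rewrite -(onorm x (bbB bf bg)); congr (_ ^+ 2).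
by rewrite (osub bf bg).
Qed.

(** [g] and [|g|] have the same square, so their integrals have the same norm at [x]. Strong
    closeness at [x] thus becomes closeness in [L^1] of the scalar measure at [x]. *)
Lemma intg_abs_le g x : bb g -> E x (fun t => `|g t|) <= nrm (oi g x) * nrm x.
Proof.
move=> bg; have bg' := bb_abs bg.
have <- : nrm (oi (fun t => `|g t|) x) = nrm (oi g x).
  apply/eqP; rewrite -(@eqrXn2 _ 2) ?nrm_ge0// (onorm x bg) (onorm x bg'); apply/eqP.
  by congr (E x); apply/funext => t; rewrite -normrM ger0_norm// -expr2 sqr_ge0.
rewrite -(oqf x bg'); apply: le_trans (ler_norm _) _; exact: cauchy_schwarz.
Qed.

Lemma oint_cvg (u : nat -> X -> R) f (M : R) x : (forall n, bb (u n)) ->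
  (forall n t, `|u n t| <= M) -> (forall t, u n t @[n --> \oo] --> f t) ->
  nrm (oi (u n) x - oi f x) ^+ 2 @[n --> \oo] --> 0.
Proof.
move=> bu uM cf; have bf := bb_lim bu uM cf.
have fM t : `|f t| <= M.
  have h : `|u n t| @[n --> \oo] --> `|f t| by apply: cvg_norm; exact: cf.
  rewrite -(cvg_lim _ h)//; apply: limr_le; first exact: cvgP h.
  by apply: nearW => n; exact: uM.
rewrite (_ : (fun n => _) = fun n => E x (fun t => (u n t - f t) * (u n t - f t))); last first.
  by apply/funext => n; rewrite nrm_oint_sub.
rewrite -(intg_0 (mE x)); apply: (intg_cvg (mE x) (M := (M + M) * (M + M))).
- by move=> n; apply: bbM; exact: bbB.
- move=> n t; rewrite normrM; have h : `|u n t - f t| <= M + M.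
    by apply: le_trans (ler_normB _ _) _; exact: lerD.
  exact: ler_pM.
- move=> t; rewrite -[0 in X in _ --> X](mulr0 0).
  by apply: cvgM; rewrite -(subrr (f t)); apply: cvgB;
    [exact: cf|exact: cvg_cst|exact: cf|exact: cvg_cst].
Qed.

(* [p = h ^+ 2] and [h * c = r * h], so the claim is that [s * (r - T) >= 0] at [oi h x]. *)
Lemma clamp_half (s r : R) p c T x : sa T -> Cc X R p -> bb c -> (forall t, 0 <= p t) ->
  (forall t, p t != 0 -> c t = r) -> (forall y, 0 <= s * (r * nrm y ^+ 2 - qf T y)) ->
  0 <= s * rdot dot (oi p x) (oi c x - T x).
Proof.
move=> sT cp bc p0 pr hT; pose h t := Num.sqrt (p t).
have bh : bb h by apply: bb_Cc; apply: Cc_comp cp; [exact: sqrt_continuous|exact: sqrtr0].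
have ph : p = fun t => h t * h t by apply/funext => t; rewrite -expr2 sqr_sqrtr.
have hc : (fun t => h t * c t) = fun t => r * h t.
  apply/funext => t; have [e|n] := eqVneq (p t) 0.
    by rewrite /h e sqrtr0 mul0r mulr0.
  by rewrite (pr t n) mulrC.
have e1 : oi h (oi c x) = (r%:C)%C *: oi h x.
  by have := omul bh bc; rewrite hc oscale// => /(congr1 (@^~ x)).
have e2 : oi p x = oi h (oi h x) by rewrite {1}ph omul.
have sh := osa bh; have [Ah _] := sh; have [AT _] := sT.
rewrite e2 (sa_sym As _ _ sh) (linB _ _ (sa_linear As sh)) e1 (sa_comm As x Ah AT).
have := hT (oi h x); move: (oi h x) => y; rewrite -[qf T y]/(rdot dot (T y) y).
by rewrite rdotBr rdotZr (rdotxx dot_norm) (rdotC dot y (T y)).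
Qed.

(** [f = c - (n - p)], with [c] the truncation, [p] the excess above [b] and [n] the deficit below
    [a]. By [clamp_half], [oi p x] has a nonnegative and [oi n x] a nonpositive inner product with
    [oi c x - T x], so expanding [|oi f x - T x|^2] only adds to [|oi c x - T x|^2]. The condition
    [a <= 0 <= b] keeps the support compact. *)
Lemma clamp_closer (a b : R) f T : a <= 0 <= b -> sa T ->
  (forall y, a * nrm y ^+ 2 <= qf T y <= b * nrm y ^+ 2) -> Cc X R f ->
  exists g, [/\ Cc X R g, forall t, a <= g t <= b & forall x, nrm (oi g x - T x) <= nrm (oi f x - T x)].
Proof.
move=> /andP[a0 b0] sT hT cf; have ab := le_trans a0 b0.
pose c t := Num.max a (Num.min b (f t)).
pose p t := Num.max 0 (f t - b); pose n t := Num.max 0 (a - f t).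
have [kf _] := cf.
have cc : Cc X R c.
  apply: (Cc_sub _ _ cf); last by move=> t ft; rewrite /c ft (min_idPr b0) (max_idPr a0).
  by apply: cont_max; [exact: cont_cst|apply: cont_min => //; exact: cont_cst].
have cp : Cc X R p.
  apply: (Cc_sub _ _ cf); last by move=> t ft; apply/max_idPl; rewrite ft sub0r oppr_le0.
  by apply: cont_max; [exact: cont_cst|apply: cont_sub => //; exact: cont_cst].
have cn : Cc X R n.
  apply: (Cc_sub _ _ cf); last by move=> t ft; apply/max_idPl; rewrite ft subr0.
  by apply: cont_max; [exact: cont_cst|apply: cont_sub => //; exact: cont_cst].
exists c; split=> //.
  by move=> t; rewrite /c le_max lexx ge_max ab ge_min lexx.
move=> x.
have bc := bb_Cc cc; have bp := bb_Cc cp; have bn := bb_Cc cn; have bf := bb_Cc cf.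
have fE : f = fun t => c t - (n t - p t).
  apply/funext => t; rewrite /c /n /p.
  by case: (leP b (f t)) => h1; case: (leP a _) => h2; case: (leP 0 (a - _)) => h3;
    case: (leP 0 (_ - b)) => h4; lra.
have h1 := @clamp_half 1 b p c T x sT cp bc.
have h2 := @clamp_half (-1) a n c T x sT cn bc.
have {}h1 : 0 <= rdot dot (oi p x) (oi c x - T x).
  rewrite -[X in 0 <= X]mul1r; apply: h1.
  - by move=> t; rewrite le_max lexx.
  - move=> t; rewrite /p /c; case: (leP 0 (f t - b)) => h; last by rewrite eqxx.
    by rewrite subr_ge0 in h; rewrite (min_idPl h) (max_idPr ab).
  - by move=> y; have /andP[] := hT y; lra.
have {}h2 : 0 <= -1 * rdot dot (oi n x) (oi c x - T x).
  apply: h2.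
  - by move=> t; rewrite le_max lexx.
  - move=> t; rewrite /n /c; case: (leP 0 (a - f t)) => h; last by rewrite eqxx.
    rewrite subr_ge0 in h; rewrite (min_idPr (le_trans h ab)) => _; exact/max_idPl.
  - by move=> y; have /andP[] := hT y; lra.
have -> : oi f x = oi c x - (oi n x - oi p x).
  by rewrite {1}fE (osub bc (bbB bn bp)) (osub bn bp).
move: (oi c x) (oi n x) (oi p x) h1 h2 => u v w h1 h2.
rewrite -(@ler_pXn2r _ 2) ?nnegrE ?nrm_ge0// -!(rdotxx dot_norm).
have -> : u - (v - w) - T x = (u - T x) - (v - w) by rewrite addrAC.
move: (u - T x) h1 h2 => d h1 h2.
have := sqr_ge0 (nrm (v - w)); rewrite -(rdotxx dot_norm).
rewrite -[v - w in X in _ -> X]opprK; move: h1 h2.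
have -> : rdot dot w d = rdot dot v d - rdot dot (v - w) d by rewrite rdotBl; ring.
move: (v - w) => q h1 h2 h3.
rewrite opprK rdotBl !rdotBr (rdotC dot d q); lra.
Qed.

Lemma sa_approx_Cc (a b : R) T (s : seq H) (e : R) : a <= 0 <= b -> sa T ->
  (forall y, a * nrm y ^+ 2 <= qf T y <= b * nrm y ^+ 2) -> 0 < e ->
  exists g, [/\ Cc X R g, forall t, a <= g t <= b & forall x, x \in s -> nrm (oi g x - T x) < e].
Proof.
move=> ab sT hT e0; have e20 : 0 < e / 2 by rewrite divr_gt0.
have [_ aT] : bounded_op T /\ sot_approx (pR @` C0 X R) T.
  by apply/sot_closureP; rewrite -(sa_closure_piR dot_norm pi_hom).
have [_ [f cf <-] hf] := aT s _ e20.
(* [m] dominates the norms of all vectors in [s], so replacing the function in [C_0] by one in [C_c]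
   with uniform error [e / 2 / m] costs at most [e / 2] at each of them. *)
pose m := \sum_(x <- s) nrm x + 1.
have s0 : 0 <= \sum_(x <- s) nrm x by apply: sumr_ge0 => x _; exact: nrm_ge0.
have m0 : 0 < m by rewrite ltr_wpDl.
have sm x : x \in s -> nrm x <= m.
  move=> xs; rewrite /m (big_rem x)//= -addrA lerDl addr_ge0 ?ler01//.
  by apply: sumr_ge0 => y _; exact: nrm_ge0.
have d0 : 0 < e / 2 / m by rewrite divr_gt0.
have [g cg fg] := C0_approx hX cf d0.
have [c [cc cab hc]] := clamp_closer ab sT hT cg.
exists c; split=> // x xs; apply: le_lt_trans (hc x) _.
have cfg := C0_sub cf (Cc_C0 cg).
have h1 : nrm (pR (fun t => f t - g t) x) <= e / 2 / m * nrm x.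
  by apply: (piR_contract dot_norm pi_hom) => //; exact: ltW.
have h2 : pR (fun t => f t - g t) x = pR f x - oi g x.
  by rewrite -(piR_oint cg) (piR_sub pi_hom cf (Cc_C0 cg)).
have h3 : e / 2 / m * nrm x <= e / 2.
  by rewrite -mulrA ger_pMr// mulrC ler_pdivrMr// mul1r sm.
rewrite h2 in h1.
have := nrm_tri (oi g x) (pR f x) (T x); rewrite (nrmBC (oi g x) (pR f x)).
have := hf x xs; lra.
Qed.

Let q (n : nat) : R := 2^-1 ^+ n.

Let q_gt0 n : 0 < q n.
Proof. by rewrite exprn_gt0. Qed.

Let qS n : q n.+1 = q n / 2.
Proof. by rewrite /q exprS mulrC. Qed.

Let q_cvg (M : R) : M * q n @[n --> \oo] --> 0.
Proof.
rewrite -[0](mulr0 M); apply: cvgM; first exact: cvg_cst.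
by apply: cvg_expr; rewrite ger0_norm//; lra.
Qed.

(** [F] is the upper limit of the [f n]. As [f n] is controlled at [xi j] only for [n >= j], the
    estimates at [xi j] start at index [j]. The common bounds serve dominated convergence and the
    passage from [L^1] back to strong convergence. *)
Lemma clamped_limsup (a b : R) T (xi : nat -> H) : separating A xi -> a <= 0 <= b -> sa T ->
  (forall y, a * nrm y ^+ 2 <= qf T y <= b * nrm y ^+ 2) ->
  exists (g : nat -> nat -> X -> R) (G : nat -> X -> R) (F : X -> R),
  [/\ forall n k, Cc X R (g n k),
    (forall n k t, a <= g n k t <= b) /\ (forall n t, a <= G n t <= b),
    (forall n k t, g n k t <= g n k.+1 t) /\ (forall n t, g n k t @[k --> \oo] --> G n t),
    (forall n t, G n.+1 t <= G n t) /\ (forall t, G n t @[n --> \oo] --> F t)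
    & oi F = T].
Proof.
move=> sep ab sT hT.
have /choice[f hf] : forall n, exists f, [/\ Cc X R f, forall t, a <= f t <= b &
    forall x, x \in [seq xi j | j <- iota 0 n.+1] -> nrm (oi f x - T x) < q n].
  by move=> n; apply: sa_approx_Cc.
have cf n : Cc X R (f n) by case: (hf n).
have fab n t : a <= f n t <= b by case: (hf n).
have fT n j : (j <= n)%N -> nrm (oi (f n) (xi j) - T (xi j)) < q n.
  move=> jn; have [_ _] := hf n; apply; apply: map_f; by rewrite mem_iota.
have cg n k : Cc X R (run_max f n k) by apply: run_max_ind => //; exact: Cc_max.
have gab n k t : a <= run_max f n k t <= b.
  apply: (run_max_ind (P := fun h => a <= h t <= b)) => // g h ga ha.
  by case: (leP (g t) (h t)).
have gup n k t : run_max f n k t <= run_max f n k.+1 t by rewrite /= le_max lexx.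
have /choice[G hG] : forall n, exists G, [/\ forall t, run_max f n k t @[k --> \oo] --> G t,
    forall k t, run_max f n k t <= G t & forall t, a <= G t <= b].
  by move=> n; exact: increasing_limit.
have Gdown n t : G n.+1 t <= G n t.
  have [c _ _] := hG n.+1; have [_ u _] := hG n.
  rewrite -(cvg_lim _ (@c t))//; apply: limr_le; first exact: cvgP (@c t).
  by apply: nearW => k; apply: le_trans (run_max_shift f n k t) (u _ _).
have Gab n t : a <= G n t <= b by case: (hG n).
have [F [cF _ Fab]] := decreasing_limit Gdown Gab.
exists (run_max f), G, F; split=> //.
  by split=> // n; case: (hG n).
have bdd (h : X -> R) t := norm_clamped (r := h t) ab.
have bG n : bb (G n).
  have [c _ _] := hG n; apply: (@bb_lim _ _ (run_max f n) _ (b - a)) => //.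
    by move=> k; exact: bb_Cc.
  by move=> k t; exact: bdd.
have GM n t : `|G n t| <= b - a by exact: bdd.
have bF : bb F by apply: (bb_lim bG GM cF).
have sF := osa bF; have [AF _] := sa_sub As sF sT.
suff FT j : oi F (xi j) = T (xi j).
  apply/funext => x; apply/eqP; rewrite -subr_eq0; apply/eqP.
  by apply: (sep _ AF) => j; rewrite opE FT subrr.
set x := xi j.
(* The distances of [f m] and [f m.+1] to [T] at [x] are below [q m] and [q m.+1], together at most
   [2 q m]. *)
have step m : (j <= m)%N -> E x (fun t => `|f m.+1 t - f m t|) <= 2 * q m * nrm x.
  move=> jm; apply: le_trans (intg_abs_le x (bbB (bb_Cc (cf _)) (bb_Cc (cf _)))) _.
  rewrite ler_wpM2r ?nrm_ge0// (osub (bb_Cc (cf _)) (bb_Cc (cf _))) opE.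
  have h1 := fT _ _ jm; have h2 := fT _ _ (leqW jm); rewrite qS in h2.
  have := nrm_tri (oi (f m.+1) x) (T x) (oi (f m) x); rewrite (nrmBC (T x)).
  have := q_gt0 m; rewrite /x; lra.
have bg n k := bb_Cc (cg n k); have bf n := bb_Cc (cf n).
(* Including one more function raises the maximum by at most the last increment, since the maximum
   already dominates the preceding function. The bound telescopes, as [2 q m = 4 q m - 4 q m.+1]. *)
have tail n k : (j <= n)%N -> E x (fun t =>
  run_max f n k t - f n t) <= (4 * q n - 4 * q (n + k)%N) * nrm x.
  move=> jn; elim: k => [|k IH].
    rewrite addn0 subrr mul0r (_ : (fun t => _) = fun=> 0) ?(intg_0 (mE x))//.
    by apply/funext => t /=; rewrite subrr.
  have bs := bb_abs (bbB (bf (n + k).+1) (bf (n + k)%N)).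
  apply: le_trans (_ : E x (fun t => (run_max f n k t - f n t) + `|f (n + k).+1 t - f (n + k)%N t|) <= _).
    apply: (intg_le (mE x)); [exact: bbB|by apply: bbD => //; exact: bbB|move=> t].
    rewrite /= addnS addrAC lerD2r ge_max; apply/andP; split; first by rewrite lerDl.
    have := run_max_ge f n k t; have := ler_norm (f (n + k).+1 t - f (n + k)%N t); lra.
  rewrite (intg_D (mE x)) => //; last exact: bbB.
  have := step _ (leq_trans jn (leq_addr k n)); rewrite addnS qS; lra.
have tailG n : (j <= n)%N -> E x (fun t => G n t - f n t) <= 4 * q n * nrm x.
  move=> jn; have [c _ _] := hG n.
  have cE : E x (fun t => run_max f n k t - f n t) @[k --> \oo] --> E x (fun t => G n t - f n t).
    apply: (intg_cvg (mE x) (M := (b - a) + (b - a))).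
    - by move=> k; exact: bbB.
    - by move=> k t; apply: le_trans (ler_normB _ _) _; apply: lerD; exact: bdd.
    - by move=> t; apply: cvgB; [exact: c|exact: cvg_cst].
  rewrite -(cvg_lim _ cE)//; apply: limr_le; first exact: cvgP cE.
  apply: nearW => k; apply: le_trans (tail n k jn) _; rewrite ler_wpM2r ?nrm_ge0//.
  by have := q_gt0 (n + k)%N; lra.
(* [0 <= G n - f n <= b - a] bounds the square of the difference by [b - a] times the difference. *)
have Gf n : (j <= n)%N -> nrm (oi (G n) x - oi (f n) x) ^+ 2 <= (b - a) * (4 * q n * nrm x).
  move=> jn; rewrite (nrm_oint_sub)//.
  have [_ le _] := hG n; have ba : 0 <= b - a by case/andP: ab; lra.
  apply: le_trans (_ : E x (fun t => (b - a) * (G n t - f n t)) <= _).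
    apply: (intg_le (mE x)) => [||t]; [by apply: bbM; exact: bbB|by apply: bbZ; exact: bbB|].
    apply: ler_wpM2r; first by rewrite subr_ge0; exact: (le 0%N t).
    by have /andP[_ h1] := Gab n t; have /andP[h2 _] := fab n t; lra.
  by rewrite (intg_Z (mE x)) ?ler_wpM2l// ?tailG//; exact: bbB.
have cGF := oint_cvg x bG GM cF.
apply/eqP; rewrite -subr_eq0; apply/eqP; apply: nrm_lt_eq0 => e e0.
have e30 : 0 < (e / 3) by rewrite divr_gt0.
have e32 : 0 < (e / 3) ^+ 2 by rewrite exprn_gt0.
have /cvgrPdist_lt/(_ _ e32)[N1 _ hN1] := cGF.
have /cvgrPdist_lt/(_ _ e32)[N2 _ hN2] := q_cvg ((b - a) * (4 * nrm x)).
have /cvgrPdist_lt/(_ _ e30)[N3 _ hN3] := q_cvg 1.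
pose n := maxn (maxn N1 N2) (maxn N3 j).
have n1 : (N1 <= n)%N by rewrite /n !leq_max leqnn.
have n2 : (N2 <= n)%N by rewrite /n !leq_max leqnn orbT.
have n3 : (N3 <= n)%N by rewrite /n !leq_max leqnn !orbT.
have nj : (j <= n)%N by rewrite /n !leq_max leqnn !orbT.
have {hN1} := hN1 n n1; have {hN2} := hN2 n n2; have {hN3} := hN3 n n3.
rewrite /= !sub0r !normrN mul1r (ger0_norm (ltW (q_gt0 n))) => k3 k2 k1.
have {}k1 : nrm (oi (G n) x - oi F x) < e / 3.
  rewrite -(@ltr_pXn2r _ 2) ?nnegrE ?nrm_ge0 ?(ltW e30)//.
  exact: le_lt_trans (ler_norm _) k1.
have {}k2 : nrm (oi (G n) x - oi (f n) x) < e / 3.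
  rewrite -(@ltr_pXn2r _ 2) ?nnegrE ?nrm_ge0 ?(ltW e30)//.
  apply: le_lt_trans (Gf n nj) _; apply: le_lt_trans (ler_norm _) _.
  by rewrite (_ : _ * _ = (b - a) * (4 * nrm x) * q n)//; ring.
have := fT n j nj; have := nrm_tri (oi F x) (oi (G n) x) (T x).
have := nrm_tri (oi (G n) x) (oi (f n) x) (T x); rewrite (nrmBC (oi F x) (oi (G n) x)) -/x.
lra.
Qed.

Let ordot f g x := @oint_rdot _ _ _ _ dot_norm _ As Acl _ muv mu_finite _ mE spectral f g x.
Let oae f g := @oint_ae _ _ _ _ dot_norm _ As Acl _ muv mu_finite _ mE spectral f g.
Let ole f g := @oint_le _ _ _ _ dot_norm _ As Acl _ muv mu_finite _ mE f g.

Lemma mu_ae_true (P : X -> Prop) : (forall t, P t) -> mu_ae mu P.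
Proof. by move=> hP; exists set0; split=> //; [exact: borel0|case: muv]. Qed.

Lemma mu_ae_and (P Q : X -> Prop) : mu_ae mu P -> mu_ae mu Q -> mu_ae mu (fun t => P t /\ Q t).
Proof.
move=> [N [bN muN PN]] [M [bM muM QM]]; exists (N `|` M); split; first exact: borelU.
  have nullP D := mu_null_qf dot_norm As muv mu_finite (N := D).
  apply/(nullP _ (borelU bN bM)) => x.
  have N0 := (nullP _ bN).1 muN x; have M0 := (nullP _ bM).1 muM x.
  apply/le_anti; rewrite (opm_ge0 As muv mu_finite x (borelU bN bM)) andbT.
  rewrite -(intg_indic (mE x) (borelU bN bM)).
  apply: le_trans (_ : E x (fun t => \1_N t + \1_M t) <= _).
    apply: (intg_le (mE x)); [by apply: bb_indic; exact: borelU|by apply: bbD;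
      exact: bb_indic|move=> t].
    by rewrite !indicE in_setU; case: (_ \in N); case: (_ \in M); rewrite /= ?addr0 ?add0r// lerDl.
  by rewrite (intg_D (mE x)); [rewrite !(intg_indic (mE x))// N0 M0 addr0|exact: bb_indic..].
by move=> t /not_orP[/PN ? /QM ?].
Qed.

Lemma mu_ae_imp (P Q : X -> Prop) : (forall t, P t -> Q t) -> mu_ae mu P -> mu_ae mu Q.
Proof. by move=> PQ [N [bN muN PN]]; exists N; split=> // t /PN/PQ. Qed.

(** With [k] the indicator of [g < f], the integral of the nonnegative [(f - g) k] at [x] is the
    form of [oi f - oi g] at [oi k x], hence at most 0; so [(f - g) k] vanishes almost everywhere.
    Conversely, [g] agrees almost everywhere with [max f g]. *)
Lemma oint_leP f g : bb f -> bb g -> qle (oi f) (oi g) <-> mu_ae mu (fun t => f t <= g t).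
Proof.
move=> bf bg; split=> h; last first.
  have bm := bb_max bf bg.
  have -> : oi g = oi (fun t => Num.max (f t) (g t)).
    by apply/(oae bg bm); apply: mu_ae_imp h => t fg; exact/esym/max_idPr.
  by apply: ole => // t; rewrite le_max lexx.
pose k : X -> R := \1_[set t | g t < f t]; pose p t := (f t - g t) * k t.
have bk : bb k by apply: bb_indic; exact: borel_ltr.
have bfg := bbB bf bg; have bp : bb p by exact: bbM.
have p0 t : 0 <= p t.
  rewrite /p /k indicE; case: (boolP (_ \in _)) => [/set_mem /= gf|_]; last by rewrite mulr0.
  by rewrite mulr1 subr_ge0 ltW.
have Ep x : E x p = 0.
  apply/le_anti; rewrite (intg_ge0 (mE x) bp p0) andbT.
  have -> : p = fun t => p t * k t.
    apply/funext => t; rewrite /p /k indicE; case: (_ \in _); by rewrite /= ?mulr1 ?mulr0.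
  rewrite -(ordot x bp bk) (omul bfg bk) (osub bf bg) /= opE; move: (oi k x) => y.
  by rewrite rdotBl subr_le0; exact: h.
have b0 : bb (fun=> 0) by exact: bb_cst.
have : oi p = oi (fun=> 0).
  apply: (sa_eq dot_norm As); [exact: osa|exact: osa|move=> x].
  by rewrite !oqf// Ep (intg_0 (mE x)).
move/(oae bp b0); apply: mu_ae_imp => t; rewrite /p /k indicE.
case: (boolP (t \in _)) => [/set_mem /= gf|]; last first.
  by move=> /negP nt _; rewrite leNgt; apply/negP => gf; apply: nt; exact: mem_set.
by rewrite mulr1 => /eqP; rewrite subr_eq0 => /eqP e; rewrite e ltxx in gf.
Qed.

Lemma ae_class_refl f : bb f -> ae_class mu f f.
Proof. by move=> bf; split=> //; exact: mu_ae_true. Qed.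

Lemma ae_class_oint f g : bb f -> ae_class mu f g -> bb g /\ oi g = oi f.
Proof. by move=> bf [bg fg]; split=> //; apply/esym/(oae bf bg). Qed.

Lemma Imu_class f : bb f -> Imu le sa mu (ae_class mu f) = oi f.
Proof.
move=> bf; have h : ae_class mu f (xget (cst 0) (ae_class mu f)).
  by apply: xgetPex; exists f; exact: ae_class_refl.
by have [] := ae_class_oint bf h.
Qed.

Lemma class_leP f g : bb f -> bb g ->
  class_le mu (ae_class mu f) (ae_class mu g) <-> le (oi f) (oi g).
Proof.
move=> bf bg; split=> [[u [v [/(ae_class_oint bf)[bu <-] /(ae_class_oint bg)[bv <-]]]] uv|h].
  by apply/(sa_leP As (osa bu) (osa bv)); exact/oint_leP.
exists f, g; split; [exact: ae_class_refl|exact: ae_class_refl|].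
by apply/oint_leP => //; apply/(sa_leP As (osa bf) (osa bg)).
Qed.

Lemma oint_sup (u : nat -> X -> R) f (M : R) : (forall n, bb (u n)) ->
  (forall n t, `|u n t| <= M) -> (forall n t, u n t <= u n.+1 t) ->
  (forall t, u n t @[n --> \oo] --> f t) -> is_sup le sa (range (fun n => oi (u n))) (oi f).
Proof.
move=> bu uM up cf; have bf := bb_lim bu uM cf.
apply/(sa_supP As); first by move=> _ [n _ <-]; exact: osa.
split; first exact: osa.
  move=> _ [n _ <-]; apply: ole => // t; rewrite -(cvg_lim _ (@cf t))//.
  apply: nondecreasing_cvgn_le; last exact: cvgP (@cf t).
  by apply/nondecreasing_seqP => k; exact: up.
move=> U sU hU x; rewrite (oqf x bf).
have h := intg_cvg (mE x) bu uM cf; rewrite -(cvg_lim _ h)//.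
apply: limr_le; first exact: cvgP h.
by apply: nearW => n; rewrite -(oqf x (bu n)); apply: hU; exists n.
Qed.

Lemma oint_opp f : bb f -> oi (fun t => - f t) = - oi f.
Proof.
move=> bf; rewrite -scaleN1r -(rmorphN1 (real_complex R)) -(oscale (-1) bf).
by congr oint; apply/funext => t; rewrite mulN1r.
Qed.

Lemma is_sup_opp (B : set (H -> H)) T : B `<=` sa -> is_sup le sa B (- T) ->
  is_inf le sa [set - S | S in B] T.
Proof.
move=> Bsa /(sa_supP As _ Bsa)[sT ub lub].
have sT' : sa T by rewrite -[T]opprK; exact: (sa_opp As).
split=> // [_ [S BS <-]|U sU hU].
  apply/(sa_leP As sT' (sa_opp As (Bsa _ BS))) => x.
  by have := ub S BS x; rewrite !qfN; lra.
have h : qle (- T) (- U).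
  apply: lub => [|S BS y]; first exact: (sa_opp As).
  have sNS := sa_opp As (Bsa _ BS).
  by have := (sa_leP As sU sNS).1 (hU _ (ex_intro2 _ _ S BS erefl)) y; rewrite !qfN; lra.
by apply/(sa_leP As sU sT') => x; have := h x; rewrite !qfN lerN2.
Qed.

Lemma oint_inf (u : nat -> X -> R) f (M : R) : (forall n, bb (u n)) ->
  (forall n t, `|u n t| <= M) -> (forall n t, u n.+1 t <= u n t) ->
  (forall t, u n t @[n --> \oo] --> f t) -> is_inf le sa (range (fun n => oi (u n))) (oi f).
Proof.
move=> bu uM down cf; have bf := bb_lim bu uM cf.
have -> : range (fun n => oi (u n)) = [set - S | S in range (fun n => oi (fun t => - u n t))].
  rewrite image_comp; congr (_ @` setT); apply/funext => n /=.
  by rewrite (oint_opp (bu n)) opprK.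
apply: is_sup_opp; first by move=> _ [n _ <-]; apply: osa; exact: bbN.
rewrite -(oint_opp bf); apply: (@oint_sup _ _ M) => [n|n t|n t|t]; first exact: bbN.
- by rewrite normrN.
- by rewrite lerN2.
- by apply: cvgN; exact: cf.
Qed.

Let clamped (a b : R) := [set f | Cc X R f /\ forall t, a <= f t <= b].

(** Keeping the range [[a, b]] in the conclusion lets [a = 0] settle the positive cone. *)
Lemma down_up_clamped (a b : R) T xi : separating A xi -> a <= 0 <= b -> sa T ->
  (forall y, a * nrm y ^+ 2 <= qf T y <= b * nrm y ^+ 2) ->
  seq_down le sa (seq_up le sa (pR @` clamped a b)) T.
Proof.
move=> sep ab sT hT.
have [g [G [F [cg [gab Gab] [gup gG] [Gdown GF] <-]]]] :=
  clamped_limsup sep ab sT hT.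
have gM n k t := norm_clamped ab (gab n k t); have GM n t := norm_clamped ab (Gab n t).
have bg n k := bb_Cc (cg n k).
have bG n := bb_lim (bg n) (gM n) (gG n).
exists (fun n => oi (G n)); split; last by apply: oint_inf GF.
  move=> n; exists (fun k => oi (g n k)); split; last by apply: oint_sup (gG n).
    by move=> k; exists (g n k); [split|exact: piR_oint].
  by move=> k; apply/(sa_leP As (osa (bg _ _)) (osa (bg _ _))); apply: ole.
by move=> n; apply/(sa_leP As (osa (bG _)) (osa (bG _))); apply: ole.
Qed.

(** The construction for [- T] with bounds [- b] and [- a], negated: increasing and decreasing
    sequences trade places. *)
Lemma up_down_clamped (a b : R) T xi : separating A xi -> a <= 0 <= b -> sa T ->
  (forall y, a * nrm y ^+ 2 <= qf T y <= b * nrm y ^+ 2) ->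
  seq_up le sa (seq_down le sa (pR @` clamped a b)) T.
Proof.
move=> sep ab sT hT; have ab' : - b <= 0 <= - a by rewrite oppr_le0 oppr_ge0 andbC.
have hT' y : - b * nrm y ^+ 2 <= qf (- T) y <= - a * nrm y ^+ 2.
  by rewrite qfN !mulNr !lerN2 andbC.
have [g [G [F [cg [gab Gab] [gup gG] [Gdown GF] FT]]]] :=
  clamped_limsup sep ab' (sa_opp As sT) hT'.
have gM n k t := norm_clamped ab' (gab n k t); have GM n t := norm_clamped ab' (Gab n t).
have bg n k := bb_Cc (cg n k).
have bG n := bb_lim (bg n) (gM n) (gG n).
have bF := bb_lim bG GM GF.
have -> : T = oi (fun t => - F t) by rewrite (oint_opp bF) FT opprK.
have bGN n := bbN (bG n); have bgN n k := bbN (bg n k).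
exists (fun n => oi (fun t => - G n t)); split.
- move=> n; exists (fun k => oi (fun t => - g n k t)); split.
  + move=> k; have c : Cc X R (fun t => - g n k t).
      by apply: (Cc_comp (phi := -%R)) (cg n k); [move=> r; exact: opp_continuous|exact: oppr0].
    exists (fun t => - g n k t); last exact: piR_oint.
    by split=> // t; rewrite lerNr lerNl andbC.
  + by move=> k; apply/(sa_leP As (osa (bgN _ _)) (osa (bgN _ _))); apply: ole => // t;
    rewrite lerN2.
  + apply: (oint_inf (M := - a - - b)) => [//|k t|k t|t]; rewrite ?normrN ?lerN2//.
    by apply: cvgN; exact: gG.
- by move=> n; apply/(sa_leP As (osa (bGN _)) (osa (bGN _))); apply: ole => // t; rewrite lerN2.
- apply: (oint_sup (M := - a - - b)) => [//|k t|k t|t]; rewrite ?normrN ?lerN2//.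
  by apply: cvgN; exact: GF.
Qed.

Lemma oint_surjective T xi : separating A xi -> sa T -> exists2 f, bb f & oi f = T.
Proof.
move=> sep sT; have [c c0 hc] := qf_bound dot_norm (sa_bounded As (proj1 sT)).
have ab : - c <= 0 <= c by rewrite oppr_le0 (ltW c0).
have hT y : - c * nrm y ^+ 2 <= qf T y <= c * nrm y ^+ 2.
  by have := hc y; rewrite ler_norml mulNr.
have [g [G [F [cg [gab Gab] [gup gG] [Gdown GF] FT]]]] :=
  clamped_limsup sep ab sT hT.
have gM n k t := norm_clamped ab (gab n k t); have GM n t := norm_clamped ab (Gab n t).
have bG n := bb_lim (fun k => bb_Cc (cg n k)) (gM n) (gG n).
by exists F => //; exact: bb_lim bG GM GF.
Qed.

End representing_measure.

(** * Complex-valued functions *)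

Section complex_integral.
Context {R : realType} {X : topologicalType} {H : completeNormedModType R[i]}.
Context (hX : hausdorff_space X) (lX : locally_compact [set: X]).
Context (dot : {dot H for Num.conj}).
Context (dot_norm : forall x : H, dot x x = `|x| ^+ 2).
Context (pi : (X -> R[i]) -> H -> H) (pi_hom : star_homomorphism dot pi).
Local Notation A := (sot_closure (pi @` C0 X R[i])).
Local Notation sa := (sa_part dot A).
Local Notation qf := (qf dot).
Local Notation le := (op_le dot).
Context (mu : set X -> option (H -> H)).
Context (rep : represents dot sa mu pi).
Local Notation bbC := (bounded_borel X R[i]).
Local Notation ic := ((0 +i* 1)%C : R[i]).
Local Notation mop := (opm mu).
Local Notation oi := (oint le sa mu).
Implicit Types (x y z : H) (S T : H -> H) (D : set X) (u v : X -> R) (f g : X -> R[i]) (t : X).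

Let As := closure_alg dot_norm pi_hom.
Let Acl T : bounded_op T -> sot_approx A T -> A T.
Proof. exact: closure_closed. Qed.
Let muv := rep_vmeasure rep.
Let mu_fin := mu_finite hX lX dot_norm pi_hom rep.

Context (E : H -> (X -> R) -> R).
Context (mE : forall x, is_integral (fun D => qf (mop D) x) (E x)).
Let spec := spectral hX lX dot_norm pi_hom rep mE.
Let osa u := @oint_sa _ _ _ _ dot_norm _ As Acl _ muv mu_fin _ mE u.
Let omul u v := @oint_mul _ _ _ _ dot_norm _ As Acl _ muv mu_fin _ mE spec u v.
Let osub u v := @oint_sub _ _ _ _ dot_norm _ As Acl _ muv mu_fin _ mE u v.
Let oscale a u := @oint_scale _ _ _ _ dot_norm _ As Acl _ muv mu_fin _ mE a u.
Let oae u v := @oint_ae _ _ _ _ dot_norm _ As Acl _ muv mu_fin _ mE spec u v.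
Let oadd u v := @oint_add _ _ _ _ dot_norm _ As Acl _ muv mu_fin _ mE u v.
Local Notation oC := (ointC le sa mu).
Local Notation IC := (ImuC le sa mu).
Local Notation cl := (ae_class mu (K := R[i])).

Lemma ae_ReIm f g : mu_ae mu (fun t => f t = g t) <->
  mu_ae mu (fun t => Ref f t = Ref g t) /\ mu_ae mu (fun t => Imf f t = Imf g t).
Proof.
split=> [h|[h1 h2]]; last first.
  apply: mu_ae_imp (mu_ae_and hX lX dot_norm pi_hom rep mE h1 h2) => t [].
  by rewrite /Ref /Imf; case: (f t) => a b; case: (g t) => c d /= -> ->.
by split; apply: mu_ae_imp h => t; rewrite /Ref /Imf => ->.
Qed.

Lemma ointCE f : oC f = oi (Ref f) + ic *: oi (Imf f).
Proof. by []. Qed.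

(** Uniqueness of real and imaginary parts of an operator splits the complex equality into two real
    ones. *)
Lemma ointC_eq f g : bbC f -> bbC g -> mu_ae mu (fun t => f t = g t) <-> oC f = oC g.
Proof.
move=> /bbC_ReIm[rf jf] /bbC_ReIm[rg jg]; rewrite ae_ReIm !ointCE; split=> [[h1 h2]|].
  by rewrite ((oae rf rg).1 h1) ((oae jf jg).1 h2).
by move=> /(cartesian_unique dot_norm As (osa rf) (osa jf) (osa rg) (osa jg))[/oae h1 /oae h2];
  split; [exact: h1|exact: h2].
Qed.

Lemma ImuC_class f : bbC f -> IC (cl f) = oC f.
Proof.
move=> bf; have [bg fg] : cl f (xget (cst 0) (cl f)).
  by apply: xgetPex; exists f; split=> //; exact: (mu_ae_true rep).
exact/esym/(ointC_eq bf bg).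
Qed.

Lemma class_eq f g : mu_ae mu (fun t => f t = g t) -> cl f = cl g.
Proof.
have sub f' g' : mu_ae mu (fun t => f' t = g' t) -> cl f' `<=` cl g'.
  move=> fg h [bh fh]; split=> //; apply: mu_ae_imp (mu_ae_and hX lX dot_norm pi_hom rep mE fg fh).
  by move=> t [<-].
by move=> fg; apply/seteqP; split; apply: sub => //; apply: mu_ae_imp fg.
Qed.

Lemma ointC_alg f : bbC f -> A (oC f).
Proof.
move=> /bbC_ReIm[rf jf]; rewrite ointCE; apply: (alg_add As); first by case: (osa rf).
by apply: (alg_scale As); case: (osa jf).
Qed.

Lemma ointC_surjective T xi : separating A xi -> A T -> exists2 f, bbC f & oC f = T.
Proof.
move=> sep /(cartesian As)[U [V [sU sV ->]]].
have [u bu <-] := oint_surjective hX lX dot_norm pi_hom rep mE sep sU.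
have [v bv <-] := oint_surjective hX lX dot_norm pi_hom rep mE sep sV.
by exists (fun t => (u t +i* v t)%C) => //; apply/bbC_ReIm.
Qed.

Lemma ointC_integrable f : bbC f -> ointegrableC le sa mu f.
Proof.
by move=> /bbC_ReIm[rf jf]; split;
  [have [] := oint_qf dot_norm As Acl muv mu_fin mE rf|have [] := oint_qf dot_norm As Acl muv mu_fin mE jf].
Qed.

Lemma ointC_lin (a : R[i]) f g : bbC f -> bbC g -> oC (a *: f + g) = a *: oC f + oC g.
Proof.
move=> /bbC_ReIm[rf jf] /bbC_ReIm[rg jg]; rewrite !ointCE; case: a => p q.
rewrite Ref_lin Imf_lin.
rewrite complex_scale (oadd (bbB (bbZ p rf) (bbZ q jf)) rg) (osub (bbZ p rf) (bbZ q jf)).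
rewrite (oadd (bbD (bbZ p jf) (bbZ q rf)) jg) (oadd (bbZ p jf) (bbZ q rf)).
rewrite (oscale p rf) (oscale q rf) (oscale p jf) (oscale q jf).
move: (oi (Ref f)) (oi (Imf f)) (oi (Ref g)) (oi (Imf g)) => U V U' V'.
by rewrite [ic *: (_ + V')]scalerDr addrACA.
Qed.

Lemma ointC_mul f g : bbC f -> bbC g -> oC (f \* g) = oC f \o oC g.
Proof.
move=> /bbC_ReIm[rf jf] /bbC_ReIm[rg jg]; rewrite !ointCE.
rewrite Ref_mul Imf_mul.
rewrite (osub (bbM rf rg) (bbM jf jg)) (oadd (bbM rf jg) (bbM jf rg)).
rewrite (omul rf rg) (omul rf jg) (omul jf rg) (omul jf jg).
have lr := sa_linear As (osa rf); have lj := sa_linear As (osa jf).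
move: lr lj; move: (oi (Ref f)) (oi (Imf f)) (oi (Ref g)) (oi (Imf g)) => U V U' V' lU lV.
apply/funext => x; rewrite /= !opE /= !(linD _ _ lU) !(linD _ _ lV) !(linZ _ _ lU) !(linZ _ _ lV).
rewrite !scalerDr !scalerA.
have -> : ic * ic = -1 by apply/eqP; rewrite eq_complex /=; apply/andP; split; apply/eqP; ring.
by rewrite scaleN1r addrACA (addrC (ic *: V (U' x))) [in RHS]addrACA addrACA -!addrA;
  congr (_ + _); rewrite addrCA.
Qed.

Lemma ointC_adjoint f : bbC f -> is_adjoint dot (oC f) (oC (fun t => Num.conj (f t))).
Proof.
move=> bf; have [lC _] := sa_bounded As (ointC_alg (bbC_conj bf)).
apply/(is_adjointP dot _ lC) => x y; move: bf => /bbC_ReIm[rf jf]; rewrite !ointCE.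
rewrite Ref_conj Imf_conj.
rewrite (oint_opp hX lX dot_norm pi_hom rep mE jf) !opE scalerN rdotDl rdotBr rdot_i.
rewrite (sa_sym As _ _ (osa rf)) (sa_sym As _ _ (osa jf)).
by rewrite (linZ _ _ (sa_linear As (osa jf))).
Qed.

Lemma integral_star_isomorphism xi : separating A xi -> star_isomorphism dot mu A IC.
Proof.
move=> sep; split.
- split.
  + by move=> _ [f bf <-]; rewrite ImuC_class//; exact: ointC_alg.
  + move=> c d /set_mem[f bf <-] /set_mem[g bg <-]; rewrite !ImuC_class// => e.
    by apply: class_eq; apply/ointC_eq.
  + move=> T /(ointC_surjective sep)[f bf <-]; exists (cl f); first by exists f.
    exact: ImuC_class.
- by move=> a f g bf bg; rewrite !ImuC_class// ?ointC_lin//; exact: bbC_lin.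
- by move=> f g bf bg; rewrite !ImuC_class// ?ointC_mul//; exact: bbC_mul.
- by move=> f bf; rewrite !ImuC_class//; [exact: ointC_adjoint|exact: bbC_conj].
Qed.

End complex_integral.

(** * Monotone limits under order isomorphisms *)

Section order_images.
Context {T1 T2 : Type} (le1 : T1 -> T1 -> Prop) (le2 : T2 -> T2 -> Prop).
Context (F1 S : set T1) (F2 : set T2) (J : T1 -> T2).

(** Suprema are relative to [F1] and [F2]: since [J] maps [F1] onto [F2], every competing upper
    bound in [F2] can be pulled back. *)
Lemma seq_up_image : J @` F1 = F2 -> (forall c d, F1 c -> F1 d -> le1 c d <-> le2 (J c) (J d)) ->
  S `<=` F1 -> J @` seq_up le1 F1 S = seq_up le2 F2 (J @` S).
Proof.
move=> JF Jle SF; apply/seteqP; split=> [_ [c [s [Ss sup [Fc ub lub]] <-]]|x [u [Su uup [Fx ub lub]]]].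
  exists (J \o s); split.
  - by move=> n; exists (s n).
  - by move=> n /=; apply/Jle; [exact: SF|exact: SF|].
  - split.
    + by rewrite -JF; exists c.
    + by move=> _ [n _ <-]; apply/Jle; [exact: SF|by []|apply: ub; exists n].
    + rewrite -JF => _ [d Fd <-] hd; apply/Jle => //; apply: lub => // _ [n _ <-].
      by apply/Jle; [exact: SF|by []|apply: hd; exists n].
have /choice[s hs] : forall n, exists c, S c /\ J c = u n by move=> n; have [c ? ?] := Su n;
  exists c.
move: Fx; rewrite -JF => -[c Fc Jc].
have Fs n : F1 (s n) by apply: SF; case: (hs n).
have Js n : J (s n) = u n by case: (hs n).
exists c => //; exists s; split.
- by move=> n; case: (hs n).
- by move=> n; apply/Jle => //; rewrite !Js.
- split=> // [_ [n _ <-]|d Fd hd].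
    by apply/Jle => //; rewrite Js Jc; apply: ub; exists n.
  apply/Jle => //; rewrite Jc; apply: lub; first by rewrite -JF; exists d.
  by move=> _ [n _ <-]; rewrite -Js; apply/Jle => //; apply: hd; exists n.
Qed.

End order_images.

(** [is_inf] and [seq_down] are, by conversion, [is_sup] and [seq_up] for the reversed order. *)
Lemma seq_down_image (T1 T2 : Type) (le1 : T1 -> T1 -> Prop) (le2 : T2 -> T2 -> Prop)
    (F1 S : set T1) (F2 : set T2) (J : T1 -> T2) :
  J @` F1 = F2 -> (forall c d, F1 c -> F1 d -> le1 c d <-> le2 (J c) (J d)) ->
  S `<=` F1 -> J @` seq_down le1 F1 S = seq_down le2 F2 (J @` S).
Proof.
move=> JF Jle; apply: (@seq_up_image _ _ (fun x y => le1 y x) (fun x y => le2 y x)) => // c d Fc Fd.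
exact: Jle.
Qed.

Section monotonicity.
Context {T : Type} (le : T -> T -> Prop) (F : set T).

Lemma seq_up_mono S S' : S `<=` S' -> seq_up le F S `<=` seq_up le F S'.
Proof. by move=> SS' x [s [Ss up sup]]; exists s; split=> // n; exact: SS'. Qed.

Lemma seq_down_mono S S' : S `<=` S' -> seq_down le F S `<=` seq_down le F S'.
Proof. by move=> SS' x [s [Ss up sup]]; exists s; split=> // n; exact: SS'. Qed.

Lemma seq_up_sub S : seq_up le F S `<=` F.
Proof. by move=> x [s [_ _ []]]. Qed.

Lemma seq_down_sub S : seq_down le F S `<=` F.
Proof. by move=> x [s [_ _ []]]. Qed.

(** An increasing limit dominates its first term. Together with [seq_down_ge] this keeps iterated
    limits of positive elements positive. *)
Lemma seq_up_ge S z : (forall x y, F x -> F y -> le z x -> le x y -> le z y) -> S `<=` F ->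
  (forall x, S x -> le z x) -> forall x, seq_up le F S x -> le z x.
Proof.
move=> tr SF zS x [s [Ss _ [Fx ub _]]]; apply: (tr (s 0%N)) => //; [exact: SF|exact: zS|].
by apply: ub; exists 0%N.
Qed.

Lemma seq_down_ge S z : F z -> (forall x, S x -> le z x) -> forall x, seq_down le F S x -> le z x.
Proof. by move=> Fz zS x [s [Ss _ [_ _ glb]]]; apply: glb => // _ [n _ <-]; exact: zS. Qed.

End monotonicity.

Lemma closure_nondegenerate (R : realType) (X : topologicalType) (H : completeNormedModType R[i])
    (pi : (X -> R[i]) -> H -> H) T x :
  sot_closure (pi @` C0 X R[i]) T -> nondegenerate_part pi (T x).
Proof.
move=> /sot_closureP[_ aT]; apply: closure_nrm => e e0.
have [_ [f cf <-] h] := aT [:: x] e e0; exists (pi f x); last by rewrite h ?mem_head.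
exists 1%N, (fun=> 1), (fun=> pi f x); split=> [_|]; first by exists f => //; exists x.
by rewrite big_ord1 scale1r.
Qed.

Theorem theorem7p9 (R : realType)
    (X : topologicalType)
    (X_hausdorff : hausdorff_space X)
    (X_loc_compact : locally_compact [set: X])
    (H : completeNormedModType R[i])
    (dot : {dot H for Num.conj})
    (dot_norm : forall x : H, dot x x = `|x| ^+ 2)
    (pi : (X -> R[i]) -> H -> H)
    (pi_hom : star_homomorphism dot pi)
    (mu : set X -> option (H -> H)) :
  let piR := fun f : X -> R => pi (toC f) in
  let A := sot_closure (pi @` C0 X R[i]) in
  let Asa := sa_part dot A in
  let Asa_pos := sa_pos dot A in
  let le := op_le dot in
  let up := seq_up le Asa in
  let down := seq_down le Asa in
  let B := bspace mu R in
  let Bpos := bspace_pos mu in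
  let up_B := seq_up (class_le mu) B in
  let down_B := seq_down (class_le mu) B in
  let I := Imu le Asa mu in
  let IC := ImuC le Asa mu in
  represents dot Asa mu pi ->
  [/\ Asa = sot_closure (piR @` C0 X R),
      countable_sup_property le Asa Asa_pos <-> algebra_sigma_finite dot A,
      separable_set (nondegenerate_part pi) ->
        countable_sup_property le Asa Asa_pos
    & countable_sup_property le Asa Asa_pos ->
      [/\ A = IC @` bspace mu R[i],
          [/\ Asa = I @` B,
              Asa = down (up (piR @` Cc X R))
            & Asa = up (down (piR @` Cc X R))],
          [/\ Asa_pos = I @` Bpos,
              Asa_pos = I @` up_B (down_B (ae_class mu @` Cc_pos X R)),
              Asa_pos = up (down (piR @` Cc_pos X R)),
              Asa_pos = I @` down_B (up_B (ae_class mu @` Cc_pos X R))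
            & Asa_pos = down (up (piR @` Cc_pos X R))]
        & (forall f, bounded_borel X R[i] f ->
             ointegrableC le Asa mu f /\
             IC (ae_class mu f) = ointC le Asa mu f) /\
          star_isomorphism dot mu A IC]].
Proof.
move=> piR0 A Asa Asa_pos le up down B Bpos up_B down_B I IC rep.
have As : star_alg dot A := closure_alg dot_norm pi_hom.
have Acl T : bounded_op T -> sot_approx A T -> A T by exact: closure_closed.
have muv := rep_vmeasure rep.
have mu_fin := mu_finite X_hausdorff X_loc_compact dot_norm pi_hom rep.
have [E mE] := qf_integrals_exist dot_norm As Acl muv mu_fin.
(* Sigma-finiteness and separability each produce a separating sequence, and such a sequence yields
   the countable sup property. *)
have sep_csp xi : separating A xi -> countable_sup_property le Asa Asa_pos.
  exact: separating_csp.
split.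
- exact: sa_closure_piR.
- split; first exact: csp_sigma_finite.
  by move=> /(sigma_finite_separating dot_norm As Acl)[xi /sep_csp].
- move=> sepN; have [xi /sep_csp//] := separable_separating dot_norm As
    (fun T x (AT : A T) => closure_nondegenerate (x := x) AT) sepN.
move=> /(csp_sigma_finite dot_norm As Acl)/(sigma_finite_separating dot_norm As Acl)[xi sep].
have osa f := @oint_sa _ _ _ _ dot_norm _ As Acl _ muv mu_fin _ mE f.
have Icl f := @Imu_class _ _ _ X_hausdorff X_loc_compact _ dot_norm _ pi_hom _ rep _ mE f.
have clle f g := @class_leP _ _ _ X_hausdorff X_loc_compact _ dot_norm _ pi_hom _ rep _ mE f g.
have Isur T := @oint_surjective _ _ _ X_hausdorff X_loc_compact _ dot_norm _ pi_hom _ rep _ mE T xi sep.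
have iso := integral_star_isomorphism X_hausdorff X_loc_compact dot_norm pi_hom rep mE sep.
have IB : I @` B = Asa.
  apply/seteqP; split=> [_ [_ [f bf <-] <-]|T /Isur[f bf <-]].
    by rewrite /I Icl//; exact: osa.
  by exists (ae_class mu f); [exists f|exact: Icl].
have Ile c d : B c -> B d -> class_le mu c d <-> le (I c) (I d).
  by move=> [f bf <-] [g bg <-]; rewrite /I !Icl//; exact: clle.
have piB f : Cc X R f -> I (ae_class mu f) = piR0 f.
  by move=> cf; rewrite /I Icl; [exact/esym/(piR_oint rep)|exact: bb_Cc].
have sC : piR0 @` Cc X R `<=` Asa.
  by move=> _ [f cf <-]; exact: (piR_sa_closure pi_hom (Cc_C0 cf)).
have CpC : Cc_pos X R `<=` Cc X R by move=> f [].
have sCp : piR0 @` Cc_pos X R `<=` Asa by move=> T [f /CpC cf <-]; apply: sC; exists f.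
have clB : ae_class mu @` Cc_pos X R `<=` B.
  by move=> _ [f /CpC cf <-]; exists f => //; exact: bb_Cc.
have Icl_pos : I @` (ae_class mu @` Cc_pos X R) = piR0 @` Cc_pos X R.
  rewrite image_comp; apply/seteqP; split=> _ [f fp <-]; exists f => //=.
    by rewrite piB//; exact: CpC.
  by rewrite piB//; exact: CpC.
have sa0 := sa_zero As.
have le_tr S T U : Asa S -> Asa T -> Asa U -> le S T -> le T U -> le S U.
  move=> sS sT sU /(sa_leP As sS sT) h1 /(sa_leP As sT sU) h2.
  by apply/(sa_leP As sS sU); exact: qle_trans h1 h2.
have pos0 T : (piR0 @` Cc_pos X R) T -> le 0 T.
  move=> [f [cf f0] <-]; have sf := piR_sa_closure pi_hom (Cc_C0 cf).
  by apply/(sa_leP As sa0 sf) => x; rewrite qf0; exact: (piR_ge0 dot_norm pi_hom (Cc_C0 cf)).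
have bnd T : Asa T -> exists2 c : R, 0 < c & forall y, - c * nrm y ^+ 2 <= qf dot T y <= c * nrm y ^+ 2.
  move=> sT; have [c c0 hc] := qf_bound dot_norm (sa_bounded As (proj1 sT)).
  by exists c => // y; have := hc y; rewrite ler_norml mulNr.
(* The lower bound is 0 instead of [- c], so the approximating functions come out nonnegative. *)
have bndp T : Asa_pos T -> exists2 c : R, 0 < c & forall y, 0 * nrm y ^+ 2 <= qf dot T y <= c * nrm y ^+ 2.
  move=> [sT /(sa_leP As sa0 sT) T0]; have [c c0 hc] := bnd T sT; exists c => // y.
  by have /andP[_ ->] := hc y; rewrite mul0r andbT; have := T0 y; rewrite qf0.
have updown_pos : Asa_pos = up (down (piR0 @` Cc_pos X R)).
  apply/seteqP; split=> T.
    move=> pT; have [sT _] := pT; have [c c0 hc] := bndp T pT.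
    have ab : (0 : R) <= 0 <= c by rewrite lexx ltW.
    have := up_down_clamped X_hausdorff X_loc_compact dot_norm pi_hom rep mE sep ab sT hc.
    apply: seq_up_mono; apply: seq_down_mono => _ [f [cf fb] <-]; exists f => //.
    by split=> // t; have /andP[] := fb t.
  move=> uT; split; first exact: seq_up_sub uT.
  apply: (@seq_up_ge _ le Asa _ _ _ _ _ _ uT).
  - by move=> S U sS sU; exact: le_tr.
  - exact: seq_down_sub.
  - exact: seq_down_ge.
have downup_pos : Asa_pos = down (up (piR0 @` Cc_pos X R)).
  apply/seteqP; split=> T.
    move=> pT; have [sT _] := pT; have [c c0 hc] := bndp T pT.
    have ab : (0 : R) <= 0 <= c by rewrite lexx ltW.
    have := down_up_clamped X_hausdorff X_loc_compact dot_norm pi_hom rep mE sep ab sT hc.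
    apply: seq_down_mono; apply: seq_up_mono => _ [f [cf fb] <-]; exists f => //.
    by split=> // t; have /andP[] := fb t.
  move=> uT; split; first exact: seq_down_sub uT.
  apply: (@seq_down_ge _ le Asa _ _ sa0 _ _ uT).
  apply: seq_up_ge => //.
  by move=> S U sS sU; exact: le_tr.
split.
- have [[fun_ _ sur] _ _ _] := iso.
  by apply/seteqP; split=> [T /sur|_ [c Bc <-]] //; exact: fun_.
- split; first by rewrite IB.
  + apply/seteqP; split=> T; last exact: seq_down_sub.
    move=> sT; have [c c0 hc] := bnd T sT.
    have ab : - c <= 0 <= c by rewrite oppr_le0 (ltW c0).
    have := down_up_clamped X_hausdorff X_loc_compact dot_norm pi_hom rep mE sep ab sT hc.
    by apply: seq_down_mono; apply: seq_up_mono => _ [f [cf _] <-]; exists f.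
  + apply/seteqP; split=> T; last exact: seq_up_sub.
    move=> sT; have [c c0 hc] := bnd T sT.
    have ab : - c <= 0 <= c by rewrite oppr_le0 (ltW c0).
    have := up_down_clamped X_hausdorff X_loc_compact dot_norm pi_hom rep mE sep ab sT hc.
    by apply: seq_up_mono; apply: seq_down_mono => _ [f [cf _] <-]; exists f.
- split=> //.
  + have b0 : bounded_borel X R (cst 0) by exact: bb_cst.
    have B0 : B (ae_class mu (cst 0)) by exists (cst 0).
    (* [cst 0] has compact support, so its class is sent to [pi 0 = 0], and positivity of classes
       transports along [Ile]. *)
    have I0 : I (ae_class mu (cst 0)) = 0.
      rewrite piB; last exact: Cc0.
      by rewrite /piR0 -(pi0 pi_hom); congr pi; apply/funext.
    apply/seteqP; split=> [T [sT T0]|_ [c [Bc c0] <-]].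
      move: sT T0; rewrite -[sa_part _ _]IB => -[c Bc <-] c0; exists c => //; split=> //.
      by apply/Ile => //; rewrite I0.
    by split; [rewrite -[sa_part _ _]IB; exists c|rewrite -I0; exact/Ile].
  (* By [IB] and [Ile], [I] is an order isomorphism of [B] onto [Asa], so iterated limits of classes
     become iterated limits of operators. *)
  + rewrite /up_B /down_B (seq_up_image IB Ile); last exact: seq_down_sub.
    by rewrite (seq_down_image IB Ile clB) Icl_pos.
  + rewrite /up_B /down_B (seq_down_image IB Ile); last exact: seq_up_sub.
    by rewrite (seq_up_image IB Ile clB) Icl_pos.
- split; last exact: iso.
  move=> f bf; split; first exact: (ointC_integrable X_hausdorff X_loc_compact dot_norm pi_hom rep mE).
  exact: (ImuC_class X_hausdorff X_loc_compact dot_norm pi_hom rep mE).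
Qed.
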